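(* Let $\Gamma=(\Gamma,\epsilon)$ be an OMS-divide. Then its polynomial $W_\Gamma$ and the graded Euler characteristic of its Khovanov homology $\mathcal H(\Gamma)$ are related by $$W_\Gamma(t^2)=\frac{t}{1+t^2}\,\chi_{gr}(\mathcal H(\Gamma))=\frac{t}{1+t^2}\sum_{i\in\mathbb Z}(-1)^i\dim_{gr}\mathcal H_i(\Gamma),$$ where $\dim_{gr}\mathcal H_i(\Gamma)=\sum_{j\in\mathbb Z}t^j\dim_{\mathbb Z_2}\mathcal H_{i,j}(\Gamma)$.
   Context: **OMS-divides.** Let $D^2$ be the unit disc of $\mathbb R^2$. A divide is the image $\Gamma$ of a proper generic immersion $(J,\partial J)\to(D^2,\partial D^2)$, where $J$ is a disjoint union of finitely many copies of $[0,1]$ and of the circle; generic means that the only singularities are ordinary double points and that $\Gamma$ meets $\partial D^2$ transversally. An OMS-divide (ordered Morse signed divide) $(\Gamma,\epsilon)$, often written $\Gamma$, is a divide $\Gamma$ with a sign $\epsilon(p)\in\{+,-\}$ at each double point $p$, such that for some $a,b\in\,]0,1[$ with $a^2+b^2<1$: (1) $\Gamma\subset\{|y|<b\}$ and the restriction to $\Gamma$ of $\rho(x,y)=x$ is a Morse function; (2) all double points lie in $]-a,a[\times]-b,b[$; (3) all maxima (resp. minima) of $\rho|_\Gamma$, called vertical tangent points, have $x=a$ (resp. $x=-a$). Double points and vertical tangent points are the singular points. One considers only the part of $\Gamma$ in $[-a,a]\times[-b,b]$, rescaled to $[-1,1]\times[-1,1]$. The end points of $\Gamma$ are the points of $\Gamma$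 on $\{-1,1\}\times[-1,1]$ without vertical tangent. **Splittings.** Near a double point there are two half-branches to the left and two to the right. $\Theta_0$ replaces the double point by two disjoint arcs that are graphs over the $x$-axis (upper left joined to upper right, lower left joined to lower right). $\Theta_1$ joins the two left half-branches to each other in a horizontal cusp and the two right half-branches to each other in a horizontal cusp, the two resulting arcs being disjoint. At a vertical tangent point (on $x=\pm1$), $\Theta_0$ cuts the curve there, so that the two half-branches acquire two distinct end points on $x=\pm1$; $\Theta_1$ replaces the vertical tangent by a horizontal cusp, so that the two half-branches stay joined and no end point is created. **States.** A state $S$ of $\Gamma$ is a choice of $\Theta_0$ or $\Theta_1$ at each singular point, together with the resulting diagram; $\mathrm{St}(\Gamma)$ is the set of states. Let $\mathrm{cl}(S)$ and $\mathrm{op}(S)$ be the numbers of closed components and of open components (those with two end points) of $S$. Let $n_+,n_-,n_0$ be the numbers of positive double points, negative double points and vertical tangent points of $\Gamma$, and $w(\Gamma)=2n_+-2n_-+n_0$. Let $r_+(S),r_-(S),r_0(S)$ be the numbers of $\Theta_1$ splittings in $S$ at positive double points, negative double points and vertical tangent points. Put $i(S)=r_+(S)-r_-(S)+r_0(S)$ and $k(S)=w(\Gamma)+2i(S)-r_0(S)$. An enhanced state $\widetilde S$ is a state $S$ with a sign $+$ or $-$ on each component; $i(\widetilde S)=i(S)$, and its degree is $j(\widetilde S)=k(S)+2\delta_{cl}(\widetilde S)+\delta_{op}(\widetilde S)$, where $\delta_{cl}$ (resp. $\delta_{op}$) is the number of positive minus the number of negative closed (resp. open) components. **Polynomial.**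 In the variable $\sqrt t$, $$W_\Gamma(t)=\sum_{S\in\mathrm{St}(\Gamma)}(-1)^{i(S)}(\sqrt t)^{k(S)}\Big(\frac1t+t\Big)^{\mathrm{cl}(S)}\Big(\frac1{\sqrt t}+\sqrt t\Big)^{\mathrm{op}(S)-1};$$ $W_\Gamma(t^2)$ is obtained by substituting $t$ for $\sqrt t$. **Complex and homology.** $[\![\Gamma]\!]_{i,j}$ is the $\mathbb Z_2$-vector space with basis the enhanced states $\widetilde S$ with $i(\widetilde S)=i$, $j(\widetilde S)=j$. The differential $d_{i,j}:[\![\Gamma]\!]_{i,j}\to[\![\Gamma]\!]_{i+1,j}$ sends $\widetilde S$ to the sum of all contributions obtained as follows: choose a singular point $p$ at which $S$ uses $\Theta_0$ if $p$ is a positive double point or a vertical tangent point, or $\Theta_1$ if $p$ is a negative double point; switch the splitting at $p$ (to $\Theta_1$, resp. $\Theta_0$); keep the signs of the components not involved; and change the signs of the components involved by the rule below ($\mapsto$ a sum means the sum of the corresponding enhanced states). If $p$ is a double point: two open components become two open components: $(+,+)\mapsto(+,-)+(-,+)$, $(+,-)\mapsto(-,-)$, $(-,+)\mapsto(-,-)$, $(-,-)\mapsto0$; one open becomes one open and one closed: $\pm\mapsto(\text{open }\pm,\text{closed }-)$; one open and one closed become one open: $(\text{open }\pm,\text{closed }+)\mapsto\pm$, $(\text{open }\pm,\text{closed }-)\mapsto0$; one closed becomes two closed: $+\mapsto(+,-)+(-,+)$, $-\mapsto(-,-)$; two closed become one closed: $(+,+)\mapsto+$, $(+,-)$ and $(-,+)\mapsto-$,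 $(-,-)\mapsto0$. If $p$ is a vertical tangent point: one open becomes one closed: $+\mapsto0$, $-\mapsto-$; two open become one open: $(+,+)\mapsto+$, $(+,-)$ and $(-,+)\mapsto-$, $(-,-)\mapsto0$. Then $d\circ d=0$; $\mathcal H_{i,j}(\Gamma)=\ker d_{i,j}/\operatorname{im}d_{i-1,j}$, $\mathcal H_i(\Gamma)=\bigoplus_j\mathcal H_{i,j}(\Gamma)$, and $\mathcal H(\Gamma)=(\mathcal H_i(\Gamma))_{i\in\mathbb Z}$ is the Khovanov homology of $\Gamma$. *)

(* Defs.v *)
From mathcomp Require Import all_boot all_order all_algebra.
From mathcomp Require Import finmap.
From mathcomp Require Import all_classical all_reals all_analysis.

Set Implicit Arguments.
Unset Strict Implicit.
Unset Printing Implicit Defensive.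

Import Order.TTheory GRing.Theory Num.Theory.
Import numFieldNormedType.Exports.

(** * OMS-divides *)

Section Divides.
Local Open Scope classical_set_scope.
Local Open Scope ring_scope.
Variable R : realType.

Definition smooth (f : R -> R) : Prop :=
  forall n t, derivable (derive1n n f) t 1.

(* An immersion of finitely many copies of [0, 1] and of the circle R / Z.
   The copy [c] is parametrized by [t |-> (px c t, py c t)], where [px c] and
   [py c] are defined on all of R: for a circle they are 1-periodic, for an
   interval only their values on [0, 1] are used (every smooth function on
   [0, 1] extends smoothly to R). *)
Record immersion := Immersion {
  comp : finType;
  circle : pred comp;
  px : comp -> R -> R;
  py : comp -> R -> R;
  px_smooth : forall c, smooth (px c);
  py_smooth : forall c, smooth (py c);
  px_periodic : forall c t, circle c -> px c (t + 1) = px c t;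
  py_periodic : forall c t, circle c -> py c (t + 1) = py c t
}.

(* The points of J; a circle has the fundamental domain [0, 1[. *)
Definition source (f : immersion) : set (comp f * R) :=
  [set u | 0 <= u.2 /\ (if circle u.1 then u.2 < 1 else u.2 <= 1)].

Definition source_boundary (f : immersion) : set (comp f * R) :=
  [set u | ~~ circle u.1 /\ (u.2 = 0 \/ u.2 = 1)].

Definition point_at (f : immersion) (u : comp f * R) : R * R :=
  (px u.1 u.2, py u.1 u.2).
Definition dx (f : immersion) (u : comp f * R) : R := derive1n 1 (px u.1) u.2.
Definition dy (f : immersion) (u : comp f * R) : R := derive1n 1 (py u.1) u.2.
Definition ddx (f : immersion) (u : comp f * R) : R := derive1n 2 (px u.1) u.2.

Definition sqnorm (p : R * R) : R := p.1 ^+ 2 + p.2 ^+ 2.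

Definition image_curve (f : immersion) : set (R * R) :=
  @point_at f @` @source f.

Definition double_points (f : immersion) : set (R * R) :=
  [set p | exists u v : comp f * R,
    [/\ source u, source v, u <> v, point_at u = p & point_at v = p]].

Record is_divide (f : immersion) : Prop := IsDivide {
  divide_immersion : forall u : comp f * R,
    source u -> ~ (dx u = 0 /\ dy u = 0);
  divide_in_disc : forall u : comp f * R, source u -> sqnorm (point_at u) <= 1;
  divide_proper : forall u : comp f * R,
    source u -> (sqnorm (point_at u) = 1 <-> source_boundary u);
  divide_boundary_transverse : forall u : comp f * R,
    source u -> sqnorm (point_at u) = 1 ->
    px u.1 u.2 * dx u + py u.1 u.2 * dy u != 0;
  divide_no_triple_point : forall u v w : comp f * R,
    source u -> source v -> source w ->
    point_at u = point_at v -> point_at v = point_at w ->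
    [\/ u = v, v = w | u = w];
  divide_double_transverse : forall u v : comp f * R,
    source u -> source v -> u <> v -> point_at u = point_at v ->
    dx u * dy v - dy u * dx v != 0;
  divide_double_interior : forall p, double_points f p -> sqnorm p < 1
}.

(* The vertical tangent points: the critical points of [rho (x, y) = x]. *)
Definition vertical_points (f : immersion) : set (R * R) :=
  [set p | exists u : comp f * R, [/\ source u, dx u = 0 & point_at u = p]].

(* [osign p] is the sign of the double point [p] ([true] for +); it is only
   used at double points.  A critical point of a Morse function on a curve is a
   maximum or a minimum according to the sign of the second derivative. *)
Record oms_divide := OMSDivide {
  oimm : immersion;
  osign : R * R -> bool;
  oa : R;
  ob : R;
  oms_is_divide : is_divide oimm;
  oa_gt0 : 0 < oa;
  oa_lt1 : oa < 1;
  ob_gt0 : 0 < ob;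
  ob_lt1 : ob < 1;
  oab_lt1 : oa ^+ 2 + ob ^+ 2 < 1;
  oms_strip : forall p, image_curve oimm p -> `|p.2| < ob;
  oms_morse : forall u : comp oimm * R, source u -> dx u = 0 -> ddx u != 0;
  oms_double : forall p, double_points oimm p -> `|p.1| < oa /\ `|p.2| < ob;
  oms_max : forall u : comp oimm * R,
    source u -> dx u = 0 -> ddx u < 0 -> (point_at u).1 = oa;
  oms_min : forall u : comp oimm * R,
    source u -> dx u = 0 -> 0 < ddx u -> (point_at u).1 = - oa
}.

Variable G : oms_divide.

Definition singular_points : set (R * R) :=
  double_points (oimm G) `|` vertical_points (oimm G).

(* The rescaling of [-a, a] x [-b, b] to [-1, 1] x [-1, 1] is immaterial and is
   not performed: the lines x = -1 and x = 1 of the rescaled picture are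
   x = -a and x = a here. *)
Definition box : set (R * R) := [set p | `|p.1| <= oa G /\ `|p.2| <= ob G].

Definition regular_part : set (R * R) :=
  (image_curve (oimm G) `&` box) `\` singular_points.

(* The pieces obtained by cutting the part of Gamma in the box at its singular
   points.  They contain no vertical tangent, so that each of them is a graph
   over an interval of the x-axis. *)
Definition pieces : set (set (R * R)) :=
  [set connected_component regular_part p | p in regular_part].

Definition has_end_point (A : set (R * R)) : Prop :=
  exists2 p, A p & `|p.1| = oa G.

Definition left_of (p : R * R) : set (R * R) := [set q | q.1 < p.1].
Definition right_of (p : R * R) : set (R * R) := [set q | p.1 < q.1].

(* [A] has a half-branch at [p] in the half-plane [D]. *)
Definition half_branch (D : set (R * R)) (p : R * R) (A : set (R * R)) : Prop :=
  pieces A /\ closure (A `&` D) p.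

Definition above (D : set (R * R)) (p : R * R) (A B : set (R * R)) : Prop :=
  exists2 U, nbhs p U &
    forall q r, (A `&` D `&` U) q -> (B `&` D `&` U) r -> q.1 = r.1 -> r.2 < q.2.

Definition upper (D : set (R * R)) (p : R * R) (A : set (R * R)) : Prop :=
  half_branch D p A /\ exists2 B, half_branch D p B & above D p A B.
Definition lower (D : set (R * R)) (p : R * R) (A : set (R * R)) : Prop :=
  half_branch D p A /\ exists2 B, half_branch D p B & above D p B A.

Definition link (T : Type) (P Q : T -> Prop) (A B : T) : Prop :=
  (P A /\ Q B) \/ (P B /\ Q A).

Definition theta0_double (p : R * R) (A B : set (R * R)) : Prop :=
  link (upper (left_of p) p) (upper (right_of p) p) A B \/
  link (lower (left_of p) p) (lower (right_of p) p) A B.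

Definition theta1_double (p : R * R) (A B : set (R * R)) : Prop :=
  link (upper (left_of p) p) (lower (left_of p) p) A B \/
  link (upper (right_of p) p) (lower (right_of p) p) A B.

End Divides.

(** * The combinatorial data of an OMS-divide *)

(* Positive double point, negative double point, vertical tangent point. *)
Variant singular_kind := Pos | Neg | Vert.

Definition is_pos k := if k is Pos then true else false.
Definition is_neg k := if k is Neg then true else false.
Definition is_vert k := if k is Vert then true else false.

Record diagram := Diagram {
  sing : finType;
  piece : finType;
  kind : sing -> singular_kind;
  (* the piece has a half-branch at the singular point *)
  incident : sing -> pred piece;
  (* [joined th p A B]: the splitting [th] at [p] joins a half-branch of [A] to
     a half-branch of [B]; [th = false] is Theta_0, [th = true] is Theta_1 *)
  joined : bool -> sing -> rel piece;
  (* the piece has an end point of Gamma *)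
  ended : pred piece
}.

Section DiagramOf.
Variables (R : realType) (G : oms_divide R).

(* Both sets are finite, by compactness of J, so that [fset_set] loses nothing. *)
Definition sing_type : finType := fset_set (singular_points G).
Definition piece_type : finType := fset_set (pieces G).

Definition kind_of (p : sing_type) : singular_kind :=
  if `[< double_points (oimm G) (fsval p) >]
  then (if osign G (fsval p) then Pos else Neg) else Vert.

Definition incident_of (p : sing_type) (A : piece_type) : bool :=
  `[< closure (fsval A) (fsval p) >].

Definition joined_of (th : bool) (p : sing_type) (A B : piece_type) : bool :=
  if is_vert (kind_of p) then [&& th, incident_of p A & incident_of p B]
  else if th then `[< theta1_double G (fsval p) (fsval A) (fsval B) >]
  else `[< theta0_double G (fsval p) (fsval A) (fsval B) >].

Definition ended_of (A : piece_type) : bool := `[< has_end_point G (fsval A) >].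

Definition diagram_of : diagram :=
  Diagram kind_of incident_of joined_of ended_of.

End DiagramOf.

(** * States, polynomial, complex *)

Section States.
Local Open Scope ring_scope.
Variable D : diagram.

(* [S p = false] is Theta_0 at [p], [S p = true] is Theta_1 at [p]. *)
Definition state : finType := {ffun sing D -> bool}.

(* A component of the diagram of a state is given by the set of its pieces. *)
Definition adjacent (S : state) : rel (piece D) :=
  fun A B => [exists p, joined (S p) p A B].
Definition component_of (S : state) (A : piece D) : {set piece D} :=
  [set B | connect (adjacent S) A B]%SET.
Definition components (S : state) : {set {set piece D}} :=
  [set component_of S A | A : piece D]%SET.

(* A component is an arc, with two end points, or a circle, with none. *)
Definition is_open (S : state) (C : {set piece D}) : bool :=
  [exists A in C, ended A
    || [exists p, [&& is_vert (kind p), ~~ S p & incident p A]]].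

Definition cl (S : state) : nat :=
  #|[set C in components S | ~~ is_open S C]%SET|.
Definition op (S : state) : nat :=
  #|[set C in components S | is_open S C]%SET|.

Definition n_pos : nat := #|[set p : sing D | is_pos (kind p)]%SET|.
Definition n_neg : nat := #|[set p : sing D | is_neg (kind p)]%SET|.
Definition n_vert : nat := #|[set p : sing D | is_vert (kind p)]%SET|.
Definition writhe : int := 2 * n_pos%:Z - 2 * n_neg%:Z + n_vert%:Z.

Definition r_pos (S : state) : nat := #|[set p | is_pos (kind p) && S p]%SET|.
Definition r_neg (S : state) : nat := #|[set p | is_neg (kind p) && S p]%SET|.
Definition r_vert (S : state) : nat := #|[set p | is_vert (kind p) && S p]%SET|.

Definition ideg (S : state) : int :=
  (r_pos S)%:Z - (r_neg S)%:Z + (r_vert S)%:Z.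
Definition kdeg (S : state) : int := writhe + 2 * ideg S - (r_vert S)%:Z.

(* The polynomial W, as a function of the value [s] of the variable sqrt t. *)
Definition W (F : fieldType) (s : F) : F :=
  \sum_(S : state) (-1) ^ ideg S * s ^ kdeg S
    * (s ^- 2 + s ^+ 2) ^+ cl S * (s^-1 + s) ^ ((op S)%:Z - 1).

(* An enhanced state: a state with the set of its positive components. *)
Definition estate : finType :=
  {x : state * {set {set piece D}} | x.2 \subset components x.1}.
Definition est (x : estate) : state := (val x).1.
Definition positive (x : estate) : {set {set piece D}} := (val x).2.
Definition negative (x : estate) : {set {set piece D}} :=
  (components (est x) :\: positive x)%SET.

Definition delta (x : estate) (P : pred {set piece D}) : int :=
  #|[set C in positive x | P C]%SET|%:Z - #|[set C in negative x | P C]%SET|%:Z.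
Definition jdeg (x : estate) : int :=
  kdeg (est x) + 2 * delta x (fun C => ~~ is_open (est x) C)
  + delta x (is_open (est x)).

Definition touches (p : sing D) (C : {set piece D}) : bool :=
  [exists A in C, incident p A].

Definition sign_count : Type := nat * nat * nat * nat.

(* The numbers of (open +, open -, closed +, closed -) components at [p].  As
   the rules of the differential are symmetric, a contribution is determined by
   these numbers before and after the switch; for instance
   (+,+) |-> (+,-) + (-,+) means that both enhanced states of the new diagram
   with one positive and one negative component are contributions. *)
Definition profile (p : sing D) (x : estate) : sign_count :=
  let o := is_open (est x) in
  (#|[set C in positive x | touches p C && o C]%SET|,
   #|[set C in negative x | touches p C && o C]%SET|,
   #|[set C in positive x | touches p C && ~~ o C]%SET|,
   #|[set C in negative x | touches p C && ~~ o C]%SET|).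

Definition double_rules : seq (sign_count * sign_count) :=
  [:: ((2, 0, 0, 0), (1, 1, 0, 0)); ((1, 1, 0, 0), (0, 2, 0, 0));
      ((1, 0, 0, 0), (1, 0, 0, 1)); ((0, 1, 0, 0), (0, 1, 0, 1));
      ((1, 0, 1, 0), (1, 0, 0, 0)); ((0, 1, 1, 0), (0, 1, 0, 0));
      ((0, 0, 1, 0), (0, 0, 1, 1)); ((0, 0, 0, 1), (0, 0, 0, 2));
      ((0, 0, 2, 0), (0, 0, 1, 0)); ((0, 0, 1, 1), (0, 0, 0, 1)) ]%N.

Definition vertical_rules : seq (sign_count * sign_count) :=
  [:: ((0, 1, 0, 0), (0, 0, 0, 1));
      ((2, 0, 0, 0), (1, 0, 0, 0)); ((1, 1, 0, 0), (0, 1, 0, 0)) ]%N.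

Definition switchable (S : state) (p : sing D) : bool := S p == is_neg (kind p).
Definition switch (S : state) (p : sing D) : state :=
  [ffun q => if q == p then ~~ S q else S q].

Definition untouched (p : sing D) (P : {set {set piece D}}) : {set {set piece D}} :=
  [set C in P | ~~ touches p C]%SET.

(* [y] is a contribution to the differential of [x] at [p]. *)
Definition contribution (p : sing D) (x y : estate) : bool :=
  [&& switchable (est x) p, est y == switch (est x) p,
      untouched p (positive y) == untouched p (positive x) &
      (profile p x, profile p y)
        \in (if is_vert (kind p) then vertical_rules else double_rules)].

(* The whole complex: all bidegrees together. *)
Definition chains : vectType 'F_2 := {ffun estate -> ('F_2)^o}.
Definition basis_vector (x : estate) : chains := [ffun y => (y == x)%:R].
Definition chains_at (i j : int) : {vspace chains} :=
  <<[seq basis_vector x | x <- enum estate & (ideg (est x) == i) && (jdeg x == j)]>>%VS.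

Definition differential : 'End(chains) :=
  linfun (fun f : chains =>
    [ffun y => \sum_p \sum_(x | contribution p x y) f x] : chains).

Definition cycles (i j : int) : {vspace chains} :=
  (lker differential :&: chains_at i j)%VS.
Definition boundaries (i j : int) : {vspace chains} :=
  (differential @: chains_at (i - 1) j)%VS.

(* The quotient of the cycles by the boundaries (which are cycles), represented
   by a complement of the boundaries in the space of cycles. *)
Definition homology (i j : int) : {vspace chains} :=
  (cycles i j :\: boundaries i j)%VS.

Definition dim_gr (F : fieldType) (t : F) (i : int) : F :=
  \sum_(j \in [set: int]%classic) t ^ j * (\dim (homology i j))%:R.
Definition chi_gr (F : fieldType) (t : F) : F :=
  \sum_(i \in [set: int]%classic) (-1) ^ i * dim_gr t i.

End States.

(** * The field of rational functions Q(t), as the fractions of Z[t] *)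

Definition tvar : {fraction {poly int}} := FracField.tofrac 'X%R.

(* Main.v *)
(* Both sides are the signed count of the enhanced states by bidegree.  For W,
   expand the two binomials as sums over the signs of the components; for chi_gr,
   use that a complex and its homology have the same Euler characteristic.  The
   latter needs [d o d = 0], which depends on the geometry of the divide.

   Cutting the curve at its singular points and where it reaches the lines
   x = +-a gives arcs on which x is injective, by Rolle.  By compactness of J each
   arc is open and closed in the regular part, so that the pieces are exactly these
   arcs.  Hence there are four distinct half-branches at a double point and two at
   a vertical tangent point, and a piece has two ends, each of them at a singular
   point or at an end point of Gamma.

   For two singular points p and q, the square of the cube of states that switches
   them only depends on the partial matching by which the rest of the diagram
   connects the at most eight half-branches at p and q.  The square commutes modulo
   2 for every partial matching, realizable by a plane diagram or not, which is
   checked by computation. *)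
Require Import Defs.
From HB Require Import structures.
From mathcomp Require Import all_boot all_order all_algebra.
From mathcomp Require Import zify ring lra.

Set Implicit Arguments.
Unset Strict Implicit.
Unset Printing Implicit Defensive.

(** * The local model of a square of the cube of states *)

(** Topology and algebra meet only in [well_formed]: numbered half-branches at each singular point,
    the edges of each splitting, and two ends per piece. Twisting the numbering at a negative double
    point makes it the same local model as a positive one, so that only the distinction between
    double and vertical points remains. The obstacle to a finite check is that components are
    global. Three facts make them local. Outside [p] and [q] the pieces have degree at most 2, so
    they form paths and cycles, and the half-branches at [p] and [q] see only a partial matching
    with some loose ends. A component at [p] or [q] is open exactly when it contains a loose node.
    Signs of components away from both points are carried along unchanged. Hence a table of signs at
    the nodes, together with the unchanged signs, gives faithful coordinates on the enhanced states
    over a corner of the square. As the rules are expressed by counts, the check compares numbers of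
    classes and never has to name a component. *)

Definition nnodes (v : bool) : nat := if v then 2 else 4.

(* The half-branches at a double point that is not negative are numbered: upper
   left, lower left, upper right, lower right.  At a negative one, where the
   differential switches from Theta_1 to Theta_0, the lower left and the upper
   right ones are exchanged.  In both cases the switch is from [b = false] to
   [b = true]. *)
Definition joins (v b : bool) : seq (nat * nat) :=
  match v, b with
  | false, false => [:: (0, 2); (1, 3)]
  | false, true => [:: (0, 1); (2, 3)]
  | true, false => [::]
  | true, true => [:: (0, 1)]
  end.

Definition shift_pair (k : nat) (e : nat * nat) := (k + e.1, k + e.2).

(** A plain union-find: nodes known to be connected share a label, and an edge moves the class of
    its first node to the label of its second. *)
Definition relabel (lab : seq nat) (e : nat * nat) : seq nat :=
  let a := nth 0 lab e.1 in let b := nth 0 lab e.2 in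
  [seq if l == a then b else l | l <- lab].

Definition labels (n : nat) (es : seq (nat * nat)) : seq nat :=
  foldl relabel (iota 0 n) es.

Fixpoint sublists (T : Type) (s : seq T) : seq (seq T) :=
  if s is x :: s' then let r := sublists s' in r ++ map (cons x) r else [:: [::]].

(** On the list of all pairs of indices, with [used] empty, this lists the partial matchings of the
    nodes. *)
Fixpoint disjoint_pairs (ps : seq (nat * nat)) (used : seq nat) : seq (seq (nat * nat)) :=
  if ps is e :: ps' then
    disjoint_pairs ps' used ++
    (if (e.1 \in used) || (e.2 \in used) then [::]
     else map (cons e) (disjoint_pairs ps' (e.1 :: e.2 :: used)))
  else [:: [::]].

Definition index_pairs (n : nat) : seq (nat * nat) :=
  flatten [seq [seq (i, j) | j <- iota i.+1 (n - i.+1)] | i <- iota 0 n].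

(** A sign belongs to a component, so the tables are constant on the classes of [lab], one for each
    choice of positive classes. *)
Definition sign_tables (lab : seq nat) : seq (seq bool) :=
  undup [seq [seq l \in P | l <- lab] | P <- sublists (undup lab)].

Definition unmatched (M : seq (nat * nat)) (i : nat) : bool :=
  all (fun e : nat * nat => (e.1 != i) && (e.2 != i)) M.

(* The nodes are the half-branches at p, followed by those at q; [M] lists the
   pairs of nodes connected outside p and q, and an unmatched node is connected to
   an end point.  A sign table gives the sign of the component of each node. *)
Section Square.
Variables (v1 v2 : bool) (M : seq (nat * nat)).
Let n1 := nnodes v1.
Let n2 := nnodes v2.
Definition nodes1 := iota 0 n1.
Definition nodes2 := iota n1 n2.

Definition square_labels (b1 b2 : bool) : seq nat :=
  labels (n1 + n2) (M ++ joins v1 b1 ++ map (shift_pair n1) (joins v2 b2)).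

(** End points have two sources: an outer path that does not return to a node, and a vertical
    tangent cut by Theta_0. *)
Definition loose (b1 b2 : bool) (i : nat) : bool :=
  unmatched M i || (if i < n1 then v1 && ~~ b1 else v2 && ~~ b2).

Definition square_opens (b1 b2 : bool) (lab : seq nat) : seq bool :=
  let ls := [seq nth 0 lab i | i <- iota 0 (n1 + n2) & loose b1 b2 i] in
  [seq l \in ls | l <- lab].

Definition local_profile (rng : seq nat) (lab : seq nat) (o s : seq bool) : sign_count :=
  let num a := size (undup [seq nth 0 lab i | i <- rng & a (nth false s i) (nth false o i)]) in
  (num (fun s o => s && o), num (fun s o => ~~ s && o),
   num (fun s o => s && ~~ o), num (fun s o => ~~ s && ~~ o)).

(** The local form of the condition on [untouched]: a component at the other singular point that
    avoids [rng] keeps its sign. *)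
Definition agree_off (rng oth : seq nat) (lab : seq nat) (s s' : seq bool) : bool :=
  let ls := [seq nth 0 lab i | i <- rng] in
  all (fun i => (nth 0 lab i \in ls) || (nth false s i == nth false s' i)) oth.

Definition rules (v : bool) := if v then vertical_rules else double_rules.

(** [x] runs over the signs at the initial corner and [z] over those at the opposite one; the two
    counts are the intermediate states at the two other corners. Profiles are tabulated once per
    corner to keep the evaluation cheap. *)
Definition square_even : bool :=
  let L00 := square_labels false false in
  let L10 := square_labels true false in
  let L01 := square_labels false true in
  let L11 := square_labels true true in
  let O00 := square_opens false false L00 in
  let O10 := square_opens true false L10 in
  let O01 := square_opens false true L01 in
  let O11 := square_opens true true L11 in
  let p1 L O s := local_profile nodes1 L O s in
  let p2 L O s := local_profile nodes2 L O s in
  let T10 := [seq (s, (p1 L10 O10 s, p2 L10 O10 s)) | s <- sign_tables L10] in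
  let T01 := [seq (s, (p1 L01 O01 s, p2 L01 O01 s)) | s <- sign_tables L01] in
  let T11 := [seq (s, (p1 L11 O11 s, p2 L11 O11 s)) | s <- sign_tables L11] in
  all (fun x =>
    let x1 := p1 L00 O00 x in
    let x2 := p2 L00 O00 x in
    let Y10 := [seq y <- T10 | agree_off nodes1 nodes2 L00 x y.1 && ((x1, y.2.1) \in rules v1)] in
    let Y01 := [seq y <- T01 | agree_off nodes2 nodes1 L00 x y.1 && ((x2, y.2.2) \in rules v2)] in
    all (fun z =>
      ~~ odd (count (fun y => agree_off nodes2 nodes1 L10 y.1 z.1 && ((y.2.2, z.2.2) \in rules v2)) Y10
         + count (fun y => agree_off nodes1 nodes2 L01 y.1 z.1 && ((y.2.1, z.2.1) \in rules v1)) Y01))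
      T11) (sign_tables L00).
End Square.

Definition all_square_even v1 v2 :=
  all (square_even v1 v2) (disjoint_pairs (index_pairs (nnodes v1 + nnodes v2)) [::]).

(* There are 764, 76 or 10 partial matchings, depending on [v1] and [v2]. *)
Lemma all_square_evenT v1 v2 : all_square_even v1 v2.
Proof. by case: v1; case: v2; vm_compute. Qed.

(** * Graphs given by lists of edges *)

Section Links.
Variable T : finType.
Implicit Types (es : seq (T * T)) (A B X Y Z : T).

Definition linked es : rel T := fun A B => ((A, B) \in es) || ((B, A) \in es).
Definition conn es : rel T := connect (linked es).

Lemma conn_sym es : symmetric (conn es).
Proof. by apply: sym_connect_sym => A B; rewrite /linked orbC. Qed.

Lemma conn_refl es A : conn es A A. Proof. exact: connect0. Qed.

Lemma conn_trans es : transitive (conn es). Proof. exact: connect_trans. Qed.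

Lemma eq_conn es es' : es =i es' -> conn es =2 conn es'.
Proof. by move=> E; apply: eq_connect => A B; rewrite /linked !E. Qed.

Lemma conn_cons es A B X Y : conn ((A, B) :: es) X Y =
  [|| conn es X Y, conn es X A && conn es B Y | conn es X B && conn es A Y].
Proof.
have sub U V : conn es U V -> conn ((A, B) :: es) U V.
  apply: connect_sub => U' V' UV; apply: connect1; move: UV; rewrite /linked !inE.
  by case/orP => ->; rewrite !orbT.
have AB : conn ((A, B) :: es) A B by apply: connect1; rewrite /linked inE eqxx.
apply/idP/idP; last first.
  case/or3P => [|/andP[XA BY]|/andP[XB AY]]; first exact: sub.
    exact: conn_trans (conn_trans (sub _ _ XA) AB) (sub _ _ BY).
  by apply: conn_trans (conn_trans (sub _ _ XB) _) (sub _ _ AY); rewrite conn_sym.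
(* The path grows at its end: the last step is an old edge, or the new one in either direction. *)
case/connectP => s + ->; elim/last_ind: s => [|s Z IH]; first by rewrite conn_refl.
rewrite rcons_path last_rcons => /andP[/IH{}IH].
set V := last X s in IH *; rewrite /linked !inE => VZ.
have [st|nst] := boolP (linked es V Z).
  have VZ' : conn es V Z by exact: connect1.
  case/or3P: IH => [XV|/andP[-> BV]|/andP[-> AV]]; first by rewrite (conn_trans XV VZ').
    by rewrite (conn_trans BV VZ') orbT.
  by rewrite (conn_trans AV VZ') !orbT.
have : (V = A /\ Z = B) \/ (V = B /\ Z = A).
  move: nst VZ; rewrite /linked; case: (_ \in es); case: (_ \in es) => //= _.
  by rewrite !orbF !xpair_eqE; case/orP => /andP[/eqP-> /eqP->]; [left|right].
case=> -[EV ->]; rewrite EV in IH.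
  case/or3P: IH => [->|/andP[-> _]|/andP[-> _]]; rewrite ?conn_refl ?orbT//.
case/or3P: IH => [->|/andP[-> _]|/andP[-> _]]; rewrite ?conn_refl ?orbT//.
Qed.

Definition degree es A : nat := \sum_(e <- es) ((e.1 == A) + (e.2 == A)).

Lemma degree_cons es A B X : degree ((A, B) :: es) X = (A == X) + (B == X) + degree es X.
Proof. by rewrite /degree big_cons. Qed.

Lemma class_pick es X A : \sum_(Y | conn es X Y) (A == Y) = conn es X A.
Proof.
rewrite big_mkcond (bigD1 A)//= eqxx big1 ?addn0; first by case: (conn es X A).
by move=> Y YA; rewrite eq_sym (negPf YA); case: (conn es X Y).
Qed.

(* A connected graph of maximal degree 2 is a path, whose two ends have one
   missing edge each, or a cycle; here by induction on the number of edges. *)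
Lemma class_ends es : (forall A, degree es A <= 2) ->
  forall X, \sum_(Y | conn es X Y) (2 - degree es Y) \in [:: 0; 2].
Proof.
elim: es => [|[A B] es IH] deg X.
  rewrite (big_pred1 X) => [|Y]; first by rewrite /degree big_nil.
  by apply/connectP/eqP => [[[|Z s]]|->] //; exists [::].
have dle Y : (A == Y) + (B == Y) + degree es Y <= 2 by rewrite -degree_cons.
have {}IH := IH (fun Y => leq_trans (leq_addl _ _) (dle Y)).
have split X' : \sum_(Y | conn es X' Y) (2 - degree es Y) =
    \sum_(Y | conn es X' Y) (2 - degree ((A, B) :: es) Y) + conn es X' A + conn es X' B.
  rewrite -(class_pick es X' A) -(class_pick es X' B) -!big_split /=.
  by apply: eq_bigr => Y _; rewrite degree_cons; have := dle Y; lia.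
(* If [A] and [B] are already connected, the new edge closes a path into a cycle: the class stays
   the same and its two missing edges are used up. *)
have [AB|AB] := boolP (conn es A B).
  have E : conn ((A, B) :: es) X =1 conn es X.
    move=> Y; rewrite conn_cons; apply/idP/idP => [|->//].
    case/or3P => [//|/andP[XA BY]|/andP[XB AY]].
      exact: conn_trans XA (conn_trans AB BY).
    by apply: conn_trans XB (conn_trans _ AY); rewrite conn_sym.
  rewrite (eq_bigl _ _ E); have := IH X; rewrite split !inE.
  have -> : conn es X A = conn es X B.
    by apply/idP/idP => H; apply: conn_trans H _ => //; rewrite conn_sym.
  by case: (conn es X B); lia.
(* Otherwise two classes merge. The degree bound leaves a missing edge at [A] and one at [B], so
   each class misses exactly two; the new edge uses one of each, and two remain. *)
have pos Z : Z = A \/ Z = B -> 0 < \sum_(Y | conn es Z Y) (2 - degree es Y).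
  move=> ZAB; rewrite (bigD1 Z) ?conn_refl//=.
  by have := dle Z; case: ZAB => ->; rewrite eqxx; lia.
have := IH A; have := IH B; have := pos A (or_introl erefl); have := pos B (or_intror erefl).
rewrite !split !conn_refl (conn_sym es B A) (negPf AB) !inE => pB pA sB sA.
have both : conn es X A || conn es X B ->
    \sum_(Y | conn ((A, B) :: es) X Y) (2 - degree ((A, B) :: es) Y) = 2.
  move=> XAB; have E Y : conn ((A, B) :: es) X Y = conn es A Y || conn es B Y.
    rewrite conn_cons; case/orP: XAB => XZ.
      have XE V : conn es X V = conn es A V.
        by apply/idP/idP; apply: conn_trans => //; rewrite conn_sym.
      by rewrite !XE conn_refl (negPf AB) /= orbF.
    have XE V : conn es X V = conn es B V.
      by apply/idP/idP; apply: conn_trans => //; rewrite conn_sym.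
    by rewrite !XE conn_refl (conn_sym es B A) (negPf AB) /= orbC.
  rewrite (eq_bigl _ _ E) (bigID (conn es A)) /=.
  rewrite (eq_bigl (conn es A)); last by move=> Y; case: (conn es A Y); rewrite ?andbF.
  rewrite [X in _ + X = _](eq_bigl (conn es B)); first by lia.
  move=> Y; case AY: (conn es A Y) => /=; last by rewrite andbT.
  apply/esym/negP => BY.
  by case/negP: AB; apply: conn_trans AY _; rewrite conn_sym.
have [/both->//|] := boolP (conn es X A || conn es X B).
rewrite negb_or => /andP[XA XB].
rewrite (eq_bigl (conn es X)) => [|Y]; last by rewrite conn_cons (negPf XA) (negPf XB) !orbF.
have := IH X; rewrite split (negPf XA) (negPf XB) /= !addn0. by rewrite !inE.
Qed.

End Links.

(** * Connectedness computed by relabelling *)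

Section Labels.
Implicit Types (lab : seq nat) (e : nat * nat) (es : seq (nat * nat)) (i j k n : nat).

Lemma size_relabel lab e : size (relabel lab e) = size lab.
Proof. exact: size_map. Qed.

Lemma size_foldl_relabel lab es : size (foldl relabel lab es) = size lab.
Proof. by elim: es lab => //= e es IH lab; rewrite IH size_relabel. Qed.

(** The same three alternatives as in [conn_cons]: labels and connected classes change alike when an
    edge is added. *)
Lemma relabel_eq lab e i j : i < size lab -> j < size lab ->
  (nth 0 (relabel lab e) i == nth 0 (relabel lab e) j) =
  [|| nth 0 lab i == nth 0 lab j,
     (nth 0 lab i == nth 0 lab e.1) && (nth 0 lab e.2 == nth 0 lab j) |
     (nth 0 lab i == nth 0 lab e.2) && (nth 0 lab e.1 == nth 0 lab j)].
Proof.
move=> il jl; rewrite /relabel !(nth_map 0)//.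
set a := nth 0 lab e.1; set b := nth 0 lab e.2; set x := nth 0 lab i; set y := nth 0 lab j.
by case: (eqVneq x a) => [->|xa]; case: (eqVneq y a) => [->|ya];
  rewrite ?eqxx ?(eq_sym a y) ?(negPf xa) ?(negPf ya) ?orbT ?andbF ?orbF ?andbT //=;
  rewrite ?(eq_sym a b) ?(eq_sym b y) ?(eq_sym a x) //; do ?case: eqVneq => //; lia.
Qed.

(** For a matching, with [K] the connection outside p and q, this is one half of the correctness of
    the labels. The other half is [foldl_relabel_mem], as a matching lists every connected pair of
    nodes. *)
Lemma foldl_relabel_sound (K : rel nat) lab es :
  (forall i, K i i) -> symmetric K -> transitive K ->
  (forall i j, i < size lab -> j < size lab -> nth 0 lab i = nth 0 lab j -> K i j) ->
  (forall e, e \in es -> [&& e.1 < size lab, e.2 < size lab & K e.1 e.2]) ->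
  forall i j, i < size lab -> j < size lab ->
  nth 0 (foldl relabel lab es) i = nth 0 (foldl relabel lab es) j -> K i j.
Proof.
move=> Kr Ks Kt; elim: es lab => [|e es IH] lab Kl Kes //= i j il jl.
have /and3P[e1 e2 Ke] := Kes e (mem_head _ _).
apply: IH; rewrite ?size_relabel//; last by move=> e' ee; apply: Kes; rewrite inE ee orbT.
move=> i' j' il' jl' /eqP; rewrite relabel_eq// => /or3P[/eqP|/andP[/eqP E1 /eqP E2]|/andP[/eqP E1 /eqP E2]].
- exact: Kl.
- exact: Kt (Kl _ _ il' e1 E1) (Kt _ _ _ Ke (Kl _ _ e2 jl' E2)).
- by apply: Kt (Kl _ _ il' e2 E1) (Kt _ _ _ _ (Kl _ _ e1 jl' E2)); rewrite Ks.
Qed.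

Lemma foldl_relabel_mono lab es i j : i < size lab -> j < size lab ->
  nth 0 lab i = nth 0 lab j ->
  nth 0 (foldl relabel lab es) i = nth 0 (foldl relabel lab es) j.
Proof.
elim: es lab => //= e es IH lab il jl E; apply: IH; rewrite ?size_relabel//.
by apply/eqP; rewrite relabel_eq// E eqxx.
Qed.

Lemma foldl_relabel_mem lab es e : e.1 < size lab -> e.2 < size lab -> e \in es ->
  nth 0 (foldl relabel lab es) e.1 = nth 0 (foldl relabel lab es) e.2.
Proof.
elim: es lab => //= e' es IH lab e1 e2; rewrite inE => /predU1P[<-|ee].
  apply: foldl_relabel_mono; rewrite ?size_relabel//; apply/eqP.
  by rewrite relabel_eq// !eqxx !orbT.
by apply: IH; rewrite ?size_relabel.
Qed.

Lemma foldl_relabel_conn (T : finType) (g : nat -> T) (out : seq (T * T)) lab es :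
  (forall i j, i < size lab -> j < size lab ->
    (nth 0 lab i == nth 0 lab j) = conn out (g i) (g j)) ->
  (forall e, e \in es -> (e.1 < size lab) && (e.2 < size lab)) ->
  forall i j, i < size lab -> j < size lab ->
    (nth 0 (foldl relabel lab es) i == nth 0 (foldl relabel lab es) j) =
    conn ([seq (g e.1, g e.2) | e <- es] ++ out) (g i) (g j).
Proof.
elim: es lab out => [|e es IH] lab out H Hes i j il jl /=; first exact: H.
have /andP[e1 e2] := Hes e (mem_head _ _).
rewrite (IH _ ((g e.1, g e.2) :: out)) ?size_relabel//.
- by apply: eq_conn => E; rewrite !(mem_cat, inE) orbCA.
- by move=> i' j' il' jl'; rewrite conn_cons -!H// relabel_eq.
- by move=> e' ee; apply: Hes; rewrite inE ee orbT.
Qed.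

Lemma index_pairsP n e : e \in index_pairs n <-> e.1 < e.2 < n.
Proof.
rewrite /index_pairs; split=> [/flattenP[s /mapP[i]]|/andP[e12 e2n]].
  by rewrite mem_iota => /andP[_ /= ?] -> /mapP[j]; rewrite mem_iota => /andP[? ?] -> /=; lia.
apply/flattenP; exists [seq (e.1, j) | j <- iota e.1.+1 (n - e.1.+1)].
  by apply/mapP; exists e.1; rewrite // mem_iota; lia.
by apply/mapP; exists e.2; rewrite -?surjective_pairing// mem_iota; lia.
Qed.

Lemma index_pairs_uniq n : uniq (index_pairs n).
Proof.
rewrite /index_pairs; apply: allpairs_uniq_dep; first exact: iota_uniq.
  by move=> i _; exact: iota_uniq.
by move=> /= [i j] [i' j'] _ _ /= [-> ->].
Qed.

Definition share_index (e e' : nat * nat) : bool := (e.1 \in [:: e'.1; e'.2]) || (e.2 \in [:: e'.1; e'.2]).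

Lemma filter_disjoint_pairs (a : pred (nat * nat)) ps used :
  pairwise (fun e e' => ~~ share_index e' e) [seq e <- ps | a e] ->
  all (fun e => (e.1 \notin used) && (e.2 \notin used)) [seq e <- ps | a e] ->
  [seq e <- ps | a e] \in disjoint_pairs ps used.
Proof.
elim: ps used => [|e ps IH] used //=; case: ifP => ae /= => [/andP[epw pw] /andP[/andP[e1 e2] al]|pw al].
  rewrite mem_cat (negPf e1) (negPf e2) /= map_f ?orbT// IH//.
  apply/allP => e' ee; move/allP: epw => /(_ _ ee); move/allP: al => /(_ _ ee).
  by rewrite /share_index !inE; case/andP => /negPf-> /negPf->; rewrite !orbF !negb_or; lia.
by rewrite mem_cat IH.
Qed.

Lemma pairwise_uniq_sub (T : eqType) (r : rel T) (s : seq T) : uniq s ->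
  {in s &, forall x y, x != y -> r x y} -> pairwise r s.
Proof.
elim: s => //= x s IH /andP[xs us] H; apply/andP; split.
  apply/allP => y ys; apply: H; rewrite ?inE ?eqxx ?ys ?orbT//.
  by apply: contraNneq xs => ->.
by apply: IH => // y z ys zs; apply: H; rewrite inE ?ys ?zs orbT.
Qed.

Lemma mem_sublists (T : eqType) (a : pred T) (s : seq T) : filter a s \in sublists s.
Proof.
elim: s => //= x s IH; rewrite mem_cat; case: (a x); last by rewrite IH.
by rewrite map_f ?orbT.
Qed.

Lemma mem_sign_tables (lab : seq nat) (h : nat -> bool) : map h lab \in sign_tables lab.
Proof.
rewrite mem_undup; apply/mapP; exists (filter h (undup lab)); first exact: mem_sublists.
by apply/eq_in_map => l ll; rewrite mem_filter mem_undup ll andbT.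
Qed.

Lemma sign_tablesP (lab : seq nat) s : s \in sign_tables lab -> exists h : nat -> bool, s = map h lab.
Proof. by rewrite mem_undup => /mapP[P _ ->]; exists (fun l => l \in P). Qed.

(** The number of distinct values depends only on which values coincide, so components can be
    counted through their labels. *)
Lemma size_undup_map (T U V : eqType) (f : T -> U) (h : T -> V) (s : seq T) :
  {in s &, forall x y, (f x == f y) = (h x == h y)} ->
  size (undup (map f s)) = size (undup (map h s)).
Proof.
elim: s => //= x s IH H.
have -> : (f x \in map f s) = (h x \in map h s).
  apply/mapP/mapP => -[y ys /eqP E]; exists y => //; apply/eqP; move: E;
    by rewrite H ?inE ?eqxx ?ys ?orbT.
have {}IH := IH (fun y z ys zs => H y z (mem_behead (s := x :: s) ys) (mem_behead (s := x :: s) zs)).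
by case: ifP => _ //=; rewrite IH.
Qed.

End Labels.

(** * Components of the states of a diagram *)

Section Diagrams.
Variables (D : diagram) (nd : sing D -> nat -> piece D).
Implicit Types (S : state D) (p q r : sing D) (A B C : piece D).

Definition vert r : bool := is_vert (kind r).
Definition half_branches r : seq (piece D) := [seq nd r i | i <- iota 0 (nnodes (vert r))].
Definition splice r (b : bool) : seq (piece D * piece D) :=
  [seq (nd r e.1, nd r e.2) | e <- joins (vert r) b].

Definition degree_at A : nat := #|[set r | incident r A]|.

(** The exclusive or with [is_neg] exchanges the two splittings at a negative double point.
    [wf_joined] compares distinct pieces only, since [joined] at a vertical tangent also relates an
    incident piece to itself, which does not affect connectedness. The last two fields express that
    a piece has two ends, each at a singular point or at an end point of Gamma. *)
Record well_formed : Prop := WellFormed {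
  wf_uniq : forall r, uniq (half_branches r);
  wf_incident : forall r A, incident r A = (A \in half_branches r);
  wf_joined : forall r b A B, A != B ->
    joined b r A B = linked (splice r (b (+) is_neg (kind r))) A B;
  wf_degree : forall A, degree_at A <= 2;
  wf_ended : forall A, ended A = (degree_at A < 2)
}.

(** The position in the direction of the differential, which switches every point from [false] to
    [true], whatever its kind. *)
Definition level S r : bool := S r (+) is_neg (kind r).

Definition links S (P : pred (sing D)) : seq (piece D * piece D) :=
  flatten [seq splice r (level S r) | r <- enum P].

Hypothesis wf : well_formed.

Lemma nd_mem r i : i < nnodes (vert r) -> nd r i \in half_branches r.
Proof. by move=> ir; apply: map_f; rewrite mem_iota. Qed.

Lemma joins_lt v b e : e \in joins v b -> (e.1 < nnodes v) && (e.2 < nnodes v).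
Proof. by move: e; apply/allP; case: v; case: b. Qed.

(** Every splitting glues each half-branch exactly once, except that a cut vertical tangent glues
    none. *)
Lemma degree_splice r b A :
  degree (splice r b) A = incident r A * (~~ vert r || b).
Proof.
rewrite (wf_incident wf); have <- := count_uniq_mem A (wf_uniq wf r).
rewrite /half_branches /degree /splice.
by case: (vert r); case: b => /=; rewrite ?big_cons ?big_nil /=; lia.
Qed.

Lemma degree_links S P A :
  degree (links S P) A = \sum_(r | P r) incident r A * (~~ vert r || level S r).
Proof.
rewrite /degree /links big_flatten /= big_map -[RHS]big_enum /=.
by apply: eq_bigr => r _; rewrite -degree_splice.
Qed.

Lemma degree_at_sum A : degree_at A = \sum_r (incident r A).
Proof.
rewrite /degree_at -sum1_card big_mkcond; apply: eq_bigr => r _.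
by rewrite inE; case: (incident r A).
Qed.

Lemma links_mem S P x : (x \in links S P) = [exists (r | P r), x \in splice r (level S r)].
Proof.
apply/flattenP/existsP => [[s /mapP[r rP ->] xs]|[r /andP[Pr xr]]].
  by exists r; rewrite xs andbT; rewrite mem_enum in rP.
by exists (splice r (level S r)) => //; apply/mapP; exists r; rewrite ?mem_enum.
Qed.

Lemma connect_adjacent S : connect (adjacent S) =2 conn (links S predT).
Proof.
move=> A B; apply/idP/idP; apply: connect_sub => {}A {}B.
  case/existsP => r; have [->|AB] := eqVneq A B; first by rewrite connect0.
  rewrite (wf_joined wf)// => rAB; apply: connect1; move: rAB; rewrite /linked !links_mem.
  by case/orP => H; apply/orP; [left|right]; apply/existsP; exists r.
have [->|AB] := eqVneq A B; first by rewrite connect0.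
move=> lAB; apply: connect1; apply/existsP.
move: lAB; rewrite /linked !links_mem; case/orP => /existsP[r /= H]; exists r;
  by rewrite (wf_joined wf)// /linked H ?orbT.
Qed.

Lemma component_of_eq S A B : (component_of S A == component_of S B) = conn (links S predT) A B.
Proof.
have cE X Y : (Y \in component_of S X) = conn (links S predT) X Y.
  by rewrite inE connect_adjacent.
apply/eqP/idP => [E|AB]; first by rewrite -cE E cE conn_refl.
apply/setP => X; rewrite !cE; apply/idP/idP; apply: conn_trans => //.
by rewrite conn_sym.
Qed.

Lemma in_component S A B : (B \in component_of S A) = conn (links S predT) A B.
Proof. by rewrite inE connect_adjacent. Qed.

Section Pair.
Variables (p q : sing D).
Hypothesis pq : p != q.

Let n1 := nnodes (vert p).
Let n2 := nnodes (vert q).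
Let n := n1 + n2.
Definition gnode (i : nat) : piece D := if i < n1 then nd p i else nd q (i - n1).
Definition others : pred (sing D) := fun r => (r != p) && (r != q).
Definition outer S := links S others.

Lemma incident1 A : incident p A <-> exists2 i, i \in nodes1 (vert p) & gnode i = A.
Proof.
rewrite (wf_incident wf); split=> [/mapP[i]|[i]]; rewrite /nodes1 mem_iota => /andP[_ i1].
  by move=> ->; exists i; rewrite ?mem_iota// /gnode i1.
by rewrite /gnode i1 => <-; exact: nd_mem.
Qed.

Lemma incident2 A : incident q A <-> exists2 i, i \in nodes2 (vert p) (vert q) & gnode i = A.
Proof.
rewrite (wf_incident wf); split=> [/mapP[i]|[i]]; rewrite /nodes2 mem_iota.
  move=> /andP[_ i1] ->; exists (n1 + i); first by rewrite mem_iota; lia.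
  by rewrite /gnode ifF; [rewrite addKn|lia].
move=> /andP[i1 i2]; rewrite /gnode ifF; last by lia.
by move=> <-; apply: nd_mem; lia.
Qed.

Lemma gnode_count A : \sum_(i <- iota 0 n) (gnode i == A) = incident p A + incident q A.
Proof.
have cnt r : \sum_(i <- iota 0 (nnodes (vert r))) (nd r i == A) = incident r A.
  rewrite (wf_incident wf) -(count_uniq_mem _ (wf_uniq wf r)) -sum1_count big_map [RHS]big_mkcond.
  by apply: eq_bigr => i _ /=; case: eqP.
rewrite iotaD big_cat /= add0n -cnt; congr (_ + _).
  by apply: eq_big_seq => i; rewrite mem_iota /gnode => /andP[_ ->].
rewrite -cnt -[n1 in iota n1]addn0 iotaDl big_map; apply: eq_bigr => i _.
by rewrite /gnode ifF ?addKn//; lia.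
Qed.

(** The number of ends of [A] that are end points of the state not coming from [p] or [q]: end
    points of Gamma, or cuts at other vertical tangents. *)
Definition spare S A : nat := 2 - degree (outer S) A - incident p A - incident q A.

Lemma degree_outer S A : degree (outer S) A + incident p A + incident q A +
  \sum_(r | others r) incident r A * (vert r && ~~ level S r) = degree_at A.
Proof.
rewrite degree_links degree_at_sum [in RHS](bigD1 p)//=.
rewrite [in RHS](bigD1 q) 1?eq_sym//=.
rewrite [X in _ = _ + (_ + X)](eq_bigr (fun r => incident r A * (~~ vert r || level S r) +
  incident r A * (vert r && ~~ level S r))); last first.
  by move=> r _; case: incident; case: vert; case: level.
by rewrite big_split /= /others; lia.
Qed.

Lemma vert_level S r : vert r -> level S r = S r.
Proof. by rewrite /vert /level; case: (kind r) => // _; rewrite addbF. Qed.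

Lemma spare_gt0 S A : 0 < spare S A <->
  ended A \/ exists r, [/\ others r, vert r, ~~ S r & incident r A].
Proof.
have := degree_outer S A; have := wf_degree wf A; rewrite (wf_ended wf) /spare.
set s := \sum_(r | _) _ => le2 E.
have sE : 0 < s <-> exists r, [/\ others r, vert r, ~~ S r & incident r A].
  rewrite lt0n sum_nat_eq0 negb_forall; split=> [/existsP[r]|[r [or vr Sr ir]]].
    rewrite negb_imply => /andP[or]; rewrite muln_eq0 !eqb0 negb_or !negbK => /and3P[ir vr].
    by rewrite vert_level//; exists r.
  by apply/existsP; exists r; rewrite or vr vert_level// Sr ir.
split=> [sp|[lt2|/sE]]; last 2 first; try lia.
have [lt2|ge2] := ltnP (degree_at A) 2; [by left|right; apply/sE; lia].
Qed.

Lemma outer_degree_le S A : degree (outer S) A + incident p A + incident q A <= 2.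
Proof. by have := degree_outer S A; have := wf_degree wf A; lia. Qed.

Lemma node_class S X :
  \sum_(A | conn (outer S) X A) (2 - degree (outer S) A) =
  \sum_(A | conn (outer S) X A) spare S A + \sum_(i <- iota 0 n) conn (outer S) X (gnode i).
Proof.
rewrite (eq_bigr (fun i => \sum_(A | conn (outer S) X A) (gnode i == A))); last first.
  by move=> i _; rewrite class_pick.
rewrite exchange_big -big_split /=; apply: eq_bigr => A _; rewrite gnode_count /spare.
by have := outer_degree_le S A; lia.
Qed.

(** By [class_ends] the outer class of a node has two free ends or none; the node itself is one, so
    there are two, and the other is either a single other node or a single spare end. This is why
    the outside is a partial matching. *)
Lemma node_class2 S i : i < n ->
  \sum_(A | conn (outer S) (gnode i) A) spare S A +
  \sum_(j <- iota 0 n | j != i) conn (outer S) (gnode i) (gnode j) = 1.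
Proof.
move=> ir; have deg A : degree (outer S) A <= 2 by have := outer_degree_le S A; lia.
have := class_ends deg (gnode i); rewrite node_class.
rewrite (bigD1_seq i) ?iota_uniq ?mem_iota//= conn_refl !inE; lia.
Qed.

Definition matching S : seq (nat * nat) :=
  [seq e <- index_pairs n | conn (outer S) (gnode e.1) (gnode e.2)].

Lemma three_nodes S i j k : i < n -> j < n -> k < n -> j != i -> k != i -> j != k ->
  conn (outer S) (gnode i) (gnode j) -> conn (outer S) (gnode i) (gnode k) -> False.
Proof.
move=> ir jr kr ji ki jk ij ik.
have : \sum_(j <- iota 0 n | j != i) conn (outer S) (gnode i) (gnode j) <= 1.
  by have := node_class2 S ir; lia.
rewrite big_mkcond /= (bigD1_seq j) ?iota_uniq ?mem_iota//= ji ij.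
rewrite big_mkcond /= (bigD1_seq k) ?iota_uniq ?mem_iota//= (eq_sym k) jk ki ik.
lia.
Qed.

Lemma matchingP S e : e \in matching S <->
  e.1 < e.2 < n /\ conn (outer S) (gnode e.1) (gnode e.2).
Proof.
rewrite mem_filter; split=> [/andP[ce /index_pairsP]|[/index_pairsP-> ->]] //.
Qed.

(** Two pairs with a common index would put three nodes in one outer class. *)
Lemma matching_disjoint S : matching S \in disjoint_pairs (index_pairs n) [::].
Proof.
apply: filter_disjoint_pairs; last by apply/allP => e _; rewrite !in_nil.
apply: pairwise_uniq_sub; first by rewrite filter_uniq ?index_pairs_uniq.
move=> [a b] [c d] /matchingP[/= /andP[ab bn] Cab] /matchingP[/= /andP[cd dn] Ccd] ne.
apply/negP; rewrite /share_index !inE /=.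
have an : a < n by exact: ltn_trans bn. have cn : c < n by exact: ltn_trans dn.
have Cba : conn (outer S) (gnode b) (gnode a) by rewrite conn_sym.
have Cdc : conn (outer S) (gnode d) (gnode c) by rewrite conn_sym.
case/orP => /orP[] /eqP E; subst.
- apply: (@three_nodes S a b d) => //; rewrite ?(gtn_eqF ab) ?(gtn_eqF cd)//.
  by apply: contra_neq ne => ->.
- by apply: (@three_nodes S b a d) => //; lia.
- by apply: (@three_nodes S a b c) => //; lia.
- apply: (@three_nodes S b a c) => //; try lia.
  by apply: contra_neq ne => ->.
Qed.

(** By [node_class2], the other end of the outer path from a node is another node or a spare end,
    never both. *)
Lemma unmatchedP S i : i < n ->
  unmatched (matching S) i <-> exists2 A, conn (outer S) (gnode i) A & 0 < spare S A.
Proof.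
move=> ir; have E := node_class2 S ir.
have sE : unmatched (matching S) i <-> \sum_(j <- iota 0 n | j != i) conn (outer S) (gnode i) (gnode j) = 0.
  split=> [/allP un|/eqP].
    rewrite big_seq_cond big1// => j /andP[]; rewrite mem_iota => /andP[_ jr] ji.
    apply/eqP; rewrite eqb0; apply/negP => Cij.
    have [ij|ij|ij] := ltngtP i j; last by rewrite ij eqxx in ji.
      have /un : (i, j) \in matching S by apply/matchingP; rewrite /= ij.
      by rewrite /= eqxx.
    have /un : (j, i) \in matching S by apply/matchingP; rewrite /= ij conn_sym.
    by rewrite /= eqxx andbF.
  rewrite sum_nat_seq_eq0 => /allP H; apply/allP => e /matchingP[/andP[e12 e2] Ce].
  apply/andP; split; apply/negP => /eqP ei; subst i.
    by have := H e.2; rewrite mem_iota e2 gtn_eqF//= Ce => /(_ erefl).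
  have := H e.1; rewrite mem_iota (ltn_trans e12 e2) ltn_eqF//= conn_sym Ce.
  by move=> /(_ erefl).
have pE : 0 < \sum_(A | conn (outer S) (gnode i) A) spare S A <->
    exists2 A, conn (outer S) (gnode i) A & 0 < spare S A.
  rewrite lt0n sum_nat_eq0 negb_forall; split=> [/existsP[A]|[A CA sA]].
    by rewrite negb_imply => /andP[CA sA]; exists A; rewrite ?lt0n.
  by apply/existsP; exists A; rewrite CA -lt0n.
rewrite -pE sE; lia.
Qed.

Definition state_labels S : seq nat :=
  square_labels (vert p) (vert q) (matching S) (level S p) (level S q).

Definition pair_joins S : seq (nat * nat) :=
  joins (vert p) (level S p) ++ map (shift_pair n1) (joins (vert q) (level S q)).

Lemma pair_joins_lt S e : e \in pair_joins S -> (e.1 < n) && (e.2 < n).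
Proof.
rewrite mem_cat => /orP[/joins_lt|/mapP[e' /joins_lt He ->]] /=.
  by case/andP => e1 e2; rewrite !(leq_trans _ (leq_addr n2 n1)).
by rewrite !ltn_add2l.
Qed.

Lemma links_pair S :
  links S predT =i [seq (gnode e.1, gnode e.2) | e <- pair_joins S] ++ outer S.
Proof.
have E1 : [seq (gnode e.1, gnode e.2) | e <- joins (vert p) (level S p)] = splice p (level S p).
  by apply/eq_in_map => e /joins_lt/andP[e1 e2]; rewrite /gnode e1 e2.
have E2 : [seq (gnode e.1, gnode e.2) | e <- map (shift_pair n1) (joins (vert q) (level S q))] =
    splice q (level S q).
  rewrite -map_comp; apply/eq_in_map => e _; rewrite /gnode /=.
  by rewrite !ifF ?addKn//; lia.
move=> x; rewrite map_cat E1 E2 !mem_cat !links_mem.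
apply/existsP/orP => [[r /= xr]|].
  have [rp|rp] := eqVneq r p; first by subst r; left; rewrite xr.
  have [rq|rq] := eqVneq r q; first by subst r; left; rewrite xr orbT.
  by right; apply/existsP; exists r; rewrite /others rp rq.
case=> [/orP[] H|/existsP[r /andP[_ H]]]; [by exists p|by exists q|by exists r].
Qed.

Lemma size_state_labels S : size (state_labels S) = n.
Proof. by rewrite size_foldl_relabel size_iota. Qed.

(** Only nodes are compared, so the outer graph may be replaced by its matching: after the matching
    the labels express the outer connection, and then the edges at [p] and [q] are added on both
    sides. *)
Lemma state_labels_eq S i j : i < n -> j < n ->
  (nth 0 (state_labels S) i == nth 0 (state_labels S) j) =
  (component_of S (gnode i) == component_of S (gnode j)).
Proof.
move=> ir jr; rewrite component_of_eq (eq_conn (links_pair S)).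
rewrite /state_labels /square_labels /labels foldl_cat.
have sz : size (foldl relabel (iota 0 n) (matching S)) = n.
  by rewrite size_foldl_relabel size_iota.
apply: foldl_relabel_conn; rewrite ?sz//; last exact: pair_joins_lt.
move=> {ir jr}i {}j ir jr; apply/eqP/idP.
  apply: (@foldl_relabel_sound (fun i j => conn (outer S) (gnode i) (gnode j))); rewrite ?size_iota//.
  - by move=> k; exact: conn_refl.
  - by move=> k l; exact: conn_sym.
  - by move=> k l m; exact: conn_trans.
  - by move=> k l kr lr; rewrite !nth_iota// !add0n => ->; exact: conn_refl.
  - by move=> e /matchingP[/andP[e12 e2] ->]; rewrite e2 (ltn_trans e12 e2).
move=> Cij; have [ij|ij|->//] := ltngtP i j.
  by apply: (@foldl_relabel_mem _ _ (i, j)); rewrite ?size_iota//; apply/matchingP; rewrite /= ij.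
apply/esym/(@foldl_relabel_mem _ _ (j, i)); rewrite ?size_iota//; apply/matchingP.
by rewrite /= ij conn_sym.
Qed.

Lemma conn_outer_links S A B : conn (outer S) A B -> conn (links S predT) A B.
Proof.
apply: connect_sub => {}A {}B H; apply: connect1; move: H.
by rewrite /linked !links_pair !mem_cat => /orP[] ->; rewrite !orbT.
Qed.

(** Only the last stretch of a path matters: after its last passage through [p] or [q] it stays in
    the outer graph. *)
Lemma near_node S X A : conn (links S predT) X A ->
  conn (outer S) X A \/ exists2 k, k < n & conn (outer S) (gnode k) A.
Proof.
rewrite (eq_conn (links_pair S)).
have : forall e, e \in pair_joins S -> (e.1 < n) && (e.2 < n) by move=> e; exact: pair_joins_lt.
elim: (pair_joins S) X => [|e es IH] X lt_n /=; first by left.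
have /andP[e1 e2] := lt_n e (mem_head _ _).
have {}IH Y := IH Y (fun e' ee => lt_n e' (mem_behead (s := e :: es) ee)).
have node Y k : k < n -> conn ([seq (gnode e.1, gnode e.2) | e <- es] ++ outer S) (gnode k) A ->
    conn (outer S) Y A \/ exists2 k, k < n & conn (outer S) (gnode k) A.
  by move=> kr /IH[H|H]; right => //; exists k.
rewrite conn_cons => /or3P[/IH//|/andP[_]|/andP[_]]; exact: node.
Qed.

Definition state_opens S : seq bool :=
  square_opens (vert p) (vert q) (matching S) (level S p) (level S q) (state_labels S).

Lemma looseP S i : i < n ->
  loose (vert p) (vert q) (matching S) (level S p) (level S q) i ->
  exists2 A, conn (outer S) (gnode i) A &
    ended A \/ exists r, [/\ vert r, ~~ S r & incident r A].
Proof.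
move=> ir; rewrite /loose => /orP[/(unmatchedP S ir)[A CA /spare_gt0[eA|[r [_ vr Sr ir']]]]|].
- by exists A => //; left.
- by exists A => //; right; exists r.
have vert_case r : vert r -> ~~ level S r -> incident r (gnode i) -> exists2 A,
    conn (outer S) (gnode i) A & ended A \/ exists r, [/\ vert r, ~~ S r & incident r A].
  move=> vr; rewrite vert_level// => Sr ii; exists (gnode i); first exact: conn_refl.
  by right; exists r.
case: ifP => i1 /andP[vr lr]; apply: (vert_case _ vr lr).
  by apply/incident1; exists i; rewrite // /nodes1 mem_iota.
by apply/incident2; exists i; rewrite // /nodes2 mem_iota -/n1 -/n2; lia.
Qed.

Lemma state_opens_nth S i : i < n ->
  nth false (state_opens S) i = is_open S (component_of S (gnode i)).
Proof.
move=> ir; rewrite /state_opens /square_opens (nth_map 0) ?size_state_labels//.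
apply/mapP/existsP => [[j]|[A]].
  rewrite mem_filter mem_iota => /andP[lj /andP[_ jr]] /eqP; rewrite state_labels_eq//.
  rewrite component_of_eq => Cij; have [A CA H] := looseP jr lj; exists A.
  rewrite in_component (conn_trans Cij (conn_outer_links CA)) /=.
  case: H => [->//|[r [vr Sr iA]]]; apply/orP; right; apply/existsP; exists r.
  by rewrite iA Sr [is_vert _]vr.
case/andP; rewrite in_component => CiA H.
(* The end point at [A] has to be moved to a node. If it comes from [p] or [q], then [A] itself is
   the piece of a node ([flag]). Otherwise [A] has a spare end, and an outer path leads from some
   node to [A] ([sparing]). *)
suff [j jr [Cj lj]] : exists2 j, j < n & conn (links S predT) (gnode i) (gnode j) /\
    loose (vert p) (vert q) (matching S) (level S p) (level S q) j.
  exists j; last by apply/eqP; rewrite state_labels_eq// component_of_eq Cj.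
  by rewrite mem_filter lj mem_iota; exact: jr.
have flag r j : j < n -> gnode j = A -> vert r -> ~~ S r ->
    (if j < n1 then r == p else r == q) ->
    exists2 j, j < n & conn (links S predT) (gnode i) (gnode j) /\
    loose (vert p) (vert q) (matching S) (level S p) (level S q) j.
  move=> jr gj vr Sr jE; exists j => //; rewrite gj; split=> //; rewrite /loose -/n1.
  by case: (j < n1) jE => /eqP E; subst r; rewrite vr vert_level// Sr orbT.
have sparing : 0 < spare S A -> exists2 j, j < n & conn (links S predT) (gnode i) (gnode j) /\
    loose (vert p) (vert q) (matching S) (level S p) (level S q) j.
  move=> sA; have [k kr Ck] : exists2 k, k < n & conn (outer S) (gnode k) A.
    by case: (near_node CiA) => [Ci|//]; exists i.
  exists k => //; split.
    by apply: conn_trans CiA _; rewrite conn_sym; exact: conn_outer_links.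
  by apply/orP; left; apply/(unmatchedP S kr); exists A.
case/orP: H => [eA|/existsP[r /and3P[vr Sr iA]]]; first by apply/sparing/spare_gt0; left.
have [rp|rp] := eqVneq r p.
  subst r; have [j + gj] := proj1 (incident1 A) iA; rewrite mem_iota => /andP[_ j1].
  by apply: (flag p j); rewrite ?j1//; rewrite /n -/n1; lia.
have [rq|rq] := eqVneq r q.
  subst r; have [j + gj] := proj1 (incident2 A) iA; rewrite mem_iota => /andP[j1 j2].
  by apply: (flag q j); rewrite ?ifF//; rewrite -/n1 in j1 j2 *; lia.
by apply/sparing/spare_gt0; right; exists r; rewrite /others rp rq.
Qed.

End Pair.
End Diagrams.

(** A path that starts in [C] never leaves it, hence never meets an edge on which the two relations
    differ. *)
Lemma connect_local (T : finType) (e e' : rel T) (C : pred T) (A : T) : C A ->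
  (forall X Y, C X -> e X Y = e' X Y) -> (forall X Y, C X -> e X Y -> C Y) ->
  connect e A =1 connect e' A.
Proof.
move=> CA ee' Ce B; apply/connectP/connectP => -[s + ->].
  elim: s A CA => [|X s IH] A CA /=; first by exists [::].
  case/andP=> AX /(IH X (Ce _ _ CA AX))[t tX ->].
  by exists (X :: t); rewrite //= -ee'// AX.
elim: s A CA => [|X s IH] A CA /=; first by exists [::].
rewrite -ee'// => /andP[AX /(IH X (Ce _ _ CA AX))[t tX ->]].
by exists (X :: t); rewrite //= AX.
Qed.

(** * Signs on the components at two singular points *)

Section Enhanced.
Variables (D : diagram) (nd : sing D -> nat -> piece D).
Hypothesis wf : well_formed nd.
Implicit Types (S : state D) (p q r : sing D) (A B : piece D) (x y z : estate D).
Implicit Types (C : {set piece D}).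

Lemma splice_incident r b A B : linked (splice nd r b) A B -> incident r A && incident r B.
Proof.
have H X Y : (X, Y) \in splice nd r b -> incident r X && incident r Y.
  case/mapP => e /joins_lt/andP[e1 e2] [-> ->]; rewrite !(wf_incident wf).
  by rewrite !nd_mem.
by case/orP => /H// /andP[-> ->].
Qed.

Lemma switchE S r r' : switch S r r' = if r' == r then ~~ S r' else S r'.
Proof. by rewrite ffunE. Qed.

Lemma level_switch S r r' : level (switch S r) r' = (r' == r) (+) level S r'.
Proof. by rewrite /level switchE; case: eqP => // _; rewrite addNb. Qed.

Lemma switchK S r : switch (switch S r) r = S.
Proof. by apply/ffunP => r'; rewrite !switchE; case: eqP => // _; rewrite negbK. Qed.

Lemma touchesP S r X : reflect (exists2 A, A \in component_of S X & incident r A)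
  (touches r (component_of S X)).
Proof. by apply: (iffP existsP) => [[A /andP[? ?]]|[A ? ?]]; exists A => //; apply/andP. Qed.

Lemma linked_links S A B : linked (links nd S predT) A B =
  [exists r, linked (splice nd r (level S r)) A B].
Proof.
rewrite /linked !links_mem; apply/orP/existsP => [[]/existsP[r /= H]|[r /orP[] H]].
- by exists r; rewrite H.
- by exists r; rewrite H orbT.
- by left; apply/existsP; exists r.
- by right; apply/existsP; exists r.
Qed.

Lemma switch_component S r A : ~~ touches r (component_of S A) ->
  component_of (switch S r) A = component_of S A.
Proof.
move=> /touchesP nt; apply/setP => B; rewrite !(in_component wf).
apply/esym/(@connect_local _ _ _ (fun X => X \in component_of S A)).
- by rewrite (in_component wf) conn_refl.
- move=> X Y XA; rewrite !linked_links; apply/existsP/existsP => -[r' H]; exists r';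
    rewrite level_switch in H *; case: eqP H => [->|//] H;
    by case: nt; exists X => //; case/andP: (splice_incident H).
- move=> X Y; rewrite !(in_component wf) => AX XY; apply: conn_trans AX _.
  exact: connect1.
Qed.

Lemma switch_touches S r A :
  touches r (component_of (switch S r) A) = touches r (component_of S A).
Proof.
have [|nt] := boolP (touches r (component_of S A)); last first.
  by rewrite switch_component//; exact: negbTE.
apply: contraTT => nt; rewrite -[S in component_of S](switchK S r).
by rewrite switch_component.
Qed.

Lemma is_open_switch S r C : ~~ touches r C -> is_open (switch S r) C = is_open S C.
Proof.
move=> /existsP nt; apply: eq_existsb => A; have [AC|//] := boolP (A \in C).
congr (_ || _); apply: eq_existsb => r'; rewrite switchE; case: eqP => // ->.
have -> : incident r A = false; last by rewrite !andbF.
by apply/negP => iA; apply: nt; exists A; rewrite AC.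
Qed.

Lemma componentsP S C : reflect (exists A, C = component_of S A) (C \in components S).
Proof. by apply: (iffP imsetP) => [[A _ ->]|[A ->]]; exists A. Qed.

Lemma positive_sub x : positive x \subset components (est x).
Proof. exact: (valP x). Qed.

Section Pair.
Variables (p q : sing D).
Hypothesis pq : p != q.
Let n := nnodes (vert p) + nnodes (vert q).
Let g := gnode nd p q.
Let L S := state_labels nd p q S.
Let O S := state_opens nd p q S.

Definition sign x (i : nat) : bool := component_of (est x) (g i) \in positive x.
Definition table x : seq bool := [seq sign x i | i <- iota 0 n].

Lemma table_nth x i : i < n -> nth false (table x) i = sign x i.
Proof. by move=> ir; rewrite (nth_map 0) ?size_iota// nth_iota. Qed.

(** The part of an enhanced state that neither switch can change; [table] records the rest. *)
Definition far x : {set {set piece D}} :=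
  [set C in positive x | ~~ touches p C && ~~ touches q C].

(* [rng] and [oth] are the nodes of [r] and [r'], one of which is [p] and the other [q]. *)
Record node_ranges r r' (rng oth : seq nat) : Prop := NodeRanges {
  rng_lt : forall i, i \in rng -> i < n;
  oth_lt : forall i, i \in oth -> i < n;
  rngP : forall A, incident r A <-> exists2 i, i \in rng & g i = A;
  othP : forall A, incident r' A <-> exists2 i, i \in oth & g i = A;
  ranges_far : forall C, (~~ touches p C && ~~ touches q C) = (~~ touches r C && ~~ touches r' C)
}.

Lemma node_ranges1 : node_ranges p q (nodes1 (vert p)) (nodes2 (vert p) (vert q)).
Proof.
split=> //; try exact: incident1; try exact: incident2.
- by move=> i; rewrite mem_iota /n; lia.
- by move=> i; rewrite mem_iota /n; lia.
Qed.

Lemma node_ranges2 : node_ranges q p (nodes2 (vert p) (vert q)) (nodes1 (vert p)).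
Proof.
split; try exact: incident1; try exact: incident2.
- by move=> i; rewrite mem_iota /n; lia.
- by move=> i; rewrite mem_iota /n; lia.
- by move=> C; rewrite andbC.
Qed.

Section Ranges.
Variables (r r' : sing D) (rng oth : seq nat).
Hypothesis nr : node_ranges r r' rng oth.

Lemma component_rng S C : C \in components S -> touches r C ->
  exists2 i, i \in rng & C = component_of S (g i).
Proof.
case/componentsP => X -> /touchesP[A AX /(rngP nr)[i ir gi]]; exists i => //.
by apply/eqP; rewrite (component_of_eq wf) gi -(in_component wf).
Qed.

Lemma component_oth S C : C \in components S -> touches r' C ->
  exists2 i, i \in oth & C = component_of S (g i).
Proof.
case/componentsP => X -> /touchesP[A AX /(othP nr)[i ir gi]]; exists i => //.
by apply/eqP; rewrite (component_of_eq wf) gi -(in_component wf).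
Qed.

Lemma touches_rng S i : i \in rng -> touches r (component_of S (g i)).
Proof.
move=> ir; apply/touchesP; exists (g i); first by rewrite (in_component wf) conn_refl.
by apply/(rngP nr); exists i.
Qed.

Lemma count_components S (a : pred {set piece D}) :
  #|[set C in components S | touches r C && a C]| =
  size (undup [seq nth 0 (L S) i | i <- rng & a (component_of S (g i))]).
Proof.
set s := [seq i <- rng | _].
have -> : size (undup [seq nth 0 (L S) i | i <- s]) = size (undup [seq component_of S (g i) | i <- s]).
  apply: size_undup_map => i j; rewrite !mem_filter => /andP[_ ir] /andP[_ jr].
  by apply: (state_labels_eq wf pq); exact: (rng_lt nr).
rewrite -(card_uniqP (undup_uniq _)); apply: eq_card => C; rewrite inE mem_undup.
apply/andP/mapP => [[CS /andP[tC aC]]|[i]].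
  have [i ir E] := component_rng CS tC; exists i => //.
  by rewrite mem_filter ir -E aC.
rewrite mem_filter => /andP[ai ir] ->; split; first by apply/componentsP; exists (g i).
by rewrite touches_rng.
Qed.

Lemma profile_local x :
  profile r x = local_profile rng (L (est x)) (O (est x)) (table x).
Proof.
have pos C : C \in positive x -> C \in components (est x) by move/subsetP: (positive_sub x); apply.
(* The four entries of the profile are one statement, with [a] a Boolean function of the sign and of
   openness. *)
have H (a : bool -> bool -> bool) (P : {set {set piece D}}) (b : pred {set piece D}) :
    (forall C, C \in components (est x) ->
      (C \in P) && b C = a (C \in positive x) (is_open (est x) C)) ->
    P \subset components (est x) ->
    #|[set C in P | touches r C && b C]| = size (undup [seq nth 0 (L (est x)) i |
      i <- rng & a (nth false (table x) i) (nth false (O (est x)) i)]).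
  move=> HP Psub; rewrite -(@eq_in_filter _ (fun i =>
     a (component_of (est x) (g i) \in positive x) (is_open (est x) (component_of (est x) (g i))))).
    rewrite -(count_components (est x) (fun C => a (C \in positive x) (is_open (est x) C))).
    apply: eq_card => C; rewrite !inE.
    have [CS|CS] := boolP (C \in components (est x)); last first.
      by rewrite (contraNF (subsetP Psub C) CS).
    by rewrite -HP// andbCA.
  move=> i /(rng_lt nr) ir; rewrite table_nth//.
  by rewrite (state_opens_nth wf pq).
have neg : negative x \subset components (est x) by exact: subsetDl.
congr (_, _, _, _).
- by apply: (H (fun s o => s && o)) => //; exact: positive_sub.
- by apply: (H (fun s o => ~~ s && o)) => // C CS; rewrite inE CS andbT.
- by apply: (H (fun s o => s && ~~ o)) => //; exact: positive_sub.
- by apply: (H (fun s o => ~~ s && ~~ o)) => // C CS; rewrite inE CS andbT.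
Qed.

Definition local_contribution S S' (s s' : seq bool) : bool :=
  agree_off rng oth (L S) s s' &&
  ((local_profile rng (L S) (O S) s, local_profile rng (L S') (O S') s') \in rules (vert r)).

Lemma touches_rng_label S i : i \in oth ->
  touches r (component_of S (g i)) = (nth 0 (L S) i \in [seq nth 0 (L S) j | j <- rng]).
Proof.
move=> io; have it := oth_lt nr io; apply/idP/mapP => [ti|[j jr /eqP E]].
  have CS : component_of S (g i) \in components S by apply/componentsP; exists (g i).
  have [j jr E] := component_rng CS ti.
  by exists j => //; apply/eqP; rewrite (state_labels_eq wf pq)// ?E//; exact: (rng_lt nr).
move: E; rewrite (state_labels_eq wf pq)//; last exact: (rng_lt nr).
by move=> /eqP->; exact: touches_rng.
Qed.

(** A component that avoids [r] is either far, or touches [r'] and so contains one of the nodes in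
    [oth]. The first kind is compared by [far], the second by [agree_off]. *)
Lemma untouched_local x y : est y = switch (est x) r ->
  (untouched r (positive y) == untouched r (positive x)) =
  (far y == far x) && agree_off rng oth (L (est x)) (table x) (table y).
Proof.
move=> Ey; have comp X : ~~ touches r (component_of (est x) X) ->
    component_of (est y) X = component_of (est x) X.
  by rewrite Ey; exact: switch_component.
have tch X : touches r (component_of (est y) X) = touches r (component_of (est x) X).
  by rewrite Ey switch_touches.
have mem_u P C : (C \in untouched r P) = (C \in P) && ~~ touches r C by rewrite inE.
have mem_f u C : (C \in far u) = (C \in positive u) && (~~ touches r C && ~~ touches r' C).
  by rewrite inE (ranges_far nr).
apply/eqP/andP => [E|[/eqP E /allP ag]].
  have PE C : ~~ touches r C -> (C \in positive y) = (C \in positive x).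
    by move=> nC; have := mem_u (positive y) C; rewrite E mem_u nC !andbT.
  split; first by apply/eqP/setP => C; rewrite !mem_f; case: (boolP (touches r C)) => [_|/PE->];
    rewrite ?andbF.
  apply/allP => i io; rewrite !table_nth ?(oth_lt nr)// -touches_rng_label//.
  have [//|nt] := boolP (touches _ _); apply/eqP.
  by rewrite /sign -PE// comp.
apply/setP => C; rewrite !mem_u; have [_|nt] := boolP (touches r C); first by rewrite !andbF.
rewrite !andbT; have [t'|nt'] := boolP (touches r' C); last first.
  by have := mem_f y C; rewrite E mem_f nt nt' !andbT.
have agi i : i \in oth -> ~~ touches r (component_of (est x) (g i)) ->
    (component_of (est x) (g i) \in positive y) = (component_of (est x) (g i) \in positive x).
  move=> io nti; have := ag i io; rewrite !table_nth ?(oth_lt nr)// -touches_rng_label//.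
  by rewrite (negPf nti) /sign comp// => /eqP->.
apply/idP/idP => Cu.
  have [i io E'] := component_oth (subsetP (positive_sub y) _ Cu) t'.
  have nti : ~~ touches r (component_of (est x) (g i)) by rewrite -tch -E'.
  by rewrite E' comp// -agi// -comp// -E'.
have [i io E'] := component_oth (subsetP (positive_sub x) _ Cu) t'.
by rewrite E' agi// -E'.
Qed.

Lemma contribution_local x y : est y = switch (est x) r -> ~~ level (est x) r ->
  contribution r x y = (far y == far x) && local_contribution (est x) (est y) (table x) (table y).
Proof.
move=> Ey lr; rewrite /contribution Ey eqxx (untouched_local Ey) !profile_local.
have -> : switchable (est x) r.
  by move: lr; rewrite /switchable /level; case: (est x r); case: is_neg.
by rewrite -Ey -andbA.
Qed.

End Ranges.

(** An enhanced state over [S] is determined by its far part and its table, and every combination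
    occurs. This bijection turns the number of intermediate states into a count over
    [sign_tables]. *)
Lemma table_perm S (F : {set {set piece D}}) : F \subset components S ->
  {in F, forall C, ~~ touches p C && ~~ touches q C} ->
  perm_eq [seq table y | y <- enum [set y | (est y == S) && (far y == F)]] (sign_tables (L S)).
Proof.
move=> FS Ffar; apply: uniq_perm.
- rewrite map_inj_in_uniq ?enum_uniq// => y z.
  rewrite !mem_enum !inE => /andP[/eqP yS /eqP yF] /andP[/eqP zS /eqP zF] E.
  have sE i : i < n -> sign y i = sign z i by move=> ir; rewrite -!table_nth// E.
  have sub u v : est u = S -> est v = S -> far u = F -> far v = F ->
      (forall i, i < n -> sign u i = sign v i) -> forall C, C \in positive u -> C \in positive v.
    move=> uS vS uF vF H C Cu; have CS := subsetP (positive_sub u) _ Cu.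
    have tr r r' rng oth (nr : node_ranges r r' rng oth) : touches r C -> C \in positive v.
      move=> tC; have [i ir EC] := component_rng nr CS tC.
      have := H i (rng_lt nr ir); rewrite /sign -EC Cu => /esym.
      by rewrite vS -uS -EC.
    have [/(tr _ _ _ _ node_ranges1)//|np] := boolP (touches p C).
    have [/(tr _ _ _ _ node_ranges2)//|nq] := boolP (touches q C).
    have : C \in far u by rewrite inE Cu np nq.
    by rewrite uF -vF inE => /andP[].
  apply/val_inj/injective_projections; first exact: etrans yS (esym zS).
  by apply/setP => C; apply/idP/idP; apply: sub => // i ir; rewrite sE.
- exact: undup_uniq.
move=> s; apply/mapP/idP => [[y]|].
  rewrite mem_enum inE => /andP[/eqP yS _] ->.
  (* The sign of a label is that of any of its nodes, as nodes with the same label lie in the same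
     component. *)
  pose h l := has (fun i => (nth 0 (L S) i == l) && sign y i) (iota 0 n).
  suff -> : table y = map h (L S) by exact: mem_sign_tables.
  apply: (@eq_from_nth _ false).
    by rewrite !size_map size_iota size_state_labels.
  move=> i; rewrite size_map size_iota => ir.
  rewrite table_nth// (nth_map 0) ?size_state_labels// /h.
  apply/idP/hasP => [si|[j]]; first by exists i; rewrite ?mem_iota// eqxx.
  rewrite mem_iota => /andP[_ jr] /andP[]; rewrite (state_labels_eq wf pq)// /sign yS.
  by move=> /eqP->.
case/sign_tablesP => h ->.
(* The required enhanced state has the far part [F] and, at the nodes, the positive components
   prescribed by [h]. *)
pose N := [set component_of S (g (val i)) | i : 'I_n & h (nth 0 (L S) i)].
have sub : F :|: N \subset components S.
  rewrite subUset FS; apply/subsetP => C /imsetP[i _ ->]; apply/componentsP.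
  by exists (g i).
exists (Sub (S, F :|: N) sub : estate D).
  rewrite mem_enum inE /est SubK eqxx /=; apply/eqP/setP => C; rewrite inE /positive SubK /= !inE.
  have [CF|CF] /= := boolP (C \in F); first by rewrite Ffar.
  apply/negP => /andP[/imsetP[i _ ->]] /andP[].
  have := ltn_ord i; set j := val i; rewrite -/(val i) -/j => jr.
  have [i1|i1] := ltnP j (nnodes (vert p)).
    by rewrite (touches_rng node_ranges1)// /nodes1 mem_iota.
  by rewrite (touches_rng node_ranges2) ?andbF// /nodes2 mem_iota i1.
apply: (@eq_from_nth _ false).
  by rewrite !size_map size_iota size_state_labels.
move=> i; rewrite size_map size_state_labels => ir.
rewrite table_nth// (nth_map 0) ?size_state_labels// /sign /est /positive SubK /= inE.
have -> : (component_of S (g i) \in F) = false.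
  apply/negP => /Ffar /andP[].
  have [i1|i1] := ltnP i (nnodes (vert p)).
    by rewrite (touches_rng node_ranges1)// /nodes1 mem_iota.
  by move=> _; rewrite (touches_rng node_ranges2)// /nodes2 mem_iota i1.
apply/idP/imsetP => [hi|[j]]; first by exists (Ordinal ir); rewrite ?inE.
rewrite inE => hj /eqP; rewrite -(state_labels_eq wf pq)//; last exact: ltn_ord.
by move=> /eqP->.
Qed.

End Pair.
End Enhanced.

(** * The differential *)

Section Parity.
Variables (D : diagram) (nd : sing D -> nat -> piece D).
Hypothesis wf : well_formed nd.
Implicit Types (S : state D) (p q r : sing D) (x y z : estate D).

Lemma contribution_est r x y : contribution r x y ->
  est y = switch (est x) r /\ ~~ level (est x) r.
Proof.
case/and4P => sw /eqP -> _ _; split=> //.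
by move: sw; rewrite /switchable /level; case: (est x r); case: is_neg.
Qed.

Definition paths2 r r' x z : nat := #|[set y | contribution r x y && contribution r' y z]|.

Section Pair.
Variables (p q : sing D).
Hypothesis pq : p != q.
Let L S := state_labels nd p q S.

(** Each of the two steps preserves the far part, so it must agree in [x] and [z]; it is then also
    that of the intermediate state, of which only the table is free. *)
Lemma path_count r r' rng oth x z : node_ranges nd p q r r' rng oth ->
  node_ranges nd p q r' r oth rng -> r' != r ->
  ~~ level (est x) r -> ~~ level (est x) r' -> est z = switch (switch (est x) r) r' ->
  paths2 r r' x z = (far p q x == far p q z) *
    count (fun s => local_contribution nd p q r rng oth (est x) (switch (est x) r) (table nd p q x) s &&
      local_contribution nd p q r' oth rng (switch (est x) r) (est z) s (table nd p q z))
      (sign_tables (L (switch (est x) r))).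
Proof.
move=> nr nr' rr lr lr' Ez; set S1 := switch (est x) r in Ez *.
pose F := far p q x.
pose f s := local_contribution nd p q r rng oth (est x) S1 (table nd p q x) s &&
  local_contribution nd p q r' oth rng S1 (est z) s (table nd p q z).
have lr1 : ~~ level S1 r' by rewrite level_switch (negPf rr).
have E y : contribution r x y && contribution r' y z =
    [&& est y == S1, far p q y == F, F == far p q z & f (table nd p q y)].
  have [Ey|Ey] := eqVneq (est y) S1; last first.
    by apply/negP => /andP[/contribution_est[Ey' _] _]; rewrite Ey' eqxx in Ey.
  rewrite (contribution_local wf pq nr)// (contribution_local wf pq nr')//; last 2 first.
  - by rewrite Ey.
  - by rewrite Ey.
  rewrite /f Ey -/F; case: (eqVneq (far p q y) F) => //= ->.
  by rewrite [far p q z == _]eq_sym; case: eqP => _ /=; rewrite ?andbF.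
rewrite /paths2; have [Fz|Fz] /= := eqVneq (far p q x) (far p q z); last first.
  rewrite mul0n; apply/eqP; rewrite cards_eq0; apply/eqP/setP => y.
  by rewrite !inE E [F == _](negPf Fz) !andbF.
rewrite mul1n -/f; have FS : F \subset components S1.
  apply/subsetP => C; rewrite inE => /and3P[Cx np nq].
  have /componentsP[X CX] := subsetP (positive_sub x) _ Cx.
  apply/componentsP; exists X; rewrite /S1 (switch_component wf) -?CX//.
  by have := ranges_far nr C; rewrite np nq => /esym/andP[].
have Ff : {in F, forall C, ~~ touches p C && ~~ touches q C}.
  by move=> C; rewrite inE => /andP[].
have /permP <- := table_perm wf pq FS Ff.
rewrite count_map -size_filter -(card_uniqP (filter_uniq _ (enum_uniq _))).
apply: eq_card => y; rewrite mem_filter mem_enum !inE E /= /F -Fz eqxx.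
by rewrite [f _ && _]andbC -andbA.
Qed.

(** Hence the four corners of a square have the same matching. *)
Lemma matching_eq S S' : (forall r, others p q r -> S r = S' r) ->
  matching nd p q S = matching nd p q S'.
Proof.
move=> H; rewrite /matching; have -> // : outer nd p q S = outer nd p q S'.
rewrite /outer /links; congr flatten; apply/eq_in_map => r.
by rewrite mem_enum => /H E; rewrite /level E.
Qed.

Lemma switchC S : switch (switch S p) q = switch (switch S q) p.
Proof.
by apply/ffunP => r; rewrite !switchE; case: (eqVneq r q) => [->|_] //; rewrite eq_sym (negPf pq).
Qed.

Lemma paths2_even x z : ~~ odd (paths2 p q x z + paths2 q p x z).
Proof.
have qp : q != p by rewrite eq_sym.
(* Unless both points are switchable in [x] and [z] lies over the doubly switched state, there is no
   path in either order. *)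
have none r r' : ~~ [&& ~~ level (est x) r, ~~ level (est x) r' & est z == switch (switch (est x) r) r'] ->
    r' != r -> paths2 r r' x z = 0.
  move=> H rr; apply/eqP; rewrite cards_eq0; apply/eqP/setP => y; rewrite !inE.
  apply: contraNF H => /andP[/contribution_est[Ey lr] /contribution_est[Ez]].
  by rewrite Ey level_switch (negPf rr) lr Ez Ey eqxx => ->.
have [|H] := boolP [&& ~~ level (est x) p, ~~ level (est x) q & est z == switch (switch (est x) p) q]; last first.
  by rewrite !none// -switchC andbCA.
case/and3P => lp lq /eqP Ez.
have nr1 := node_ranges1 wf pq; have nr2 := node_ranges2 wf pq.
rewrite (path_count nr1 nr2 qp lp lq Ez).
rewrite (path_count nr2 nr1 pq lq lp) -?switchC// -mulnDr.
case: (_ == _); last by rewrite mul0n.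
rewrite mul1n.
have /allP/(_ _ (matching_disjoint wf pq (est x))) := all_square_evenT (vert p) (vert q).
rewrite /square_even.
have M10 : matching nd p q (switch (est x) p) = matching nd p q (est x).
  by apply: matching_eq => r /andP[rp rq]; rewrite switchE (negPf rp).
have M01 : matching nd p q (switch (est x) q) = matching nd p q (est x).
  by apply: matching_eq => r /andP[rp rq]; rewrite switchE (negPf rq).
have M11 : matching nd p q (est z) = matching nd p q (est x).
  by apply: matching_eq => r /andP[rp rq]; rewrite Ez !switchE (negPf rp) (negPf rq).
set M := matching nd p q (est x).
(* The corners of the abstract square are identified with the states obtained from [est x] by
   switching neither point, [p], [q], or both. *)
have L00 : square_labels (vert p) (vert q) M false false = L (est x).
  by rewrite /L /state_labels (negPf lp) (negPf lq).
have L10 : square_labels (vert p) (vert q) M true false = L (switch (est x) p).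
  by rewrite /L /state_labels M10 !level_switch eqxx (negPf qp) (negPf lp) (negPf lq).
have L01 : square_labels (vert p) (vert q) M false true = L (switch (est x) q).
  by rewrite /L /state_labels M01 !level_switch eqxx (negPf pq) (negPf lp) (negPf lq).
have L11 : square_labels (vert p) (vert q) M true true = L (est z).
  by rewrite /L /state_labels M11 Ez !level_switch !eqxx (negPf pq) (negPf qp) (negPf lp) (negPf lq).
have O00 : square_opens (vert p) (vert q) M false false (L (est x)) = state_opens nd p q (est x).
  by rewrite /state_opens (negPf lp) (negPf lq).
have O10 : square_opens (vert p) (vert q) M true false (L (switch (est x) p)) = state_opens nd p q (switch (est x) p).
  by rewrite /state_opens M10 !level_switch eqxx (negPf qp) (negPf lp) (negPf lq).
have O01 : square_opens (vert p) (vert q) M false true (L (switch (est x) q)) = state_opens nd p q (switch (est x) q).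
  by rewrite /state_opens M01 !level_switch eqxx (negPf pq) (negPf lp) (negPf lq).
have O11 : square_opens (vert p) (vert q) M true true (L (est z)) = state_opens nd p q (est z).
  by rewrite /state_opens M11 Ez !level_switch !eqxx (negPf pq) (negPf qp) (negPf lp) (negPf lq).
have tab y : table nd p q y \in sign_tables (L (est y)).
  have sub : far p q y \subset components (est y).
    by apply/subsetP => C; rewrite inE => /andP[/(subsetP (positive_sub y))].
  have fy : {in far p q y, forall C, ~~ touches p C && ~~ touches q C}.
    by move=> C; rewrite inE => /andP[].
  rewrite -(perm_mem (table_perm wf pq sub fy)); apply: map_f.
  by rewrite mem_enum inE !eqxx.
rewrite L00 L10 L01 L11 O00 O10 O01 O11.
move=> /allP/(_ _ (tab x))/allP; move=> H.
have {}H := H _ (map_f _ (tab z)); move: H; rewrite /=.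
rewrite !count_filter !count_map /=.
congr (~~ odd (_ + _)); apply: eq_count => s /=;
  by rewrite /local_contribution andbC.
Qed.

End Pair.
End Parity.

Import Order.TTheory GRing.Theory Num.Theory.
Local Open Scope ring_scope.

(** * The bidegree of the differential *)

Section Degrees.
Variables (D : diagram) (nd : sing D -> nat -> piece D).
Hypothesis wf : well_formed nd.
Implicit Types (S : state D) (p q r : sing D) (x y z : estate D).

Lemma card_indicator (P : pred (sing D)) : #|[set p | P p]%SET|%:Z = \sum_p (P p : nat)%:Z.
Proof.
rewrite -sum1_card big_mkcond /= (big_morph Posz PoszD (erefl 0%:Z)).
by apply: eq_bigr => p _; rewrite inE; case: (P p).
Qed.

Definition weight S p : int := (if is_neg (kind p) then -1 else 1) * (S p : nat)%:Z.

Lemma ideg_sum S : ideg S = \sum_p weight S p.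
Proof.
rewrite /ideg /r_pos /r_neg /r_vert !card_indicator -sumrB -big_split /=.
by apply: eq_bigr => p _; rewrite /weight; case: (kind p); case: (S p).
Qed.

(** At a negative double point the switch removes a Theta_1, which counts as -1. *)
Lemma ideg_switch S r : ~~ level S r -> ideg (switch S r) = ideg S + 1.
Proof.
move=> lr; rewrite !ideg_sum (bigD1 r)//= [in RHS](bigD1 r)//=.
rewrite [X in _ + X](eq_bigr (weight S)) => [|p pr]; last first.
  by rewrite /weight switchE (negPf pr).
suff -> : weight (switch S r) r = weight S r + 1 by rewrite addrAC.
move: lr; rewrite /weight /level switchE eqxx.
by case: (S r); case: (is_neg (kind r)).
Qed.

Lemma r_vert_switch S r : ~~ level S r ->
  (r_vert (switch S r))%:Z = (r_vert S)%:Z + (vert r : nat)%:Z.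
Proof.
move=> lr; rewrite /r_vert !card_indicator (bigD1 r)//= [in RHS](bigD1 r)//=.
rewrite [X in _ + X](eq_bigr (fun p => (is_vert (kind p) && S p : nat)%:Z)) => [|p pr]; last first.
  by rewrite switchE (negPf pr).
rewrite switchE eqxx; move: lr; rewrite /level /vert addrAC.
by case: (kind r); case: (S r).
Qed.

Lemma kdeg_switch S r : ~~ level S r ->
  kdeg (switch S r) = kdeg S + (if vert r then 1 else 2).
Proof.
move=> lr; rewrite /kdeg ideg_switch// r_vert_switch//.
by case: (vert r); lia.
Qed.

(** The share in [jdeg] of the signs of the components at one singular point. *)
Definition profile_degree (s : sign_count) : int :=
  let: (a, b, c, d) := s in a%:Z - b%:Z + 2 * (c%:Z - d%:Z).

(** Checked on the list of rules; the loss is exactly what [kdeg] gains in [kdeg_switch]. *)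
Lemma rules_degree v s s' : (s, s') \in rules v ->
  profile_degree s = profile_degree s' + (if v then 1 else 2).
Proof.
have : all (fun e => profile_degree e.1 == profile_degree e.2 + (if v then 1 else 2)) (rules v).
  by case: v.
by move=> /allP H /H/eqP.
Qed.

Lemma contribution_degree r x y : contribution r x y ->
  ideg (est y) = ideg (est x) + 1 /\ jdeg y = jdeg x.
Proof.
move=> cxy; have [Ey lr] := contribution_est cxy.
split; first by rewrite Ey ideg_switch.
have /and4P[_ _ /eqP un /rules_degree] := cxy.
pose cnt (u : estate D) (P : {set {set piece D}}) (t o : bool) :=
  #|[set C in P | (touches r C == t) && (is_open (est u) C == o)]|.
have split_cnt (u : estate D) (P : {set {set piece D}}) o :
    #|[set C in P | is_open (est u) C == o]| = (cnt u P true o + cnt u P false o)%N.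
  rewrite -(cardsID [set C | touches r C]); congr (_ + _)%N; apply: eq_card => C; rewrite !inE.
    by case: (C \in P); case: (touches r C); rewrite ?andbT ?andbF.
  by case: (C \in P); case: (touches r C); rewrite ?andbT ?andbF.
(* The degree is split into the part at [r], governed by the rules, and the part of the untouched
   components, which is the same for [x] and [y]. *)
have jE u : jdeg u = kdeg (est u) + profile_degree (profile r u) +
    ((cnt u (positive u) false true)%:Z - (cnt u (negative u) false true)%:Z +
     2 * ((cnt u (positive u) false false)%:Z - (cnt u (negative u) false false)%:Z)).
  rewrite /jdeg /delta /profile /profile_degree.
  have H (P : {set {set piece D}}) : #|[set C in P | is_open (est u) C]| = (cnt u P true true + cnt u P false true)%N.
    by rewrite -split_cnt; apply: eq_card => C; rewrite !inE eqb_id.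
  have H' (P : {set {set piece D}}) : #|[set C in P | ~~ is_open (est u) C]| = (cnt u P true false + cnt u P false false)%N.
    by rewrite -split_cnt; apply: eq_card => C; rewrite !inE eqbF_neg.
  have K (P : {set {set piece D}}) : #|[set C in P | touches r C && is_open (est u) C]| = cnt u P true true.
    by apply: eq_card => C; rewrite !inE !eqb_id.
  have K' (P : {set {set piece D}}) : #|[set C in P | touches r C && ~~ is_open (est u) C]| = cnt u P true false.
    by apply: eq_card => C; rewrite !inE eqb_id eqbF_neg.
  by rewrite !H !H' !K !K'; lia.
have un_pos C : ~~ touches r C -> (C \in positive y) = (C \in positive x).
  by move=> nt; have /setP/(_ C) := un; rewrite !inE nt !andbT.
have un_comp C : ~~ touches r C -> (C \in components (est y)) = (C \in components (est x)).
  move=> nt; rewrite Ey; apply/componentsP/componentsP => -[A E]; exists A; rewrite E.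
    by rewrite (switch_component wf)// -(switch_touches wf) -E.
  by rewrite (switch_component wf)// -E.
have un_cnt o : cnt y (positive y) false o = cnt x (positive x) false o /\
    cnt y (negative y) false o = cnt x (negative x) false o.
  split; apply: eq_card => C; rewrite !inE; case: (boolP (touches r C)) => [_|nt];
    rewrite ?andbF// Ey is_open_switch// ?un_pos// -?Ey ?un_comp//.
rewrite !jE Ey kdeg_switch//.
have [-> ->] := un_cnt true; have [-> ->] := un_cnt false.
by rewrite /vert => ->; lia.
Qed.

End Degrees.

Section Differential.
Variable D : diagram.
Implicit Types (p q r : sing D) (x y z : estate D) (f : chains D).

(** The function inside [differential] gets a name to carry a linear structure, without which
    [lfunE] does not evaluate [linfun]. *)
Definition differential_fun f : chains D :=
  [ffun y => \sum_r \sum_(x | contribution r x y) f x].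

Lemma differential_fun_linear : linear differential_fun.
Proof.
move=> a f g; apply/ffunP => y; rewrite !ffunE /=.
rewrite scaler_sumr -big_split; apply: eq_bigr => r _.
rewrite scaler_sumr -big_split; apply: eq_bigr => x _.
by rewrite !ffunE.
Qed.

HB.instance Definition _ :=
  GRing.isLinear.Build 'F_2 (chains D) (chains D) *:%R differential_fun differential_fun_linear.

Lemma differentialE f y :
  differential D f y = \sum_r \sum_(x | contribution r x y) f x.
Proof. by rewrite /differential (lfunE differential_fun) ffunE. Qed.

(** The terms for [(r, r')] and [(r', r)] are grouped, an enumeration of the type deciding which of
    the two represents the pair. *)
Lemma sum_symmetric_even (P : sing D -> sing D -> nat) :
  (forall r, P r r = 0%N) -> (forall r r', r != r' -> ~~ odd (P r r' + P r' r)) ->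
  ~~ odd (\sum_r \sum_r' P r r').
Proof.
move=> P0 P2; pose lt r r' := (enum_rank r < enum_rank r')%N.
have -> : (\sum_r \sum_r' P r r' = \sum_r \sum_r' (P r r' + P r' r) * lt r r')%N.
  transitivity (\sum_r \sum_r' P r r' * lt r r' + \sum_r \sum_r' P r r' * lt r' r)%N.
    rewrite -big_split; apply: eq_bigr => r _; rewrite -big_split; apply: eq_bigr => r' _ /=.
    rewrite -mulnDr /lt; case: ltngtP => E; rewrite ?muln1// muln0.
    by rewrite (enum_rank_inj (val_inj E)) P0.
  rewrite [X in (_ + X)%N]exchange_big -big_split; apply: eq_bigr => r _.
  by rewrite -big_split; apply: eq_bigr => r' _; rewrite mulnDl.
elim/big_ind: _ => // [a b /negPf oa /negPf ob|r _]; first by rewrite oddD oa ob.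
elim/big_ind: _ => // [a b /negPf oa /negPf ob|r' _]; first by rewrite oddD oa ob.
rewrite oddM negb_and; have [->|rr] := eqVneq r r'; first by rewrite /lt ltnn orbT.
by rewrite P2.
Qed.

Lemma differentialK (nd : sing D -> nat -> piece D) : well_formed nd ->
  forall f, differential D (differential D f) = 0.
Proof.
move=> wf f; apply/ffunP => z; rewrite differentialE ffunE.
(* The coefficient of [f x] is the number of two-step paths from [x] to [z]. *)
transitivity (\sum_x f x * (\sum_r \sum_r' paths2 r r' x z)%:R).
  under eq_bigr => r' _ do under eq_bigr => y _ do rewrite differentialE.
  under eq_bigr => r' _ do under eq_bigr => y _ do under eq_bigr => r _ do rewrite big_mkcond.
  under eq_bigr => r' _ do under eq_bigr => y _ do rewrite exchange_big.
  under eq_bigr => r' _ do rewrite exchange_big.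
  rewrite exchange_big; apply: eq_bigr => x _ /=.
  rewrite natr_sum mulr_sumr.
  under eq_bigr => r' _ do rewrite exchange_big.
  rewrite exchange_big; apply: eq_bigr => r _ /=.
  rewrite natr_sum mulr_sumr; apply: eq_bigr => r' _.
  rewrite /paths2 -sum1_card natr_sum mulr_sumr big_mkcond [RHS]big_mkcond.
  by apply: eq_bigr => y _; rewrite inE andbC; do 2!case: contribution; rewrite /= ?mulr1.
rewrite big1// => x _.
suff /negPf odd0 : ~~ odd (\sum_r \sum_r' paths2 r r' x z).
  rewrite -[X in X%:R]odd_double_half odd0 add0n -muln2 natrM.
  have -> : (2%:R : 'F_2) = 0 by apply/eqP.
  by rewrite !mulr0.
apply: sum_symmetric_even => [r|r r' rr]; last exact: (paths2_even wf rr).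
(* No point is switched twice: after the first switch its level is [true]. *)
apply/eqP; rewrite cards_eq0; apply/eqP/setP => y; rewrite !inE.
apply/negP => /andP[/contribution_est[Ey lr] /contribution_est[_]].
by rewrite Ey level_switch eqxx (negPf lr).
Qed.

End Differential.

(** * The Euler characteristic *)

From mathcomp Require Import finmap.
From mathcomp Require Import all_classical all_reals all_analysis.

Section Euler.
Variable D : diagram.
Implicit Types (x y : estate D) (f : chains D) (i j : int).

Definition has_degree i j : pred (estate D) := fun x => (ideg (est x) == i) && (jdeg x == j).

Lemma basis_vector_free (s : seq (estate D)) : uniq s -> free [seq basis_vector x | x <- s].
Proof.
move=> us; apply/(@freeP _ _ _ (in_tuple _)) => /= k k0 i.
have ir : (i < size s)%N by rewrite -(size_map (@basis_vector D)).
have [x0 _] : exists x0 : estate D, True by case: s us k k0 i ir => [|x s] _ _ _ i //; exists x.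
have /ffunP/(_ (nth x0 s i)) := k0; rewrite !ffunE sum_ffunE (bigD1 i)//= big1 => [|i' i'i].
  rewrite addr0 !ffunE (nth_map x0)// ffunE eqxx => <-.
  by rewrite -[RHS]/(k i * 1) mulr1.
have ir' : (i' < size s)%N by rewrite -(size_map (@basis_vector D)).
rewrite !ffunE (nth_map x0)// ffunE nth_uniq// eq_sym -[(i' : nat) == i]/(i' == i) (negPf i'i).
by rewrite scaler0.
Qed.

Lemma dim_chains_at i j : \dim (chains_at D i j) = #|has_degree i j|.
Proof.
rewrite /chains_at (eqP (basis_vector_free (filter_uniq _ (enum_uniq _)))).
rewrite size_map size_filter -sum1_count -sum1_card big_enum_cond.
by apply: eq_bigl => x; rewrite inE.
Qed.

Lemma chains_atP i j f :
  reflect (forall x, f x != 0 -> has_degree i j x) (f \in chains_at D i j).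
Proof.
apply: (iffP idP) => [|H].
  rewrite /chains_at; set s := seq.filter _ _; set X := map _ s.
  move=> fX; have -> := @coord_span _ _ _ (in_tuple X) f fX.
  move=> x; rewrite sum_ffunE; apply: contraNT => nx; rewrite big1// => k _.
  have kr : (k < size s)%N by rewrite -(size_map (@basis_vector D)).
  rewrite !ffunE (nth_map x)// ffunE; case: eqP => [E|]; last by rewrite scaler0.
  by move: nx; rewrite E; have := mem_nth x kr; rewrite mem_filter /has_degree => /andP[-> _].
have -> : f = \sum_x f x *: basis_vector x.
  apply/ffunP => y; rewrite sum_ffunE (bigD1 y)//= big1 => [|x xy].
    by rewrite !ffunE eqxx addr0 -[RHS]/(f y * 1) mulr1.
  by rewrite !ffunE eq_sym (negPf xy) scaler0.
apply: memv_suml => x _; have [->|fx] := eqVneq (f x) 0; first by rewrite scale0r mem0v.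
by apply/memvZ/memv_span/map_f; rewrite mem_filter mem_enum andbT; exact: H.
Qed.

Section Complex.
Hypothesis contribution_degree : forall r x y, contribution r x y ->
  ideg (est y) = ideg (est x) + 1 /\ jdeg y = jdeg x.
Hypothesis differential_linear : forall f y,
  differential D f y = \sum_r \sum_(x | contribution r x y) f x.
Hypothesis differentialK : forall f, differential D (differential D f) = 0.

Lemma differential_chains i j f : f \in chains_at D i j ->
  differential D f \in chains_at D (i + 1) j.
Proof.
move=> /chains_atP fC; apply/chains_atP => y; rewrite differential_linear.
apply: contraR => ny; rewrite big1// => r _; rewrite big1// => x cxy.
apply/eqP; apply: contraR ny => /fC /andP[/eqP ix /eqP jx].
by have [iy jy] := contribution_degree cxy; rewrite /has_degree iy jy ix jx !eqxx.
Qed.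

Definition boundary_dim i j : nat := \dim (boundaries D i j).

Lemma boundaries_cycles i j : (boundaries D i j <= cycles D i j)%VS.
Proof.
apply/subvP => f /memv_imgP[g gC ->]; rewrite /cycles memv_cap memv_ker differentialK eqxx /=.
by rewrite -[i](subrK 1); exact: differential_chains.
Qed.

(** Rank-nullity: the cycles split into homology and boundaries, and the image of the chains is the
    space of boundaries one degree higher. *)
Lemma homology_dim i j :
  (\dim (homology D i j) + boundary_dim i j + boundary_dim (i + 1) j)%N = #|has_degree i j|.
Proof.
have := dimv_cap_compl (cycles D i j) (boundaries D i j).
rewrite (capv_idPr (boundaries_cycles i j)).
have := limg_ker_dim (differential D) (chains_at D i j).
have -> : (differential D @: chains_at D i j)%VS = boundaries D (i + 1) j.
  by rewrite /boundaries addrK.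
by rewrite -dim_chains_at /boundary_dim /homology capvC -/(cycles D i j); lia.
Qed.

(** Strictly above all degrees in absolute value, so that nothing lives at the two ends of the
    window [degrees] and the telescoping sum has no remainder. *)
Definition bound : nat := (\sum_(x : estate D) (`|ideg (est x)|%N + `|jdeg x|%N))%N.+1.

Lemma boundP x : (`|ideg (est x)| < bound)%N /\ (`|jdeg x| < bound)%N.
Proof. by rewrite /bound (bigD1 x)//= !ltnS; lia. Qed.

Definition degrees : seq int := [seq k%:Z - bound%:Z | k <- iota 0 bound.*2.+1].

Lemma degrees_uniq : uniq degrees.
Proof. by rewrite map_inj_uniq ?iota_uniq// => k l /addIr[]. Qed.

Lemma mem_degrees i : (i \in degrees) = (`|i| <= bound)%N.
Proof.
apply/mapP/idP => [[k]|ib]; first by rewrite mem_iota => kr ->; lia.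
by exists (absz (i + bound%:Z)); rewrite ?mem_iota; lia.
Qed.

Lemma has_degree_bound i j : (bound <= `|i|)%N || (bound <= `|j|)%N -> #|has_degree i j| = 0%N.
Proof.
move=> ij; apply: eq_card0 => x; rewrite inE; apply/negP => /andP[/eqP ix /eqP jx].
by have := boundP x; rewrite ix jx; lia.
Qed.

Variables (F : fieldType) (t : F).
Hypothesis t0 : t != 0.

Lemma euler_telescope (b : nat -> F) m :
  \sum_(k <- iota 0 m) (-1) ^+ k * (b k + b k.+1) = b 0%N - (-1) ^+ m * b m.
Proof.
elim: m => [|m IH]; first by rewrite big_nil expr0 mul1r subrr.
by rewrite -addn1 iotaD big_cat IH /= big_seq1 add0n addn1 exprS; ring.
Qed.

(** The boundaries of degree [i] are counted at [i] and at [i - 1], with opposite signs. *)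
Lemma boundaries_cancel j :
  \sum_(i <- degrees) (-1) ^ i * ((boundary_dim i j)%:R + (boundary_dim (i + 1) j)%:R) = 0 :> F.
Proof.
pose b k : F := (boundary_dim (k%:Z - bound%:Z) j)%:R.
rewrite big_map (eq_bigr (fun k => (-1) ^ (- bound%:Z) * ((-1) ^+ k * (b k + b k.+1)))).
  rewrite -mulr_sumr euler_telescope.
  have bE k : (k = 0 \/ k = bound.*2.+1)%N -> b k = 0.
    move=> kE; have := homology_dim (k%:Z - bound%:Z) j; rewrite has_degree_bound.
      by move/eqP; rewrite !addn_eq0 => /andP[/andP[_ /eqP h] _]; rewrite /b h.
    by apply/orP; left; lia.
  by rewrite !bE ?mulr0 ?subr0 ?mulr0//; [right|left].
move=> k _; rewrite addrC expfzDr ?oppr_eq0 ?oner_eq0// mulrA; congr (_ * (_ + _)).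
by rewrite /b; congr (boundary_dim _ _)%:R; lia.
Qed.

Lemma chi_gr_chains : chi_gr D t = \sum_(x : estate D) (-1) ^ ideg (est x) * t ^ jdeg x.
Proof.
have h_le i j : (\dim (homology D i j) <= #|has_degree i j|)%N.
  by have := homology_dim i j; lia.
have h0 i j : (bound <= `|i|)%N || (bound <= `|j|)%N -> (\dim (homology D i j))%:R = 0 :> F.
  by move=> /has_degree_bound c0; have := h_le i j; rewrite c0 leqn0 => /eqP->.
(* Homology vanishes outside a finite window, so the finitely supported sums become sums over
   lists. *)
have -> : chi_gr D t = \sum_(i <- degrees) (-1) ^ i *
    \sum_(j <- degrees) t ^ j * (\dim (homology D i j))%:R.
  rewrite /chi_gr (@fsbigE _ _ _ _ _ degrees)//; first last.
  - move=> i _; rewrite mem_degrees -ltnNge => ib; rewrite /dim_gr fsbig1 ?mulr0// => j _.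
    by rewrite h0 ?mulr0// (ltnW ib).
  - exact: degrees_uniq.
  rewrite big_mkcond; apply: eq_bigr => i _; rewrite in_setT; congr (_ * _).
  rewrite /dim_gr (@fsbigE _ _ _ _ _ degrees)//; first last.
  - by move=> j _; rewrite mem_degrees -ltnNge => jb; rewrite h0 ?mulr0// (ltnW jb) orbT.
  - exact: degrees_uniq.
  by rewrite big_mkcond; apply: eq_bigr => j _; rewrite in_setT.
have hE i j : (\dim (homology D i j))%:R = (#|has_degree i j|)%:R -
    ((boundary_dim i j)%:R + (boundary_dim (i + 1) j)%:R) :> F.
  by rewrite -homology_dim !natrD; ring.
(* The cancellation is along [i] with [j] fixed, hence the exchange of the sums. *)
transitivity (\sum_(i <- degrees) \sum_(j <- degrees) (-1) ^ i * t ^ j * (#|has_degree i j|)%:R : F).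
  under eq_bigr => i _ do rewrite mulr_sumr.
  rewrite exchange_big [RHS]exchange_big; apply: eq_bigr => j _ /=.
  under eq_bigr => i _ do rewrite hE mulrA mulrBr.
  rewrite sumrB -[RHS]subr0; congr (_ - _).
  under eq_bigr => i _ do rewrite mulrAC mulrC.
  by rewrite -mulr_sumr boundaries_cancel mulr0.
have cE i j : (#|has_degree i j|)%:R = \sum_(x : estate D) ((has_degree i j x)%:R : F).
  rewrite -sum1_card natr_sum big_mkcond; apply: eq_bigr => x _; rewrite unfold_in.
  by rewrite /has_degree; case: andP.
under eq_bigr => i _ do under eq_bigr => j _ do rewrite cE mulr_sumr.
under eq_bigr => i _ do rewrite exchange_big.
rewrite exchange_big; apply: eq_bigr => x _ /=.
have [ix jx] := boundP x.
rewrite (bigD1_seq (ideg (est x))) ?degrees_uniq ?mem_degrees 1?ltnW//= [X in _ + X]big1 => [|i ii]; last first.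
  by rewrite big1// => j _; rewrite /has_degree eq_sym (negPf ii) mulr0.
rewrite addr0 (bigD1_seq (jdeg x)) ?degrees_uniq ?mem_degrees 1?ltnW//= [X in _ + X]big1 => [|j jj]; last first.
  by rewrite /has_degree [jdeg x == _]eq_sym (negPf jj) andbF mulr0.
by rewrite /has_degree !eqxx mulr1 addr0.
Qed.

End Complex.

(** * Expansion of the polynomial over the enhanced states *)

Section Polynomial.
Variables (F : fieldType) (t : F).
Hypothesis t0 : t != 0.

(** In the expanded product, [B] is the set of components where the positive exponent is chosen. It
    is used with [a = t] for open and [b = t ^+ 2] for closed components. *)
Lemma sum_signs (T : finType) (A : {set T}) (P : pred T) (a b : F) :
  a != 0 -> b != 0 ->
  \sum_(B : {set T} | B \subset A)
    (a ^ (#|[set C in B | P C]|%:Z - #|[set C in A :\: B | P C]|%:Z) *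
     b ^ (#|[set C in B | ~~ P C]|%:Z - #|[set C in A :\: B | ~~ P C]|%:Z)) =
  (a^-1 + a) ^+ #|[set C in A | P C]| * (b^-1 + b) ^+ #|[set C in A | ~~ P C]|.
Proof.
move=> a0 b0; pose w C := if P C then a else b.
have w0 C : w C != 0 by rewrite /w; case: ifP.
have prodE (B : {set T}) (v : bool -> F) :
    \prod_(C in B) v (P C) = v true ^+ #|[set C in B | P C]| * v false ^+ #|[set C in B | ~~ P C]|.
  rewrite (bigID P) /= -!prodr_const; congr (_ * _).
    by apply: eq_big => C; rewrite ?inE// => /andP[_ ->].
  by apply: eq_big => C; rewrite ?inE// => /andP[_ /negPf->].
have -> : (a^-1 + a) ^+ #|[set C in A | P C]| * (b^-1 + b) ^+ #|[set C in A | ~~ P C]| =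
    \prod_(C in A) (w C + (w C)^-1).
  rewrite -(prodE A (fun u => if u then a^-1 + a else b^-1 + b)).
  by apply: eq_bigr => C _; rewrite /w; case: (P C); rewrite addrC.
(* [bigA_distr] wants a product over the whole type; the factors [0 + 1] outside [A] kill the sets
   that are not contained in [A]. *)
have -> : \prod_(C in A) (w C + (w C)^-1) =
    \prod_C ((if C \in A then w C else 0) + (if C \in A then (w C)^-1 else 1)).
  by rewrite big_mkcond; apply: eq_bigr => C _; case: ifP => //; rewrite add0r.
rewrite bigA_distr [RHS](bigID (fun B : {set T} => B \subset A)) /=.
rewrite [X in _ = _ + X]big1 ?addr0 => [|B /subsetPn[C CB CA]]; last first.
  by rewrite (bigD1 C)//= CB (negPf CA) mul0r.
apply: eq_bigr => B BA.
have -> : \prod_C (if C \in B then if C \in A then w C else 0 else if C \in A then (w C)^-1 else 1) =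
    (\prod_(C in B) w C) * \prod_(C in A :\: B) (w C)^-1.
  rewrite (bigID (mem B)) /=; congr (_ * _).
    by apply: eq_bigr => C CB; rewrite CB (fintype.subsetP BA).
  rewrite [RHS]big_mkcond [LHS]big_mkcond; apply: eq_bigr => C _; rewrite !inE.
  by case: (C \in B); case: (C \in A).
rewrite (prodE B (fun u => if u then a else b)) prodfV (prodE _ (fun u => if u then a else b)).
by rewrite invfM mulrACA !expfzDr// -!exprnN.
Qed.

(** The exponent [op S - 1] is -1 for a state without open components, so the missing factor is
    obtained by dividing by [t^-1 + t]. *)
Lemma W_estates : t^-1 + t != 0 ->
  W D t = (t^-1 + t)^-1 * \sum_(x : estate D) (-1) ^ ideg (est x) * t ^ jdeg x.
Proof.
move=> tt0; pose jd (S : state D) (P : {set {set piece D}}) : int := kdeg S +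
  2 * (#|[set C in P | ~~ is_open S C]%SET|%:Z -
       #|[set C in components S :\: P | ~~ is_open S C]%SET|%:Z) +
  (#|[set C in P | is_open S C]%SET|%:Z - #|[set C in components S :\: P | is_open S C]%SET|%:Z).
have -> : \sum_(x : estate D) (-1) ^ ideg (est x) * t ^ jdeg x =
    \sum_(S : state D) \sum_(P : {set {set piece D}} | P \subset components S)
      (-1) ^ ideg S * t ^ jd S P.
  rewrite pair_big_dep /= [RHS](reindex_omap (val : estate D -> _) insub) => [|y Py].
    by apply: eq_bigl => x; rewrite valK eqxx andbT; apply/esym; exact: (valP x).
  by rewrite insubT.
rewrite /W mulr_sumr; apply: eq_bigr => S _.
have -> : (t^-1 + t) ^ ((op S)%:Z - 1) = (t^-1 + t) ^+ op S / (t^-1 + t).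
  by rewrite expfzDr// -exprnP exprN1.
rewrite -mulr_sumr.
have shuffle (a k c o u : F) : a * k * c * (o / u) = u^-1 * (a * (k * (o * c))) by ring.
rewrite shuffle; congr (_ * (_ * _)); rewrite -(@sum_signs _ (components S) (is_open S) t (t ^+ 2))//; last first.
  by rewrite expf_neq0.
rewrite mulr_sumr; apply: eq_bigr => P _.
rewrite /jd exprnP exprz_exp -!expfzDr//; congr (t ^ _); ring.
Qed.

End Polynomial.

(** The properties of the differential are taken as hypotheses in place of [well_formed], because
    they also hold in the degenerate case of [no_contribution]. *)
Theorem W_chi_gr
  (contribution_degree : forall r x y, contribution r x y ->
    ideg (est y) = ideg (est x) + 1 /\ jdeg y = jdeg x)
  (differential_linear : forall f y,
    differential D f y = \sum_r \sum_(x | contribution r x y) f x)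
  (differentialK : forall f, differential D (differential D f) = 0)
  (F : fieldType) (t : F) : t != 0 -> 1 + t ^+ 2 != 0 ->
  W D t = t / (1 + t ^+ 2) * chi_gr D t.
Proof.
move=> t0 t2; have tE : t^-1 + t = (1 + t ^+ 2) / t by field.
rewrite (chi_gr_chains contribution_degree differential_linear differentialK t0).
by rewrite W_estates// tE ?invf_div// mulf_neq0 ?invr_eq0.
Qed.

End Euler.

Lemma tvar_neq0 : tvar != 0.
Proof. by rewrite tofrac_eq0 polyX_eq0. Qed.

Lemma tvar_sqr_neq0 : 1 + tvar ^+ 2 != 0.
Proof.
rewrite /tvar -tofrac1 -tofracXn -tofracD tofrac_eq0; apply/eqP => /(congr1 (fun p : {poly int} => p`_0%N)).
by rewrite coefD coefXn coef1 coef0.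
Qed.

(** * Real functions *)

Import numFieldNormedType.Exports.
Local Open Scope classical_set_scope.
Local Open Scope ring_scope.

Section RealFunctions.
Variable R : realType.
Implicit Types (f : R -> R) (u a t l r b : R).

(** Caratheodory's form of the derivative: estimates on increments near [u] follow from the
    continuity of [g]. *)
Lemma derive1_slope f u : derivable f u 1 ->
  exists g : R -> R, [/\ forall t, f t - f u = g t * (t - u),
    {for u, continuous g} & g u = derive1 f u].
Proof.
move=> df; have := derivableP df; rewrite -derive1E.
by move=> /is_derive1_caratheodory[g [gE gc gu]]; exists g.
Qed.

Lemma continuous_at_mull (a : R) (g : R -> R) u :
  {for u, continuous g} -> {for u, continuous (fun t => a * g t)}.
Proof. by move=> gc; apply: (@cvgM _ _ _ _ (fun=> a) g) => //; exact: cvg_cst. Qed.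

Lemma derive1_neq0_near f u a : derivable f u 1 -> derive1 f u = a -> a != 0 ->
  \forall t \near u, t != u -> 0 < a * (f t - f u) * (t - u).
Proof.
move=> df fa a0; have [g [gE gc gu]] := derive1_slope df.
have gpos : 0 < a * g u by rewrite gu fa -expr2 exprn_even_gt0.
have := @continuous_at_mull a _ _ gc.
move=> /(_ [set z | 0 < z] (lt_nbhsr gpos)) H.
near=> t => tu; have tpos : 0 < a * g t by near: t; exact: H.
rewrite gE; have -> : a * (g t * (t - u)) * (t - u) = a * g t * (t - u) ^+ 2 by ring.
by rewrite mulr_gt0// exprn_even_gt0//= subr_eq0.
Unshelve. all: by end_near. Qed.

Lemma derivable_within f l r : (forall t, derivable f t 1) -> {within `[l, r], continuous f}.
Proof.
move=> df; apply: continuous_subspaceT => t.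
by apply: differentiable_continuous; apply/derivable1_diffP.
Qed.

Lemma derive1_neq0_inj f l r : (forall t, derivable f t 1) ->
  (forall t, l < t < r -> derive1 f t != 0) ->
  forall s t, l <= s <= r -> l <= t <= r -> f s = f t -> s = t.
Proof.
move=> df f'0.
have H s t : l <= s -> t <= r -> s < t -> f s != f t.
  move=> ls tr st; apply/eqP => fst.
  have [z] := Rolle st (fun x _ => df x) (@derivable_within _ _ _ df) fst.
  rewrite in_itv/= => /andP[sz zt] [_ /eqP]; rewrite -derive1E; apply/negP/f'0.
  by rewrite (le_lt_trans ls sz) (lt_le_trans zt tr).
move=> s t /andP[ls sr] /andP[lt' tr] fst; apply/eqP; case: (ltgtP s t) => // st.
  by have := H _ _ ls tr st; rewrite fst eqxx.
by have := H _ _ lt' sr st; rewrite fst eqxx.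
Qed.

(** By the mean value theorem [f t - f u] is [f' z * (t - u)] with [z] in between, and
    [derive1_neq0_near] applied to the derivative gives the sign of [f' z]. *)
Lemma second_derivative_near f u b : (forall t, derivable f t 1) ->
  derivable (derive1 f) u 1 -> derive1 f u = 0 -> derive1 (derive1 f) u = b -> b != 0 ->
  \forall t \near u, t != u -> 0 < b * (f t - f u).
Proof.
move=> df ddf f'u fb b0; have := derive1_neq0_near ddf fb b0.
have [f' f'E] : exists f' : R -> R, f' = derive1 f by exists (derive1 f).
rewrite -f'E in f'u *; rewrite f'u => /nbhs_ballP[e /= e0 He].
apply/nbhs_ballP; exists e => // t ute tu.
have idf (z : R) : is_derive z 1 f (f' z) by rewrite f'E derive1E; exact: (derivableP (df z)).
have key z : `|u - z| < e -> z != u -> 0 < b * f' z * (z - u).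
  by move=> uz zu; have := He z uz zu; rewrite subr0.
have {}ute : `|u - t| < e by [].
have [ut|tu'|] := ltgtP u t; last by move=> ut; rewrite ut eqxx in tu.
- have [z] := MVT ut (fun x _ => idf x) (@derivable_within _ _ _ df).
  rewrite in_itv/= => /andP[uz zt] ->.
  rewrite mulrA pmulr_lgt0 ?subr_gt0//.
  have := key z; rewrite pmulr_lgt0 ?subr_gt0//; apply; last by rewrite gt_eqF.
  by move: ute; rewrite !ltr0_norm; lra.
- have [z] := MVT tu' (fun x _ => idf x) (@derivable_within _ _ _ df).
  rewrite in_itv/= => /andP[uz zt] E.
  have -> : f t - f u = f' z * (t - u) by rewrite -opprB E -mulrN opprB.
  rewrite mulrA nmulr_lgt0 ?subr_lt0//.
  have := key z; rewrite nmulr_lgt0 ?subr_lt0//; apply; last by rewrite lt_eqF.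
  by move: ute; rewrite !gtr0_norm; lra.
Qed.

Lemma derive1_periodic f : (forall t, f (t + 1) = f t) -> forall t, derive1 f (t + 1) = derive1 f t.
Proof.
move=> fp t; rewrite /derive1.
by under eq_fun do rewrite addrA !fp.
Qed.

Lemma periodic_int f : (forall t, f (t + 1) = f t) -> forall (k : int) t, f (t + k%:~R) = f t.
Proof.
move=> fp k t; case: k => n.
  elim: n => [|n IH]; first by rewrite addr0.
  by rewrite -[RHS]IH -[RHS]fp -addrA; congr (f (_ + _)); rewrite -addn1 PoszD intrD.
rewrite NegzE mulrNz -pmulrn; elim: n => [|n IH]; first by rewrite -[LHS]fp subrK.
by rewrite -[RHS]IH -[LHS]fp -addrA; congr (f (_ + _)); rewrite -natr1; lra.
Qed.

(** A curve with a nonvertical tangent is to first order a graph of slope [b / a]; this is how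
    branches at a double point are compared. *)
Lemma slope_near f (g : R -> R) u a (b e : R) : derivable f u 1 -> derivable g u 1 -> derive1 f u = a ->
  derive1 g u = b -> a != 0 -> 0 < e ->
  \forall t \near u, `|g t - g u - b / a * (f t - f u)| <= e * `|f t - f u|.
Proof.
move=> df dg fa gb a0 e0; set m := b / a.
have [F [FE Fc Fu]] := derive1_slope df.
have [H [HE Hc Hu]] := derive1_slope dg.
have : {for u, continuous (fun t => e * `|F t| - `|H t - m * F t|)}.
  apply: (@cvgB _ _ _ _ _ (fun t => e * `|F t|) (fun t => `|H t - m * F t|)).
    by apply: (@continuous_at_mull e (fun t => `|F t|)); exact: cvg_norm.
  apply: cvg_norm; apply: (@cvgB _ _ _ _ _ H (fun t => m * F t)) => //.
  exact: continuous_at_mull.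
have pos : 0 < e * `|F u| - `|H u - m * F u|.
  by rewrite Fu Hu fa gb /m divfK// subrr normr0 subr0 mulr_gt0// normr_gt0.
move=> /(_ [set z | 0 < z] (lt_nbhsr pos)) K.
near=> t; have tpos : 0 < e * `|F t| - `|H t - m * F t| by near: t; exact: K.
rewrite HE FE mulrA -mulrBl !normrM mulrA ler_wpM2r//.
by rewrite ltW// -subr_gt0.
Unshelve. all: by end_near. Qed.

End RealFunctions.

(** * The curve of a divide *)

Section ClosedSets.
Variable R : realType.

Lemma last_before (C : set R) (s t : R) : closed C -> C s -> s <= t -> ~ C t ->
  exists l, [/\ C l, l < t & forall x, l < x <= t -> ~ C x].
Proof.
move=> cC Cs st nCt; pose A := C `&` [set x | x <= t].
have A0 : A !=set0 by exists s.
have Ab : has_ubound A by exists t => x [].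
have Al : closure A (sup A) by exact: closure_sup.
have cA : closed A by apply: closedI => //; exact: closed_le.
have [Cl lt] : A (sup A) by exact: cA.
exists (sup A); split => //.
  by rewrite lt_neqAle; apply/andP; split => //; apply/eqP => E; apply: nCt; rewrite -E.
move=> x /andP[lx xt] Cx; move: lx; apply/negP; rewrite -leNgt.
by apply: ub_le_sup.
Qed.

Lemma first_after (C : set R) (s t : R) : closed C -> C s -> t <= s -> ~ C t ->
  exists r, [/\ C r, t < r & forall x, t <= x < r -> ~ C x].
Proof.
move=> cC Cs ts nCt.
have [||||l [Cl lt H]] := @last_before [set x | C (- x)] (- s) (- t).
- by apply: preimage_closed => // x _; exact: oppr_continuous.
- by rewrite /= opprK.
- by rewrite lerN2.
- by rewrite /= opprK.
exists (- l); split => //; first by rewrite ltrNr.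
move=> x /andP[tx xl]; have := H (- x); rewrite /= opprK; apply.
by rewrite ltrNr xl lerN2.
Qed.

Lemma finite_set_plane_closed (A : set (R * R)) : finite_set A -> closed A.
Proof.
by move: A; apply/accessible_finite_set_closed/hausdorff_accessible; exact: norm_hausdorff.
Qed.

Lemma near_distP (u : R) (P : R -> Prop) :
  (\forall t \near u, P t) <-> exists2 e, 0 < e & forall t, `|t - u| < e -> P t.
Proof.
split=> [/nbhs_ballP[e /= e0 H]|[e e0 H]].
  by exists e => // t tu; apply: H; rewrite /ball/= distrC.
by apply/nbhs_ballP; exists e => // t; rewrite /ball/= distrC; exact: H.
Qed.

End ClosedSets.

Section Curve.
Variables (R : realType) (G : oms_divide R).
Let J := oimm G.
Implicit Types (c d : Defs.comp J) (s t u l r e : R) (p q : R * R).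

Definition curve c t : R * R := (px c t, py c t).

(* A circle is parametrized by the whole of R, so that an arc through the
   parameter 0 of a circle is not a special case; [same_param] is equality in J. *)
Definition in_dom c t : Prop := circle c \/ 0 <= t <= 1.

Definition same_param c s t : Prop := exists k : int, s = t + k%:~R /\ (circle c \/ k = 0).

Lemma same_param_refl c t : same_param c t t.
Proof. by exists 0; split; [rewrite addr0|right]. Qed.

Lemma same_param_sym c s t : same_param c s t -> same_param c t s.
Proof.
move=> [k [-> ck]]; exists (- k); split; first by rewrite mulrNz addrK.
by case: ck => [|->]; [left|right].
Qed.

Lemma px_derivable c t : derivable (px c) t 1. Proof. exact: (@px_smooth R J c 0%N t). Qed.
Lemma py_derivable c t : derivable (py c) t 1. Proof. exact: (@py_smooth R J c 0%N t). Qed.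
Lemma dpx_derivable c t : derivable (derive1 (px c)) t 1. Proof. exact: (@px_smooth R J c 1%N t). Qed.

Lemma px_continuous c : continuous (px c).
Proof. by move=> t; apply: differentiable_continuous; apply/derivable1_diffP/px_derivable. Qed.
Lemma py_continuous c : continuous (py c).
Proof. by move=> t; apply: differentiable_continuous; apply/derivable1_diffP/py_derivable. Qed.
Lemma curve_continuous c : continuous (curve c).
Proof.
move=> t; rewrite /curve.
exact: (cvg_pair (@px_continuous c t) (@py_continuous c t)).
Qed.

Lemma same_param_curve c s t : same_param c s t ->
  [/\ curve c s = curve c t, dx (f:=J) (c, s) = dx (f:=J) (c, t),
      dy (f:=J) (c, s) = dy (f:=J) (c, t) & in_dom c s <-> in_dom c t].
Proof.
move=> [k [-> [cc|->]]]; last by rewrite addr0.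
have px1 x := px_periodic (i:=J) x cc; have py1 x := py_periodic (i:=J) x cc.
rewrite /curve /dx /dy /= !periodic_int//; first by split => //; split => _; left.
- exact: derive1_periodic.
- exact: derive1_periodic.
Qed.

Lemma source_in_dom c t : source (f:=J) (c, t) -> in_dom c t.
Proof. by rewrite /source /in_dom /=; case: ifP => [|_ [-> ->]]; [left|right]. Qed.

Lemma source_param c t : in_dom c t -> exists2 s, source (f:=J) (c, s) & same_param c t s.
Proof.
move=> ct; have [cc|cc] := boolP (circle c).
  have /andP[t0 t1] := floor_itv t.
  exists (t - (Num.floor t)%:~R).
    by rewrite /source /= cc subr_ge0; split => //; rewrite ltrBlDl -[1]/(1%:~R) -intrD.
  by exists (Num.floor t); split; [rewrite subrK|left].
case: ct => [cc'|/andP[t0 t1]]; first by rewrite cc' in cc.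
by exists t; [rewrite /source /= (negPf cc)|exact: same_param_refl].
Qed.

Lemma source_same_param c s t : source (f:=J) (c, s) -> source (f:=J) (c, t) ->
  same_param c s t -> s = t.
Proof.
rewrite /source /= => -[s0 s1] [t0 t1] [k [E [cc|k0]]]; last by rewrite E k0 addr0.
rewrite cc in s1 t1; suff k0 : k = 0 by rewrite E k0 addr0.
have : (k%:~R < 1 :> R) by lra.
have : (-1 < k%:~R :> R) by lra.
have -> : (-1 : R) = (-1)%:~R by [].
have -> : (1 : R) = 1%:~R by [].
by rewrite !ltr_int; case: k {E} => [[|n]|[|n]].
Qed.

Lemma image_curveP p : image_curve J p <-> exists c t, in_dom c t /\ curve c t = p.
Proof.
split=> [[[c t] st <-]|[c [t [ct <-]]]]; first by exists c, t; split => //; exact: source_in_dom.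
have [s ss st] := source_param ct; exists (c, s) => //.
by have [-> _ _ _] := same_param_curve st.
Qed.

Lemma regular_unique c d s t : in_dom c s -> in_dom d t -> curve c s = curve d t ->
  ~ double_points J (curve c s) -> c = d /\ same_param c s t.
Proof.
move=> cs dt E nd.
have [s' ss' ss] := source_param cs; have [t' tt' tt] := source_param dt.
have [E1 _ _ _] := same_param_curve ss; have [E2 _ _ _] := same_param_curve tt.
have : (c, s') = (d, t').
  apply: contrapT => ne; apply: nd; exists (c, s'), (d, t'); split => //.
  by rewrite E; exact: esym E2.
case=> cd s't'; subst d t'; split=> //.
case: ss => k [-> ck]; case: tt => m [-> cm]; exists (k - m).
rewrite intrB; split; first by lra.
by case: ck => [|->]; [left|case: cm => [|->]; [left|right]].
Qed.

Lemma in_disc c t : in_dom c t -> `|py c t| < ob G.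
Proof.
by move=> ct; apply: (oms_strip (o:=G) (p:=curve c t)); apply/image_curveP; exists c, t.
Qed.

(** Such a point lies on the unit circle with [|y| < b], and [a^2 + b^2 < 1] then forces [|x| > a]:
    the ends of an interval are outside the box. *)
Lemma interval_ends c t : ~~ circle c -> t = 0 \/ t = 1 -> oa G < `|px c t|.
Proof.
move=> cc t01; have st : source (f:=J) (c, t).
  by rewrite /source /= (negPf cc); case: t01 => ->; lra.
have /divide_proper : is_divide J := oms_is_divide G.
move=> /(_ _ st)[_ /(_ (conj cc t01))]; rewrite /sqnorm /= => n1.
have yb := in_disc (source_in_dom st).
have ab := oab_lt1 G; have a0 := oa_gt0 G; have b0 := ob_gt0 G.
rewrite -(ltr_pXn2r (n:=2))//; last by rewrite nnegrE ltW.
rewrite real_normK ?num_real//.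
have : py c t ^+ 2 < ob G ^+ 2.
  by rewrite -(real_normK (num_real (py c t))) ltr_pXn2r// nnegrE ltW.
lra.
Qed.

(** The extremum lies on one of the lines [x = +-a], and the second derivative makes it strict, so
    the curve near it stays strictly between these lines. *)
Lemma critical_vertical c t : in_dom c t -> dx (f:=J) (c, t) = 0 ->
  [/\ vertical_points J (curve c t), `|px c t| = oa G &
    \forall s \near t, s != t -> `|px c s| < oa G].
Proof.
move=> ct d0; have a0 := oa_gt0 G.
have [t' tt' tt] := source_param ct; have [E Ed _ _] := same_param_curve tt.
have d0' : dx (f:=J) (c, t') = 0 by rewrite -Ed.
have dd := oms_morse tt' d0'; set b := ddx (f:=J) (c, t') in dd.
have ddE : derive1 (derive1 (px c)) t = b.
  rewrite /b /ddx derive1nS derive1n1 /=.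
  case: tt => k [-> [cc|->]]; last by rewrite addr0.
  apply: periodic_int => x; apply: derive1_periodic => y; apply: derive1_periodic => z.
  exact: px_periodic.
have near2 := second_derivative_near (@px_derivable c) (@dpx_derivable c t) d0 ddE dd.
have vert : vertical_points J (curve c t) by exists (c, t'); split.
have Ex : px c t = px c t' := congr1 fst E.
clear ddE.
have [b0|b0|b0] := ltgtP b 0; last by rewrite b0 eqxx in dd.
- have xa : px c t = oa G by rewrite Ex; exact: (oms_max tt' d0' b0).
  clear d0 d0' Ed; split; [exact: vert|by rewrite xa gtr0_norm|].
  have pos : \forall s \near t, - oa G < px c s.
    by apply: (@px_continuous c t [set y | - oa G < y]); apply: lt_nbhsr; rewrite xa; lra.
  near=> s => st; rewrite ltr_norml; apply/andP; split; first by near: s.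
  have : 0 < b * (px c s - px c t) by move: st; near: s.
  by rewrite (nmulr_rgt0 _ b0) xa subr_lt0.
- have xa : px c t = - oa G by rewrite Ex; exact: (oms_min tt' d0' b0).
  clear d0 d0' Ed; split; [exact: vert|by rewrite xa normrN gtr0_norm|].
  have pos : \forall s \near t, px c s < oa G.
    by apply: (@px_continuous c t [set y | y < oa G]); apply: lt_nbhsl; rewrite xa; lra.
  near=> s => st; rewrite ltr_norml; apply/andP; split; last by near: s.
  have : 0 < b * (px c s - px c t) by move: st; near: s.
  by rewrite (pmulr_rgt0 _ b0) xa subr_gt0.
Unshelve. all: by end_near. Qed.

Lemma verticalP p : vertical_points J p -> exists c t,
  [/\ in_dom c t, curve c t = p & dx (f:=J) (c, t) = 0].
Proof. by move=> [[c t] [st d0 <-]]; exists c, t; split => //; exact: source_in_dom. Qed.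

Lemma vertical_not_double p : vertical_points J p -> ~ double_points J p.
Proof.
move=> /verticalP[c [t [ct <- d0]]] /(oms_double (o:=G))[/= + _].
by have [_ -> _] := critical_vertical ct d0; rewrite ltxx.
Qed.

Lemma regular_derivative c t : in_dom c t -> ~ singular_points G (curve c t) ->
  dx (f:=J) (c, t) != 0.
Proof.
move=> ct ns; apply/eqP => d0; apply: ns; right.
by have [] := critical_vertical ct d0.
Qed.

Lemma doubleP p : double_points J p -> exists c t d u,
  [/\ in_dom c t, in_dom d u, curve c t = p, curve d u = p &
   [/\ ~ (c = d /\ same_param c t u),
    dx (f:=J) (c, t) * dy (f:=J) (d, u) - dy (f:=J) (c, t) * dx (f:=J) (d, u) != 0 &
    forall c' s, in_dom c' s -> curve c' s = p ->
      (c' = c /\ same_param c s t) \/ (c' = d /\ same_param d s u)]].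
Proof.
move=> dp; have [[c t] [[d u] [st su ne pt pu]]] := dp.
exists c, t, d, u; split => //; try exact: source_in_dom.
split.
- move=> [cd tu]; subst d; apply: ne; congr pair; exact: source_same_param tu.
- by have := divide_double_transverse (oms_is_divide G) st su ne; rewrite pt pu; apply.
move=> c' s cs sp; have [s' ss' ss] := source_param cs.
have [E _ _ _] := same_param_curve ss.
have [||[? ?]|/ne//|[? ?]] := divide_no_triple_point (oms_is_divide G) ss' st su.
- by rewrite pt -sp; exact: esym E.
- by rewrite pt pu.
- by subst c' s'; left.
- by subst c' s'; right.
Qed.

End Curve.

(** * Arcs and pieces *)

Section Arcs.
Variables (R : realType) (G : oms_divide R).
Hypothesis finite_sing : finite_set (singular_points G).
Let J := oimm G.
Implicit Types (c d : Defs.comp J) (s t u l r e : R) (p q : R * R).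
Notation sing := (singular_points G).

Definition cut_at c t : Prop := sing (curve c t) \/ oa G <= `|px c t|.

Lemma closed_cut_at c : closed (cut_at c).
Proof.
have -> : cut_at c = curve c @^-1` sing `|` px c @^-1` (~` [set x | `|x| < oa G]).
  apply/seteqP; split => t [ct|/= ct]; [by left|right => /=; apply/negP|by left|right].
    by rewrite -leNgt.
  by rewrite leNgt; apply/negP.
apply: closedU; first apply: preimage_closed => [t _|]; first exact: curve_continuous.
  exact: finite_set_plane_closed.
apply: preimage_closed => [t _|]; first exact: px_continuous.
apply: open_closedC.
have -> : [set x : R | `|x| < oa G] = ball 0 (oa G).
  by apply/seteqP; split => x; rewrite /ball/= sub0r normrN.
exact: ball_open.
Qed.

Lemma not_cut c t : ~ cut_at c t -> ~ sing (curve c t) /\ `|px c t| < oa G.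
Proof. by move=> nc; split=> [sc|]; [|rewrite ltNge; apply/negP => ac]; apply: nc; [left|right]. Qed.

Lemma same_param_cut c s t : same_param c s t -> cut_at c s <-> cut_at c t.
Proof.
by move=> st; have [E _ _ _] := same_param_curve st; move: E; rewrite /cut_at /curve => -[-> ->].
Qed.

Lemma not_cut_derivative c t : in_dom c t -> ~ cut_at c t -> derive1 (px c) t != 0.
Proof. by move=> ct /not_cut[ns _]; exact: regular_derivative ct ns. Qed.

Record gamma_arc c l r : Prop := Arc {
  arc_lt : l < r;
  arc_dom : forall t, l <= t <= r -> in_dom c t;
  arc_left : cut_at c l;
  arc_right : cut_at c r;
  arc_inside : forall t, l < t < r -> ~ cut_at c t
}.

(** As in [regular_part], an end at a singular point is removed, while an end of Gamma on [x = +-a]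
    is kept. *)
Definition arc_piece c l r : set (R * R) := curve c @` `[l, r] `\` sing.

Lemma same_param_shift c (k : int) t : circle c \/ k = 0 -> same_param c (t + k%:~R) t.
Proof. by exists k. Qed.

Lemma arc_shift c l r (k : int) : circle c \/ k = 0 -> gamma_arc c l r ->
  gamma_arc c (l + k%:~R) (r + k%:~R).
Proof.
move=> ck [lr ad al ar ai]; split.
- by rewrite ltrD2r.
- move=> t /andP[lt tr].
  have := same_param_shift (t - k%:~R) ck; rewrite subrK => /same_param_curve[_ _ _ ->].
  by apply: ad; lra.
- exact/(same_param_cut (same_param_shift l ck)).
- exact/(same_param_cut (same_param_shift r ck)).
move=> t /andP[lt tr].
have := same_param_shift (t - k%:~R) ck; rewrite subrK => /same_param_cut ->.
by apply: ai; lra.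
Qed.

Lemma curve_shift c (k : int) t : circle c \/ k = 0 -> curve c (t + k%:~R) = curve c t.
Proof. by move=> /(same_param_shift t)/same_param_curve[]. Qed.

Lemma arc_piece_shift c l r (k : int) : circle c \/ k = 0 ->
  arc_piece c (l + k%:~R) (r + k%:~R) = arc_piece c l r.
Proof.
move=> ck; congr (_ `\` _); apply/seteqP; split => p [t] /=; rewrite in_itv/= => tlr <-.
  exists (t - k%:~R); first by rewrite /= in_itv/=; lra.
  by rewrite -{2}[t](subrK k%:~R) curve_shift.
exists (t + k%:~R); first by rewrite /= in_itv/=; lra.
by rewrite curve_shift.
Qed.

Lemma arc_overlap c l r l' r' t : gamma_arc c l r -> gamma_arc c l' r' -> l < t < r -> l' < t < r' ->
  l = l' /\ r = r'.
Proof.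
move=> [lr _ al ar ai] [lr' _ al' ar' ai'] lt lt'; split; apply/eqP.
  case: (ltgtP l l') => // ll.
    by case: (ai l') => //; lra.
  by case: (ai' l) => //; lra.
case: (ltgtP r r') => // rr.
  by case: (ai' r) => //; lra.
by case: (ai r') => //; lra.
Qed.

(** By Rolle, [x] is critical somewhere in each period, and critical points lie on [x = +-a]. So
    each circle component is cut. *)
Lemma circle_cut c t : circle c -> exists z, t < z < t + 1 /\ cut_at c z.
Proof.
move=> cc; have t1 : t < t + 1 by rewrite ltrDl.
have [z] := Rolle t1 (fun x _ => @px_derivable _ _ c x)
  (@derivable_within _ _ _ _ (@px_derivable _ _ c)) (esym (px_periodic t cc)).
rewrite in_itv/= => zt [_ d0]; exists z; split => //; left; right.
have cz : in_dom c z by left.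
by have [] : [/\ _, _ & _] := critical_vertical cz (etrans (derive1E _ _) d0).
Qed.

Lemma interval_cut c t : ~~ circle c -> t = 0 \/ t = 1 -> cut_at c t.
Proof. by move=> cc t01; right; apply/ltW/interval_ends. Qed.

(** The arc extends to the nearest cuts on both sides. They exist as a circle is cut in every period
    and an interval at both ends. *)
Lemma arc_exists c t : in_dom c t -> ~ cut_at c t -> exists l r, gamma_arc c l r /\ l < t < r.
Proof.
move=> ct nc.
have [s1 c1 [s1t d1]] : exists2 s, cut_at c s &
    s <= t /\ forall x, s <= x <= t -> in_dom c x.
  have [cc|cc] := boolP (circle c).
    have [z [zt cz]] := circle_cut (t - 1) cc; exists z => //; split; first lra.
    by move=> x _; left.
  exists 0; first by apply: interval_cut => //; left.
  case: ct => [cc'|t01]; first by rewrite cc' in cc.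
  by split=> [|x xt]; [|right]; lra.
have [s2 c2 [s2t d2]] : exists2 s, cut_at c s &
    t <= s /\ forall x, t <= x <= s -> in_dom c x.
  have [cc|cc] := boolP (circle c).
    have [z [zt cz]] := circle_cut t cc; exists z => //; split; first lra.
    by move=> x _; left.
  exists 1; first by apply: interval_cut => //; right.
  case: ct => [cc'|t01]; first by rewrite cc' in cc.
  by split=> [|x xt]; [|right]; lra.
have [l [cl lt nl]] := last_before (@closed_cut_at c) c1 s1t nc.
have [r [cr tr nr]] := first_after (@closed_cut_at c) c2 s2t nc.
have s1l : s1 <= l.
  by rewrite leNgt; apply/negP => ls; apply: (nl s1) => //; rewrite ls s1t.
have rs2 : r <= s2.
  by rewrite leNgt; apply/negP => ls; apply: (nr s2) => //; rewrite ls s2t.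
exists l, r; split; last by rewrite lt tr.
split=> //; first exact: lt_trans tr.
  move=> x /andP[lx xr]; have [xt|/ltW tx] := leP x t; first by apply: d1; lra.
  by apply: d2; lra.
move=> x /andP[lx xr]; have [xt|/ltW tx] := leP x t; first by apply: nl; lra.
by apply: nr; lra.
Qed.

Lemma arc_inj c l r : gamma_arc c l r -> forall s t, l <= s <= r -> l <= t <= r ->
  px c s = px c t -> s = t.
Proof.
move=> [lr ad al ar ai]; apply: (derive1_neq0_inj (@px_derivable _ _ c)) => t tlr.
by apply: not_cut_derivative; [apply: ad; lra|exact: ai].
Qed.

Lemma arc_ends_neq c l r : gamma_arc c l r -> curve c l != curve c r.
Proof.
move=> a; apply/eqP => -[E _]; have lr := arc_lt a.
by have := arc_inj a _ _ E; rewrite !lexx !ltW// => /(_ erefl erefl) lr'; rewrite lr' ltxx in lr.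
Qed.

Lemma arc_le c l r t : gamma_arc c l r -> l <= t <= r -> `|px c t| <= oa G.
Proof.
move=> a /andP[]; have [lr ad al ar ai] := a.
have inside s : l < s < r -> `|px c s| < oa G by move=> /ai/not_cut[].
have away s : oa G < `|px c s| -> exists2 e, 0 < e & forall x, `|x - s| < e -> oa G < `|px c x|.
  move=> as_; have [H _] := near_distP s (fun x => oa G < `|px c x|); apply: H.
  have pc : {for s, continuous (fun x => `|px c x|)} by apply: cvg_norm; exact: px_continuous.
  by apply: (pc [set y | oa G < y]); exact: lt_nbhsr.
have half x y : 0 < x -> 0 < y -> exists2 z : R, 0 < z & z < x /\ z < y.
  move=> x0 y0; exists (Num.min x y / 2); first by rewrite divr_gt0// lt_min x0.
  have : Num.min x y / 2 < Num.min x y by rewrite ltr_pdivrMr// ltr_pMr ?lt_min ?x0//; lra.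
  by rewrite lt_min => /andP[].
have lr0 : 0 < r - l by lra.
rewrite le_eqVlt => /predU1P[<- _|lt].
  rewrite leNgt; apply/negP => /away[e e0 H].
  have [z z0 [ze zr]] := half _ _ e0 lr0.
  have := H (l + z); rewrite addrAC subrr add0r gtr0_norm// => /(_ ze).
  by have := inside (l + z); lra.
rewrite le_eqVlt => /predU1P[->|tr]; last by apply/ltW/inside; rewrite lt.
rewrite leNgt; apply/negP => /away[e e0 H].
have [z z0 [ze zr]] := half _ _ e0 lr0.
have := H (r - z); rewrite addrAC subrr add0r normrN gtr0_norm// => /(_ ze).
by have := inside (r - z); lra.
Qed.

Lemma regular_partP p : regular_part G p <->
  exists c t, [/\ in_dom c t, curve c t = p, `|px c t| <= oa G & ~ sing p].
Proof.
split=> [[[/image_curveP[c [t [ct E]]] [/= pa _]] ns]|[c [t [ct E pa ns]]]].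
  by exists c, t; split => //; rewrite -E in pa.
rewrite -E in ns *; split=> //; split; first by apply/image_curveP; exists c, t.
by split => //=; apply/ltW/in_disc.
Qed.

Lemma arc_pieceP c l r p : gamma_arc c l r ->
  (arc_piece c l r p <-> exists t, [/\ l <= t <= r, curve c t = p & ~ sing p]).
Proof.
move=> a; split=> [[[t] /=]|[t [tlr E ns]]].
  by rewrite in_itv/= => tlr <- ns; exists t.
by split=> //; exists t.
Qed.

Lemma arc_piece_sub c l r : gamma_arc c l r -> arc_piece c l r `<=` regular_part G.
Proof.
move=> a p /(arc_pieceP _ a)[t [tlr E ns]]; apply/regular_partP; exists c, t.
split=> //; first exact: (arc_dom a).
exact: arc_le a tlr.
Qed.

Lemma curve_within c l r : {within `[l, r], continuous (curve c)}.
Proof. by apply: continuous_subspaceT => t; exact: curve_continuous. Qed.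

Lemma arc_image_compact c l r : compact (curve c @` `[l, r]).
Proof. by apply: continuous_compact; [exact: curve_within|exact: segment_compact]. Qed.

Lemma arc_image_closed c l r : closed (curve c @` `[l, r]).
Proof. by apply: compact_closed; [exact: norm_hausdorff|exact: arc_image_compact]. Qed.

Lemma arc_piece_connected c l r : gamma_arc c l r -> connected (arc_piece c l r).
Proof.
move=> a; have [lr ad al ar ai] := a.
have -> : arc_piece c l r = curve c @` [set t | l <= t <= r /\ ~ sing (curve c t)].
  apply/seteqP; split=> p; rewrite (arc_pieceP _ a) => -[t].
    by move=> [tlr <- ns]; exists t.
  by move=> [tlr ns] <-; exists t.
apply: connected_continuous_connected; last first.
  by apply: continuous_subspaceT => t; exact: curve_continuous.
apply/connected_intervalP => s t /= [slr ns] [tlr nt] x /andP[sx xt].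
split; first lra.
move: sx; rewrite le_eqVlt => /predU1P[<-//|sx].
move: xt; rewrite le_eqVlt => /predU1P[->//|xt].
by have /not_cut[] := ai x ltac:(lra).
Qed.

End Arcs.

(** * The arcs as connected components of the regular part *)

Section Pieces.
Variables (R : realType) (G : oms_divide R).
Hypothesis finite_sing : finite_set (singular_points G).
Let J := oimm G.
Implicit Types (c d : Defs.comp J) (s t u l r e : R) (p q : R * R).
Notation sing := (singular_points G).

(** The parameters far from all preimages of [p] form a compact set, whose image is closed and
    misses [p]; its complement is the neighbourhood. *)
Lemma curve_near p e : 0 < e -> \forall q \near p, forall d s, in_dom d s -> curve d s = q ->
  exists t, [/\ in_dom d t, curve d t = p & `|s - t| < e].
Proof.
move=> e0.
suff H d : \forall q \near p, forall s, in_dom d s -> curve d s = q ->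
    exists t, [/\ in_dom d t, curve d t = p & `|s - t| < e].
  exact: (@filter_forall _ _ _ (nbhs p) _ H).
pose far : set R := `[0, 1]%classic `&`
  ~` \bigcup_(t in [set t | in_dom d t /\ curve d t = p]) ball t e.
have cfar : closed far.
  rewrite /far; apply: closedI.
    by apply: compact_closed; [exact: norm_hausdorff|exact: segment_compact].
  by apply: open_closedC; apply: bigcup_open => t _; exact: ball_open.
have kfar : compact far.
  by apply: (subclosed_compact cfar (@segment_compact R 0 1)) => x [].
have Cfar : closed (curve d @` far).
  apply: compact_closed; first exact: norm_hausdorff.
  apply: continuous_compact => //; apply: continuous_subspaceT => t; exact: curve_continuous.
have np : (~` (curve d @` far)) p.
  move=> [s [/= s01 ns] E]; apply: ns; exists s; last exact: ballxx.
  by split=> //; right; move: s01; rewrite in_itv.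
have := closed_openC Cfar; rewrite openE => /(_ _ np); rewrite /interior.
apply: filterS => q nq s ds E.
have [s' ss' ss] := source_param ds.
have [E1 _ _ _] := same_param_curve ss.
have : ~ far s' by move=> fs; apply: nq; exists s' => //; rewrite -E1.
have s'01 : `[0, 1]%classic s'.
  by move: ss'; rewrite /source/= in_itv/=; case: ifP => _ [-> ?] //=; exact: ltW.
move=> /not_andP[//|/contrapT[t [dt Et] bt]].
case: ss => k [Es ck]; exists (t + k%:~R); split.
- by have [_ _ _ H] := same_param_curve (same_param_shift t ck); apply/H.
- by rewrite (curve_shift t ck).
by rewrite Es opprD addrACA subrr addr0 distrC.
Qed.

Lemma near_not_sing p : ~ sing p -> \forall q \near p, ~ sing q.
Proof.
by move=> np; have := closed_openC (finite_set_plane_closed finite_sing); rewrite openE; apply.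
Qed.

Lemma curve_nbhs c t (P : R * R -> Prop) : (\forall q \near curve c t, P q) ->
  exists2 e, 0 < e & forall s, `|s - t| < e -> P (curve c s).
Proof. by move=> nP; apply: (proj1 (near_distP t (fun s => P (curve c s)))); exact: curve_continuous. Qed.

Lemma mulr_gt0_cases (x y : R) : 0 < x * y -> (0 < x /\ 0 < y) \/ (x < 0 /\ y < 0).
Proof.
move=> xy; have x0 : x != 0 by apply/eqP => x0; rewrite x0 mul0r ltxx in xy.
have [xn|xp|x0'] := ltgtP x 0; last by rewrite x0' eqxx in x0.
  by right; split => //; move: xy; rewrite nmulr_rgt0.
by left; split => //; move: xy; rewrite pmulr_rgt0.
Qed.

(** The curve crosses the line transversally, so it is strictly inside on one side of [t] and
    strictly outside on the other. This form covers both lines and both directions at once. *)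
Lemma leave_box c t : in_dom c t -> ~ sing (curve c t) -> `|px c t| = oa G ->
  exists2 e, 0 < e & forall s s', 0 < s < e -> 0 < s' < e ->
    (`|px c (t - s)| < oa G -> oa G < `|px c (t + s')|) /\
    (`|px c (t + s)| < oa G -> oa G < `|px c (t - s')|) /\
    (`|px c (t - s)| < oa G \/ `|px c (t + s)| < oa G).
Proof.
move=> ct ns xa; have a0 := oa_gt0 G.
have d0 : derive1 (px c) t != 0 by exact: regular_derivative ct ns.
have [b bE] : exists b : R, derive1 (px c) t = b by exists (derive1 (px c) t).
have b0 : b != 0 by rewrite -bE.
have near1 := derive1_neq0_near (@px_derivable _ _ c t) bE b0.
have near2 : \forall s \near t, `|px c s - px c t| < oa G.
  have pc : {for t, continuous (fun x => `|px c x - px c t|)}.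
    by apply: cvg_norm; apply: cvgB; [exact: px_continuous|exact: cvg_cst].
  by apply: (pc [set y | y < oa G]); apply: lt_nbhsl; rewrite subrr normr0.
have [e e0 H] := proj1 (near_distP t _) (filterI near1 near2).
exists e => // s s' /andP[s0 se] /andP[s'0 s'e].
have tm x : 0 < x < e -> b * (px c (t - x) - px c t) < 0 /\ `|px c (t - x) - px c t| < oa G.
  move=> /andP[x0 xe]; have := H (t - x); rewrite addrAC subrr add0r normrN gtr0_norm// => /(_ xe)[].
  have -> : t - x != t by lra.
  move=> /(_ erefl) H1 H2; split=> //.
  by move: H1; rewrite nmulr_lgt0//; lra.
have tp x : 0 < x < e -> 0 < b * (px c (t + x) - px c t) /\ `|px c (t + x) - px c t| < oa G.
  move=> /andP[x0 xe]; have := H (t + x); rewrite addrAC subrr add0r gtr0_norm// => /(_ xe)[].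
  have -> : t + x != t by lra.
  move=> /(_ erefl) H1 H2; split=> //.
  by move: H1; rewrite pmulr_lgt0//; lra.
have [] := (tm s, tp s); rewrite s0 se => /(_ erefl)[m1 m2] /(_ erefl)[p1 p2].
have [] := (tm s', tp s'); rewrite s'0 s'e => /(_ erefl)[m1' m2'] /(_ erefl)[p1' p2'].
move: m2 p2 m2' p2'; rewrite !ltr_norml => /andP[? ?] /andP[? ?] /andP[? ?] /andP[? ?].
have [bp|bn|] := ltgtP 0 b; last by move=> b0'; rewrite b0' eqxx in b0.
  move: m1 p1 m1' p1'; rewrite !pmulr_rlt0// !pmulr_rgt0// => m1 p1 m1' p1'.
  move: xa; case: (ger0P (px c t)) => _ xa.
    rewrite !ltr_normr; split=> [_|]; first by apply/orP; left; lra.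
    by split=> [|]; [lra|left; lra].
  rewrite !ltr_normr; split=> [|]; first by lra.
  by split=> [_|]; [apply/orP; right; lra|right; lra].
move: m1 p1 m1' p1'; rewrite !nmulr_rlt0// !nmulr_rgt0// => m1 p1 m1' p1'.
move: xa; case: (ger0P (px c t)) => _ xa.
  rewrite !ltr_normr; split=> [|]; first by lra.
  by split=> [_|]; [apply/orP; left; lra|right; lra].
rewrite !ltr_normr; split=> [_|]; first by apply/orP; right; lra.
by split=> [|]; [lra|left; lra].
Qed.

(** A regular point has one parameter in the source, so nearby points of the curve have nearby
    parameters. If [t] is an end of the arc it lies on [x = +-a], and beyond it the curve is outside
    the box by [leave_box]. *)
Lemma arc_piece_open c l r p : gamma_arc c l r -> arc_piece c l r p ->
  \forall q \near p, regular_part G q -> arc_piece c l r q.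
Proof.
move=> a /(arc_pieceP _ a)[t [tlr Et ns]]; have [lr ad al ar ai] := a.
have ct := ad _ tlr.
have ns' : ~ sing (curve c t) by rewrite Et.
have reduce e : 0 < e -> (forall s, `|s - t| < e -> regular_part G (curve c s) -> l <= s <= r) ->
    \forall q \near p, regular_part G q -> arc_piece c l r q.
  move=> e0 H; have := curve_near p e0; apply: filterS => q Hq rq.
  have /regular_partP[d [s [ds Es _ nq]]] := rq.
  have [t' [dt' Et' st']] := Hq d s ds Es.
  have [||cd [k [E ck]]] := regular_unique ct dt'; first by rewrite Et Et'.
    by move=> dd; apply: ns'; left.
  subst d; have Ek : curve c (s + k%:~R) = q by rewrite (curve_shift s ck).
  apply/(arc_pieceP _ a); exists (s + k%:~R); split=> //.
  apply: H; last by rewrite Ek.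
  by rewrite E opprD addrACA subrr addr0.
have out s : regular_part G (curve c s) -> `|px c s| <= oa G by move=> [[_ []]].
have [/andP[lt tr]|] := boolP (l < t < r).
  apply: (reduce (Num.min (t - l) (r - t))); first by rewrite lt_min; lra.
  by move=> s; rewrite lt_min => /andP[]; rewrite !ltr_norml; lra.
move=> tn; have t_end : t = l \/ t = r.
  move: tlr tn => /andP[]; rewrite !le_eqVlt => /predU1P[->|lt]; first by left.
  by move=> /predU1P[->|tr]; [right|rewrite lt tr].
have ta : `|px c t| = oa G.
  apply/eqP; rewrite eq_le (arc_le a tlr)/=.
  by case: t_end => tE; [case: al|case: ar]; rewrite -tE.
have [e e0 H] := leave_box ct ns' ta.
apply: (reduce (Num.min e (r - l))); first by rewrite lt_min e0 subr_gt0.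
move=> s; rewrite lt_min => /andP[se sr] /out.
case: t_end => tE.
  have [ls _|sl] := leP l s; first by move: sr; rewrite ltr_norml tE; lra.
  move=> sa; pose x := t - s; have x0 : 0 < x by rewrite /x; lra.
  have xe : x < e by move: se; rewrite ltr_norml /x; lra.
  have [z [z0 ze zr]] : exists z : R, [/\ 0 < z, z < e & z < r - l].
    exists (Num.min e (r - l) / 2).
    have : Num.min e (r - l) / 2 < Num.min e (r - l).
      by rewrite ltr_pdivrMr// ltr_pMr ?lt_min ?e0 ?subr_gt0//; lra.
    by rewrite lt_min => /andP[-> ->]; split=> //; rewrite divr_gt0// lt_min e0 subr_gt0.
  have := (H z x); rewrite x0 xe z0 ze => /(_ erefl erefl)[_ [+ _]].
  have -> : t - x = s by rewrite /x; lra.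
  have /not_cut[_ ->] : ~ cut_at c (t + z) by apply: ai; lra.
  by move=> /(_ erefl); lra.
have [ls _|sl] := leP s r; first by move: sr; rewrite ltr_norml tE; lra.
move=> sa; pose x := s - t; have x0 : 0 < x by rewrite /x; lra.
have xe : x < e by move: se; rewrite ltr_norml /x; lra.
have [z [z0 ze zr]] : exists z : R, [/\ 0 < z, z < e & z < r - l].
  exists (Num.min e (r - l) / 2).
  have : Num.min e (r - l) / 2 < Num.min e (r - l).
    by rewrite ltr_pdivrMr// ltr_pMr ?lt_min ?e0 ?subr_gt0//; lra.
  by rewrite lt_min => /andP[-> ->]; split=> //; rewrite divr_gt0// lt_min e0 subr_gt0.
have := (H z x); rewrite x0 xe z0 ze => /(_ erefl erefl)[+ _].
have -> : t + x = s by rewrite /x; lra.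
have /not_cut[_ ->] : ~ cut_at c (t - z) by apply: ai; lra.
by move=> /(_ erefl); lra.
Qed.

Lemma arc_component c l r p : gamma_arc c l r -> arc_piece c l r p ->
  connected_component (regular_part G) p = arc_piece c l r.
Proof.
move=> a Kp; apply/seteqP; split; last first.
  by apply: connected_component_max => //; [exact: arc_piece_sub|exact: arc_piece_connected].
set A := connected_component _ _.
have Ap : A p by apply: connected_component_refl; exact: arc_piece_sub Kp.
have subA : A `<=` regular_part G by exact: connected_component_sub.
have : connected A by exact: component_connected.
move=> /(_ (A `&` arc_piece c l r)) H q Aq.
suff E : A `&` arc_piece c l r = A by move: Aq; rewrite -E => -[].
apply: H; first by exists p.
- exists ([set z | regular_part G z -> arc_piece c l r z]°); first exact: open_interior.
  apply/seteqP; split=> x [Ax Kx]; split=> //; first exact: arc_piece_open.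
  by apply: (interior_subset Kx); exact: subA.
(* The closed image differs from the piece by singular points only, and these are not regular. *)
- exists (curve c @` `[l, r]); first exact: arc_image_closed.
  apply/seteqP; split=> x [Ax Kx]; split=> //; first by case: Kx.
  by split=> //; have [] := subA _ Ax.
Qed.

End Pieces.

(** * The ends of the pieces *)

Section PieceArcs.
Variables (R : realType) (G : oms_divide R).
Hypothesis finite_sing : finite_set (singular_points G).
Let J := oimm G.
Implicit Types (c d : Defs.comp J) (s t u l r e : R) (p q : R * R) (A : set (R * R)).
Notation sing := (singular_points G).

Lemma arc_mem c l r t : gamma_arc c l r -> l < t < r -> arc_piece c l r (curve c t).
Proof.
move=> a tlr; apply/(arc_pieceP _ a); exists t; split=> //; first lra.
by have /not_cut[] := arc_inside a tlr.
Qed.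

Lemma arc_mid c l r : gamma_arc c l r -> l < (l + r) / 2 < r.
Proof. by move=> /arc_lt; lra. Qed.

Lemma arc_is_piece c l r : gamma_arc c l r -> pieces G (arc_piece c l r).
Proof.
move=> a; have Km := arc_mem a (arc_mid a).
by exists (curve c ((l + r) / 2)); [exact: arc_piece_sub Km|exact: arc_component].
Qed.

Lemma in_dom_near c t : in_dom c t -> `|px c t| <= oa G ->
  exists2 e, 0 < e & forall s, `|s - t| < e -> in_dom c s.
Proof.
move=> ct pa; have [cc|cc] := boolP (circle c); first by exists 1 => // s _; left.
have t01 : 0 <= t <= 1 by case: ct => // cc'; rewrite cc' in cc.
have t0 : t != 0.
  by apply/eqP => t0; have := interval_ends cc (or_introl t0); rewrite ltNge pa.
have t1 : t != 1.
  by apply/eqP => t1; have := interval_ends cc (or_intror t1); rewrite ltNge pa.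
exists (Num.min t (1 - t)); first by rewrite lt_min; lra.
by move=> s; rewrite lt_min !ltr_norml => ?; right; lra.
Qed.

(** At a point on [x = +-a] the curve is inside the box on one side; the arc through a nearby inner
    parameter reaches [t], as no parameter in between is a cut. *)
Lemma piece_arc A : pieces G A -> exists c l r, gamma_arc c l r /\ A = arc_piece c l r.
Proof.
move=> [p rp <-]; have [c [t [ct Et pa ns]]] := proj1 (regular_partP _ p) rp.
have a0 := oa_gt0 G.
suff [l [r [a tlr]]] : exists l r, gamma_arc c l r /\ l <= t <= r.
  by exists c, l, r; split => //; apply: arc_component => //; apply/(arc_pieceP _ a); exists t.
have [ta|ta] := ltP `|px c t| (oa G).
  have nc : ~ cut_at c t by rewrite /cut_at Et => -[//|]; rewrite leNgt ta.
  by have [l [r [a tlr]]] := arc_exists finite_sing ct nc; exists l, r; split => //; lra.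
have pa_le := pa; have {ta}pa : `|px c t| = oa G by apply/eqP; rewrite eq_le pa.
rewrite -Et in ns; have [e e0 H] := leave_box ct ns pa.
have [e' e'0 H'] := curve_nbhs (near_not_sing finite_sing ns).
have [e'' e''0 H''] := in_dom_near ct pa_le.
have [z [z0 ze ze' ze'']] : exists z : R, [/\ 0 < z, z < e, z < e' & z < e''].
  pose m := Num.min e (Num.min e' e''); have m0 : 0 < m by rewrite !lt_min e0 e'0.
  have : m / 2 < m by lra.
  by rewrite {2}/m !lt_min => /andP[? /andP[? ?]]; exists (m / 2); split => //; lra.
have inside s : 0 < `|s - t| <= z -> `|px c s| < oa G -> in_dom c s /\ ~ cut_at c s.
  move=> sz sa; split; first by apply: H''; case/andP: sz => _ sz; exact: le_lt_trans sz ze''.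
  by case; [apply: (H' s); case/andP: sz => _ sz; exact: le_lt_trans sz ze'|rewrite leNgt sa].
have [_ [_ side]] : _ := H z z ltac:(lra) ltac:(lra).
have nearer x y : 0 < x < e -> 0 < y < e -> (`|px c (t - x)| < oa G -> `|px c (t - y)| < oa G) /\
    (`|px c (t + x)| < oa G -> `|px c (t + y)| < oa G).
  move=> xe ye; have [h1 [h2 h3]] := H x y xe ye; have [g1 [g2 g3]] := H y x ye xe.
  split=> [/h1 out|/h2 out].
    by case: g3 => // out2; have := lt_trans out out2; rewrite ltxx.
  by case: g3 => // out2; have := lt_trans out out2; rewrite ltxx.
case: side => sa.
- have [|ds nc] := inside (t - z) _ sa.
    by rewrite addrAC subrr add0r normrN gtr0_norm// z0 lexx.
  have [l [r [a tlr]]] := arc_exists finite_sing ds nc.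
  exists l, r; split => //; apply/andP; split; first lra.
  rewrite leNgt; apply/negP => rt.
  have [||_] := inside r; last by apply; exact: arc_right a.
  + by rewrite ltr0_norm; lra.
  + have [+ _] := nearer z (t - r) ltac:(lra) ltac:(lra).
    by rewrite subKr; exact.
- have [|ds nc] := inside (t + z) _ sa.
    by rewrite addrAC subrr add0r gtr0_norm// z0 lexx.
  have [l [r [a tlr]]] := arc_exists finite_sing ds nc.
  exists l, r; split => //; apply/andP; split; last lra.
  rewrite leNgt; apply/negP => rt.
  have [||_] := inside l; last by apply; exact: arc_left a.
  + by rewrite gtr0_norm; lra.
  + have [_ +] := nearer z (l - t) ltac:(lra) ltac:(lra).
    by rewrite subrKC; exact.
Qed.

(** Near [u] the coordinate [x] differs from its value at [u], so the curve does not return to the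
    same point, and it stays inside [|x| < a]. The other singular points, being finitely many, are
    at a positive distance. *)
Lemma sing_isolated c u : in_dom c u -> sing (curve c u) ->
  exists2 e, 0 < e & forall s, 0 < `|s - u| < e -> in_dom c s /\ ~ cut_at c s.
Proof.
move=> cu su; have a0 := oa_gt0 G.
have [nx na] : (\forall s \near u, s != u -> px c s != px c u) /\
    (\forall s \near u, s != u -> `|px c s| < oa G).
  have [d0|d0] := eqVneq (dx (f:=J) (c, u)) 0.
    have [_ ua na] := critical_vertical cu d0; split=> //.
    apply: filterS na => s H /H; rewrite -ua; apply: contraTneq => ->.
    by rewrite ltxx.
  have := derive1_neq0_near (@px_derivable _ _ c u) erefl d0 => nd; split.
    apply: filterS nd => s H /H; apply: contraTneq => ->.
    by rewrite subrr mulr0 mul0r ltxx.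
  have ua : `|px c u| < oa G.
    case: su => [/(oms_double (o:=G))[]//|vu].
    have [d [t [dt E d0']]] := verticalP vu.
    have [||cd ut] := regular_unique cu dt; first by rewrite E.
      exact: vertical_not_double.
    by subst d; have [_ Ed _ _] := same_param_curve ut; rewrite Ed d0' eqxx in d0.
  have pc : {for u, continuous (fun x => `|px c x|)} by apply: cvg_norm; exact: px_continuous.
  have : \forall s \near u, `|px c s| < oa G.
    by apply: (pc [set y | y < oa G]); exact: lt_nbhsl.
  by apply: filterS => s.
have ua : `|px c u| <= oa G.
  case: su => [/(oms_double (o:=G))[/ltW]//|vu].
  have [d [t [dt E d0']]] := verticalP vu.
  by have [_ + _] := critical_vertical dt d0'; case: E => <- _ ->.
have [e1 e10 H1] := in_dom_near cu ua.
have cl : closed (sing `\ curve c u).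
  by apply: finite_set_plane_closed; exact: finite_setD.
have nu : (~` (sing `\ curve c u)) (curve c u) by move=> [_] /=.
have ns : \forall q \near curve c u, ~ (sing `\ curve c u) q.
  by have := closed_openC cl; rewrite openE; apply.
have [e2 e20 H2] := curve_nbhs ns.
have [e3 e30 H3] := proj1 (near_distP u _) (filterI nx na).
exists (Num.min e1 (Num.min e2 e3)); first by rewrite !lt_min e10 e20.
move=> s; rewrite !lt_min => /andP[s0 /andP[s1 /andP[s2 s3]]]; split; first exact: H1.
have su' : s != u by rewrite -subr_eq0 -normr_gt0.
have [/(_ su') xs /(_ su') as_] := H3 s s3.
case=> [ss|]; last by rewrite leNgt as_.
by apply: (H2 s s2); split=> // -[E _]; rewrite E eqxx in xs.
Qed.

Lemma arc_from c u : in_dom c u -> sing (curve c u) -> exists r, gamma_arc c u r.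
Proof.
move=> cu su; have [e e0 H] := sing_isolated cu su.
have [|ds nc] := H (u + e / 2); first by rewrite addrAC subrr add0r gtr0_norm; lra.
have [l [r [a tlr]]] := arc_exists finite_sing ds nc.
suff -> : u = l by exists r.
apply/eqP; rewrite eq_le; apply/andP; split; rewrite leNgt; apply/negP => ul.
  by apply: (arc_inside (t:=u) a); [lra|left].
by have [|_] := H l; [rewrite gtr0_norm; lra|apply; exact: arc_left a].
Qed.

Lemma arc_to c u : in_dom c u -> sing (curve c u) -> exists l, gamma_arc c l u.
Proof.
move=> cu su; have [e e0 H] := sing_isolated cu su.
have [|ds nc] := H (u - e / 2); first by rewrite addrAC subrr add0r normrN gtr0_norm; lra.
have [l [r [a tlr]]] := arc_exists finite_sing ds nc.
suff -> : u = r by exists l.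
apply/eqP; rewrite eq_le; apply/andP; split; rewrite leNgt; apply/negP => ul.
  by have [|_] := H r; [rewrite ltr0_norm; lra|apply; exact: arc_right a].
by apply: (arc_inside (t:=u) a); [lra|left].
Qed.

(** An inner point of an arc has a unique parameter in the source, so after an integer shift the two
    arcs overlap, and their ends are the nearest cuts. *)
Lemma arc_piece_inj c d l r l' r' : gamma_arc c l r -> gamma_arc d l' r' ->
  arc_piece c l r = arc_piece d l' r' ->
  c = d /\ exists k : int, [/\ circle c \/ k = 0, l = l' + k%:~R & r = r' + k%:~R].
Proof.
move=> a a' E; pose m := (l + r) / 2; have lmr := arc_mid a.
have := arc_mem a lmr; rewrite E => /(arc_pieceP _ a')[s [slr Es ns]].
have [||cd [k [sk ck]]] := regular_unique (arc_dom (t:=m) a _) (arc_dom a' slr) (esym Es).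
- by rewrite /m; lra.
- by move=> dm; apply: ns; left.
subst d; split=> //; exists k; have a'' := arc_shift ck a'.
suff mlr : l' + k%:~R < m < r' + k%:~R by have [-> ->] := arc_overlap a a'' lmr mlr.
have nm := arc_inside a lmr.
have ml : m != l' + k%:~R by apply/eqP => ml; apply: nm; rewrite -/m ml; exact: arc_left a''.
have mr : m != r' + k%:~R by apply/eqP => mr; apply: nm; rewrite -/m mr; exact: arc_right a''.
rewrite -/m in sk; apply/andP; split; rewrite lt_neqAle; first by rewrite eq_sym ml /=; lra.
by rewrite mr /=; lra.
Qed.

Lemma arc_from_uniq c u r r' : gamma_arc c u r -> gamma_arc c u r' -> r = r'.
Proof.
move=> a a'; have ur := arc_lt a; have ur' := arc_lt a'.
pose m := (u + Num.min r r') / 2.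
have := lexx (Num.min r r'); rewrite le_min => /andP[mr mr'].
have um : u < Num.min r r' by rewrite lt_min ur.
by have [] := arc_overlap (t:=m) a a' _ _; rewrite /m; lra.
Qed.

Lemma arc_to_uniq c u l l' : gamma_arc c l u -> gamma_arc c l' u -> l = l'.
Proof.
move=> a a'; have ur := arc_lt a; have ur' := arc_lt a'.
pose m := (u + Num.max l l') / 2.
have := lexx (Num.max l l'); rewrite ge_max => /andP[mr mr'].
have um : Num.max l l' < u by rewrite gt_max ur.
by have [] := arc_overlap (t:=m) a a' _ _; rewrite /m; lra.
Qed.

(* The half-branches with an end at the parameter [u]. *)
Definition branch c u A : Prop :=
  (exists2 r, gamma_arc c u r & A = arc_piece c u r) \/
  (exists2 l, gamma_arc c l u & A = arc_piece c l u).

Lemma branch_same c s u A : same_param c s u -> branch c s A -> branch c u A.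
Proof.
move=> /same_param_sym[k [-> ck]] [[r a ->]|[l a ->]]; [left; exists (r + k%:~R)|right; exists (l + k%:~R)].
- exact: arc_shift.
- by rewrite arc_piece_shift.
- exact: arc_shift.
- by rewrite arc_piece_shift.
Qed.

Lemma arc_closure c l r p : gamma_arc c l r -> sing p ->
  (closure (arc_piece c l r) p <-> curve c l = p \/ curve c r = p).
Proof.
move=> a sp; have lr := arc_lt a; split.
  have : closed (curve c @` `[l, r]) by exact: arc_image_closed.
  rewrite closure_id => clE; have : closure (arc_piece c l r) `<=` closure (curve c @` `[l, r]).
    by apply: closure_subset => x [].
  rewrite -clE => H /H[t /=]; rewrite in_itv/= => /andP[lt tr] E.
  move: lt; rewrite le_eqVlt => /predU1P[->|lt]; first by left.
  move: tr; rewrite le_eqVlt => /predU1P[<-|tr]; first by right.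
  by have /not_cut[] := arc_inside (t:=t) a ltac:(lra); rewrite E.
case=> <- U /curve_nbhs[e e0 H].
  pose m := Num.min e (r - l); have m0 : 0 < m by rewrite lt_min e0 subr_gt0.
  have := lexx m; rewrite {2}/m le_min => /andP[me mr].
  exists (curve c (l + m / 2)); split; first by apply: arc_mem => //; lra.
  by apply: H; rewrite addrAC subrr add0r gtr0_norm; lra.
pose m := Num.min e (r - l); have m0 : 0 < m by rewrite lt_min e0 subr_gt0.
have := lexx m; rewrite {2}/m le_min => /andP[me mr].
exists (curve c (r - m / 2)); split; first by apply: arc_mem => //; lra.
by apply: H; rewrite addrAC subrr add0r normrN gtr0_norm; lra.
Qed.

Lemma incident_branch p A : sing p -> pieces G A -> closure A p ->
  exists c u, [/\ in_dom c u, curve c u = p & branch c u A].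
Proof.
move=> sp /piece_arc[c [l [r [a ->]]]] /(arc_closure a sp)[E|E].
  exists c, l; split=> //; last by left; exists r.
  by apply: (arc_dom a); have := arc_lt a; lra.
exists c, r; split=> //; last by right; exists l.
by apply: (arc_dom a); have := arc_lt a; lra.
Qed.

Lemma branch_piece c u A : branch c u A -> pieces G A.
Proof. by move=> [[r a ->]|[l a ->]]; exact: arc_is_piece. Qed.

Lemma branch_closure c u A : branch c u A -> sing (curve c u) -> closure A (curve c u).
Proof.
by move=> [[r a ->]|[l a ->]] su; apply/(arc_closure a su); [left|right].
Qed.

(* Otherwise the two ends of an arc would be at the same point, but [px] is
   injective on an arc. *)
Lemma branch_distinct c u r d v l : gamma_arc c u r -> gamma_arc d l v ->
  curve c u = curve d v -> arc_piece c u r <> arc_piece d l v.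
Proof.
move=> a a' E /(arc_piece_inj a a')[cd [k [ck ul rv]]]; subst d.
move: (arc_ends_neq a'); rewrite -E => /eqP; apply.
by rewrite ul curve_shift.
Qed.

Lemma branch_from_distinct c u r d v r' : gamma_arc c u r -> gamma_arc d v r' ->
  ~ (c = d /\ same_param c u v) -> arc_piece c u r <> arc_piece d v r'.
Proof.
by move=> a a' ne /(arc_piece_inj a a')[cd [k [ck ul rv]]]; subst d; apply: ne; split => //; exists k.
Qed.

Lemma branch_to_distinct c u l d v l' : gamma_arc c l u -> gamma_arc d l' v ->
  ~ (c = d /\ same_param c u v) -> arc_piece c l u <> arc_piece d l' v.
Proof.
by move=> a a' ne /(arc_piece_inj a a')[cd [k [ck ul rv]]]; subst d; apply: ne; split => //; exists k.
Qed.

(** A cut that is not singular lies on [x = +-a] and stays in the piece. *)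
Lemma arc_end_point c l r : gamma_arc c l r ->
  (has_end_point G (arc_piece c l r) <-> ~ sing (curve c l) \/ ~ sing (curve c r)).
Proof.
move=> a; have lr := arc_lt a; split.
  move=> [p /(arc_pieceP _ a)[t [/andP[lt tr] E ns]] pa]; rewrite -E in ns pa.
  move: lt; rewrite le_eqVlt => /predU1P[->|lt]; first by left.
  move: tr; rewrite le_eqVlt => /predU1P[<-|tr]; first by right.
  by have /not_cut[_] := arc_inside (t:=t) a ltac:(lra); rewrite pa ltxx.
have H t : l <= t <= r -> cut_at c t -> ~ sing (curve c t) -> has_end_point G (arc_piece c l r).
  move=> tlr [//|ta] ns; exists (curve c t); first by apply/(arc_pieceP _ a); exists t.
  by apply/eqP; rewrite eq_le ta (arc_le a tlr).
by case; apply: H; [lra|exact: arc_left a|lra|exact: arc_right a].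
Qed.

End PieceArcs.

(** * Half-branches at the singular points *)

Section Strands.
Variables (R : realType) (G : oms_divide R).
Hypothesis finite_sing : finite_set (singular_points G).
Let J := oimm G.
Implicit Types (c d : Defs.comp J) (s t u l r e m h : R) (p q : R * R) (A B C : set (R * R)).
Notation sing := (singular_points G).

(* [A] is near [p] a graph over the right ([sg = 1]) or left ([sg = -1]) side of
   [p], with slope [m] at [p]. *)
Record strand p m (sg : R) A : Prop := Strand {
  strand_side : forall q, A q -> 0 < sg * (q.1 - p.1);
  strand_slope : forall e, 0 < e ->
    \forall q \near p, A q -> `|q.2 - p.2 - m * (q.1 - p.1)| <= e * `|q.1 - p.1|;
  strand_cover : forall U, nbhs p U -> exists2 e, 0 < e &
    forall h, 0 < h < e -> exists q, [/\ A q, U q & q.1 = p.1 + sg * h]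
}.

Lemma zero_between (f : R -> R) (s t : R) : s <= t -> (forall x, {for x, continuous f}) ->
  0 < f s * - f t -> exists2 z, s <= z <= t & f z = 0.
Proof.
move=> st cf fst; have wf : {within `[s, t], continuous f} by exact: continuous_subspaceT.
have [|z] := @IVT R f s t 0 st wf; last by rewrite in_itv/= => zst f0; exists z.
by case: (mulr_gt0_cases fst) => -[f1 f2]; rewrite ge_min le_max; apply/andP; split; apply/orP; lra.
Qed.

Lemma px_affine_continuous c (a b : R) x : {for x, continuous (fun t => a * (px c t - b))}.
Proof.
apply: (@continuous_at_mull R a (fun t => px c t - b)).
by apply: cvgB; [exact: px_continuous|exact: cvg_cst].
Qed.

Section Side.
Variables (c : Defs.comp J) (u a : R).
Hypotheses (ua : dx (f:=J) (c, u) = a) (a0 : a != 0).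

Lemma near_side : exists2 e, 0 < e & forall s, `|s - u| < e -> s != u ->
  0 < a * (px c s - px c u) * (s - u).
Proof.
have near1 := derive1_neq0_near (@px_derivable _ _ c u) ua a0.
exact: (proj1 (near_distP u (fun s => s != u -> 0 < a * (px c s - px c u) * (s - u))) near1).
Qed.

(** The difference vanishes only at [u], by injectivity on the arc, so it keeps the sign it has near
    [u]. *)
Lemma arc_from_side r t : gamma_arc c u r -> u < t <= r -> 0 < a * (px c t - px c u).
Proof.
move=> ar /andP[ut tr]; have ur := arc_lt ar; rewrite ltNge le_eqVlt; apply/negP => /orP[|tneg].
  rewrite mulf_eq0 (negPf a0) subr_eq0 => /eqP E.
  by have E' : t = u by [apply: (arc_inj ar _ _ E); lra]; lra.
have [e e0 H] := near_side.
pose k := Num.min e (t - u); have k0 : 0 < k by rewrite lt_min e0 subr_gt0.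
have := lexx k; rewrite {2}/k le_min => /andP[ke kt].
have [|||z zt] := @zero_between (fun t => a * (px c t - px c u)) (u + k / 2) t.
- lra.
- by move=> x; exact: px_affine_continuous.
- have := H (u + k / 2); rewrite addrAC subrr add0r gtr0_norm; last lra.
  have -> : u + k / 2 != u by lra.
  move=> /(_ _ erefl) H1; have {}H1 := H1 ltac:(lra).
  rewrite pmulr_lgt0 in H1; last lra.
  by rewrite mulr_gt0// oppr_gt0.
move/eqP; rewrite mulf_eq0 (negPf a0) subr_eq0 => /eqP E.
by have E' : z = u by [apply: (arc_inj ar _ _ E); lra]; lra.
Qed.

Lemma arc_to_side l t : gamma_arc c l u -> l <= t < u -> a * (px c t - px c u) < 0.
Proof.
move=> ar /andP[lt tu]; have lu := arc_lt ar; rewrite ltNge le_eqVlt; apply/negP => /orP[|tpos].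
  rewrite eq_sym mulf_eq0 (negPf a0) subr_eq0 => /eqP E.
  by have E' : t = u by [apply: (arc_inj ar _ _ E); lra]; lra.
have [e e0 H] := near_side.
pose k := Num.min e (u - t); have k0 : 0 < k by rewrite lt_min e0 subr_gt0.
have := lexx k; rewrite {2}/k le_min => /andP[ke kt].
have [|||z zt] := @zero_between (fun t => a * (px c t - px c u)) t (u - k / 2).
- lra.
- by move=> x; exact: px_affine_continuous.
- have := H (u - k / 2); rewrite addrAC subrr add0r normrN gtr0_norm; last lra.
  have -> : u - k / 2 != u by lra.
  move=> /(_ _ erefl) H1; have {}H1 := H1 ltac:(lra).
  rewrite nmulr_lgt0 in H1; last lra.
  by rewrite mulr_gt0// oppr_gt0.
move/eqP; rewrite mulf_eq0 (negPf a0) subr_eq0 => /eqP E.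
by have E' : z = u by [apply: (arc_inj ar _ _ E); lra]; lra.
Qed.

Variable sg : R.
Hypotheses (sg1 : sg = 1 \/ sg = -1).

Lemma sg_side (x y : R) : 0 < sg * y -> 0 < y * x -> 0 < sg * x.
Proof. by move=> sy /mulr_gt0_cases[] [? ?]; case: sg1 sy => ->; lra. Qed.

Lemma strand_cover_upto t0 (U : set (R * R)) : 0 < sg * (px c t0 - px c u) ->
  (forall z, px c z != px c u -> (u <= z <= t0) || (t0 <= z <= u) -> U (curve c z)) ->
  exists2 e, 0 < e & forall h, 0 < h < e -> exists q, U q /\ q.1 = px c u + sg * h.
Proof.
move=> st0 HU; exists (sg * (px c t0 - px c u)) => // h /andP[h0 hd].
have sh : px c u + sg * h != px c u by case: sg1 => ->; lra.
have find x y : x <= y -> (x = u /\ y = t0) \/ (x = t0 /\ y = u) ->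
    exists2 z, x <= z <= y & px c z = px c u + sg * h.
  move=> xy E; have [|z zxy zE] := @zero_between (fun t => 1 * (px c t - (px c u + sg * h))) x y xy
    (fun x => @px_affine_continuous _ 1 _ x); last by exists z => //; lra.
  rewrite !mul1r; move: st0 hd h0; case: sg1 => ->; rewrite !(mul1r, mulN1r) => H1 H2 H3.
    case: E => -[-> ->]; first by rewrite nmulr_rgt0; lra.
    by rewrite pmulr_rgt0; lra.
  case: E => -[-> ->]; first by rewrite pmulr_rgt0; lra.
  by rewrite nmulr_rgt0; lra.
have [ut|tu] := leP u t0.
  have [z zt E] := find _ _ ut (or_introl (conj erefl erefl)).
  by exists (curve c z); split=> //; apply: HU; rewrite ?E// zt.
have [z zt E] := find _ _ (ltW tu) (or_intror (conj erefl erefl)).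
by exists (curve c z); split=> //; apply: HU; rewrite ?E// zt orbT.
Qed.

Lemma curve_slope_near e : 0 < e -> exists2 k, 0 < k & forall t, `|t - u| < k ->
  `|py c t - py c u - dy (f:=J) (c, u) / a * (px c t - px c u)| <= e * `|px c t - px c u|.
Proof.
move=> e0; have ny := slope_near (@px_derivable _ _ c u) (@py_derivable _ _ c u) ua erefl a0 e0.
exact: (proj1 (near_distP u _) ny).
Qed.

Lemma strand_from r : sing (curve c u) -> gamma_arc c u r -> 0 < sg * a ->
  strand (curve c u) (dy (f:=J) (c, u) / a) sg (arc_piece c u r).
Proof.
move=> su ar sa; have ur := arc_lt ar; split.
- move=> q /(arc_pieceP _ ar)[t [/andP[ut tr] <- ns]].
  apply: sg_side sa _; apply: (arc_from_side ar); rewrite tr andbT lt_neqAle ut andbT.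
  by apply/eqP => E; apply: ns; rewrite -E.
- move=> e e0; have [k k0 H] := curve_slope_near e0.
  (* The part of the arc away from [u] is compact and misses the point, so near the point only
     parameters close to [u] occur. *)
  have np : (~` (curve c @` `[u + k, r])) (curve c u).
    move=> [t /=]; rewrite in_itv/= => /andP[ukt tr] [E _].
    by have E' : t = u by [apply: (arc_inj ar _ _ E); lra]; lra.
  have := closed_openC (@arc_image_closed _ _ c (u + k) r); rewrite openE => /(_ _ np).
  apply: filterS => q nq /(arc_pieceP _ ar)[t [/andP[ut tr] E ns]].
  rewrite -E; apply: H; rewrite ltr_norml; apply/andP; split; first lra.
  rewrite ltNge; apply/negP => kt; apply: nq; exists t => //=.
  by rewrite in_itv/=; lra.
- move=> U /curve_nbhs[e e0 H].
  pose k := Num.min e (r - u); have k0 : 0 < k by rewrite lt_min e0 subr_gt0.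
  have := lexx k; rewrite {2}/k le_min => /andP[ke kt].
  have [||e' e'0 H'] := @strand_cover_upto (u + k / 2) (U `&` arc_piece c u r).
  + by apply: sg_side sa _; apply: (arc_from_side ar); lra.
  + move=> z zu zt; have uz : u < z.
      by rewrite lt_neqAle; apply/andP; split; [apply: contraNneq zu => ->|lra].
    split; last by apply: arc_mem => //; lra.
    by apply: H; rewrite gtr0_norm; lra.
  by exists e' => // h /H'[q [[Uq Aq] E]]; exists q.
Qed.

Lemma strand_to l : sing (curve c u) -> gamma_arc c l u -> sg * a < 0 ->
  strand (curve c u) (dy (f:=J) (c, u) / a) sg (arc_piece c l u).
Proof.
move=> su ar sa; have ur := arc_lt ar.
have sa' : 0 < sg * - a by lra.
split.
- move=> q /(arc_pieceP _ ar)[t [/andP[ut tr] <- ns]].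
  apply: sg_side sa' _; rewrite mulNr oppr_gt0; apply: (arc_to_side ar).
  rewrite ut /= lt_neqAle tr andbT.
  by apply/eqP => E; apply: ns; rewrite E.
- move=> e e0; have [k k0 H] := curve_slope_near e0.
  have np : (~` (curve c @` `[l, u - k])) (curve c u).
    move=> [t /=]; rewrite in_itv/= => /andP[lt tuk] [E _].
    by have E' : t = u by [apply: (arc_inj ar _ _ E); lra]; lra.
  have := closed_openC (@arc_image_closed _ _ c l (u - k)); rewrite openE => /(_ _ np).
  apply: filterS => q nq /(arc_pieceP _ ar)[t [/andP[ut tr] E ns]].
  rewrite -E; apply: H; rewrite ltr_norml; apply/andP; split; last lra.
  rewrite ltNge; apply/negP => kt; apply: nq; exists t => //=.
  by rewrite in_itv/=; lra.
- move=> U /curve_nbhs[e e0 H].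
  pose k := Num.min e (u - l); have k0 : 0 < k by rewrite lt_min e0 subr_gt0.
  have := lexx k; rewrite {2}/k le_min => /andP[ke kt].
  have [||e' e'0 H'] := @strand_cover_upto (u - k / 2) (U `&` arc_piece c l u).
  + by apply: sg_side sa' _; rewrite mulNr oppr_gt0; apply: (arc_to_side ar); lra.
  + move=> z zu zt; have uz : z < u.
      by rewrite lt_neqAle; apply/andP; split; [apply: contraNneq zu => ->|lra].
    split; last by apply: arc_mem => //; lra.
    by apply: H; rewrite ltr0_norm; lra.
  by exists e' => // h /H'[q [[Uq Aq] E]]; exists q.
Qed.

End Side.

Lemma strands_at c u : in_dom c u -> sing (curve c u) -> dx (f:=J) (c, u) != 0 ->
  let m := dy (f:=J) (c, u) / dx (f:=J) (c, u) in
  exists L B, [/\ strand (curve c u) m (-1) L, strand (curve c u) m 1 B,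
    L <> B & forall A, branch c u A <-> A = L \/ A = B].
Proof.
move=> cu su a0 m.
have [r ar] := arc_from finite_sing cu su; have [l al] := arc_to finite_sing cu su.
have ne := branch_distinct ar al erefl.
have bE A : branch c u A <-> A = arc_piece c u r \/ A = arc_piece c l u.
  split=> [[[r' ar' ->]|[l' al' ->]]|[->|->]].
  - by left; rewrite (arc_from_uniq ar ar').
  - by right; rewrite (arc_to_uniq al al').
  - by left; exists r.
  - by right; exists l.
have s1 : (1 : R) = 1 \/ (1 : R) = -1 by left.
have s2 : (-1 : R) = 1 \/ (-1 : R) = -1 by right.
(* The sign of [dx] decides whether the outgoing arc is on the right or on the left. *)
have [an|ap|a0'] := ltgtP (dx (f:=J) (c, u)) 0; last by rewrite a0' eqxx in a0.
- exists (arc_piece c u r), (arc_piece c l u); split=> //.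
    by apply: strand_from => //; lra.
  by apply: strand_to => //; lra.
- exists (arc_piece c l u), (arc_piece c u r); split=> //.
  + by apply: strand_to => //; lra.
  + by apply: strand_from => //; lra.
  + by move=> E; apply: ne.
  + by move=> A; rewrite bE; split=> -[]; [right|left|right|left].
Qed.

(** * The vertical order of two strands on one side of a point *)

Section Above.
Variables (p : R * R) (m1 m2 sg : R) (A B D : set (R * R)).
Hypotheses (sg1 : sg = 1 \/ sg = -1) (sA : strand p m1 sg A) (sB : strand p m2 sg B).
Hypotheses (m12 : 0 < sg * (m1 - m2)) (DE : forall q, D q <-> 0 < sg * (q.1 - p.1)).

Lemma strands_above : above D p A B.
Proof.
(* With a third of the gap of the slopes, the two errors together cannot fill the gap. *)
pose e := sg * (m1 - m2) / 3; have e0 : 0 < e by rewrite divr_gt0.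
exists (fun q => (A q -> `|q.2 - p.2 - m1 * (q.1 - p.1)| <= e * `|q.1 - p.1|) /\
  (B q -> `|q.2 - p.2 - m2 * (q.1 - p.1)| <= e * `|q.1 - p.1|)).
  by apply: filterI; [exact: strand_slope sA _ e0|exact: strand_slope sB _ e0].
move=> q q' [[Aq Dq] [/(_ Aq) Hq _]] [[Bq' Dq'] [_ /(_ Bq') Hq']] E.
move/DE: Dq => Dq; rewrite -E in Hq'.
have hE : `|q.1 - p.1| = sg * (q.1 - p.1).
  by case: sg1 Dq => ->; rewrite ?mul1r ?mulN1r => H; [rewrite gtr0_norm|rewrite ltr0_norm; lra].
move: Hq Hq'; rewrite hE !ler_norml => /andP[H1 _] /andP[_ H2].
have : 0 < e * (sg * (q.1 - p.1)) by rewrite mulr_gt0.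
have : (m1 - m2) * (q.1 - p.1) = 3 * (e * (sg * (q.1 - p.1))).
  by rewrite /e; case: sg1 => ->; field.
lra.
Qed.

Lemma strands_not_below : ~ above D p B A.
Proof.
move=> [U nU H]; have [U' nU' H'] := strands_above.
have [e1 e10 H1] := strand_cover sA (filterI nU nU').
have [e2 e20 H2] := strand_cover sB (filterI nU nU').
(* [strand_cover] provides points of both strands with the same abscissa in the common
   neighbourhood, so the two opposite orders contradict each other there. *)
pose k := Num.min e1 e2; have k0 : 0 < k by rewrite lt_min e10.
have := lexx k; rewrite {2}/k le_min => /andP[k1 k2].
have [q [Aq [Uq U'q] Eq]] := H1 (k / 2) ltac:(lra).
have [q' [Bq [Uq' U'q'] Eq']] := H2 (k / 2) ltac:(lra).
have Dq : D q by apply/DE; exact: strand_side sA _ Aq.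
have Dq' : D q' by apply/DE; exact: strand_side sB _ Bq.
have := H q' q (conj (conj Bq Dq') Uq') (conj (conj Aq Dq) Uq) (etrans Eq' (esym Eq)).
have := H' q q' (conj (conj Aq Dq) U'q) (conj (conj Bq Dq') U'q') (etrans Eq (esym Eq')).
lra.
Qed.

Lemma strand_not_above (C : set (R * R)) m : strand p m sg C -> ~ above D p C C.
Proof.
move=> sC [U nU H]; have [e e0 H1] := strand_cover sC nU.
have [q [Cq Uq Eq]] := H1 (e / 2) ltac:(lra).
have Dq : D q by apply/DE; exact: strand_side sC _ Cq.
by have := H q q (conj (conj Cq Dq) Uq) (conj (conj Cq Dq) Uq) erefl; rewrite ltxx.
Qed.

Lemma strand_half_branch (C : set (R * R)) m : strand p m sg C -> pieces G C ->
  half_branch G D p C.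
Proof.
move=> sC pC; split=> // U nU; have [e e0 H1] := strand_cover sC nU.
have [q [Cq Uq Eq]] := H1 (e / 2) ltac:(lra).
by exists q; split=> //; split=> //; apply/DE; exact: strand_side sC _ Cq.
Qed.

Lemma opposite_half_branch (C : set (R * R)) m : strand p m (- sg) C -> ~ half_branch G D p C.
Proof.
move=> sC [_ /(_ setT filterT)[q [[Cq /DE Dq] _]]].
have := strand_side sC Cq; case: sg1 Dq => ->; lra.
Qed.

Hypotheses (pA : pieces G A) (pB : pieces G B)
  (hb : forall C, half_branch G D p C -> C = A \/ C = B).

Lemma upperP C : upper G D p C <-> C = A.
Proof.
split=> [[/hb[->//|->] [B' /hb[->|->]]]|->].
- by move/strands_not_below.
- by move/(strand_not_above sB).
split; first exact: strand_half_branch sA pA.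
by exists B; [exact: strand_half_branch sB pB|exact: strands_above].
Qed.

Lemma lowerP C : lower G D p C <-> C = B.
Proof.
split=> [[/hb[->|->//] [B' /hb[->|->]]]|->].
- by move/(strand_not_above sA).
- by move/strands_not_below.
split; first exact: strand_half_branch sB pB.
by exists A; [exact: strand_half_branch sA pA|exact: strands_above].
Qed.

End Above.

Lemma branch_disjoint c u d v A : curve c u = curve d v -> ~ (c = d /\ same_param c u v) ->
  branch c u A -> branch d v A -> False.
Proof.
move=> E ne [[r a ->]|[l a ->]] [[r' a' E']|[l' a' E']].
- exact: (branch_from_distinct a a' ne E').
- exact: (branch_distinct a a' E E').
- exact: (branch_distinct a' a (esym E) (esym E')).
- exact: (branch_to_distinct a a' ne E').
Qed.

Lemma double_pieces p : double_points J p -> exists UL LL UR LR,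
  [/\ [/\ UL <> LL, UL <> UR, UL <> LR, LL <> UR & LL <> LR] /\ UR <> LR,
    forall A, (pieces G A /\ closure A p) <-> [\/ A = UL, A = LL, A = UR | A = LR],
    forall A, (upper G (left_of p) p A <-> A = UL) /\ (lower G (left_of p) p A <-> A = LL) &
    forall A, (upper G (right_of p) p A <-> A = UR) /\ (lower G (right_of p) p A <-> A = LR)].
Proof.
move=> dp; have sp : sing p by left.
have nv c u : in_dom c u -> curve c u = p -> dx (f:=J) (c, u) != 0.
  move=> cu E; apply/eqP => d0; have [vp _ _] := critical_vertical cu d0.
  by apply: (@vertical_not_double _ G p) => //; rewrite -E.
(* By symmetry the branch through [u] may be assumed to have the larger slope. *)
suff H c u d v : in_dom c u -> in_dom d v -> curve c u = p -> curve d v = p ->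
    ~ (c = d /\ same_param c u v) ->
    dy (f:=J) (d, v) / dx (f:=J) (d, v) < dy (f:=J) (c, u) / dx (f:=J) (c, u) ->
    (forall c' s, in_dom c' s -> curve c' s = p ->
      (c' = c /\ same_param c s u) \/ (c' = d /\ same_param d s v)) ->
    exists UL LL UR LR,
  [/\ [/\ UL <> LL, UL <> UR, UL <> LR, LL <> UR & LL <> LR] /\ UR <> LR,
    forall A, (pieces G A /\ closure A p) <-> [\/ A = UL, A = LL, A = UR | A = LR],
    forall A, (upper G (left_of p) p A <-> A = UL) /\ (lower G (left_of p) p A <-> A = LL) &
    forall A, (upper G (right_of p) p A <-> A = UR) /\ (lower G (right_of p) p A <-> A = LR)].
  have [c [u [d [v [cu dv Eu Ev [ne tr pre]]]]]] := doubleP dp.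
  have a0 := nv _ _ cu Eu; have b0 := nv _ _ dv Ev.
  have [m|m|m] := ltgtP (dy (f:=J) (d, v) / dx (f:=J) (d, v)) (dy (f:=J) (c, u) / dx (f:=J) (c, u)).
  - exact: (H c u d v).
  - apply: (H d v c u) => //.
      by move=> [dc]; subst d => /same_param_sym uv; apply: ne.
    by move=> c' s cs E; case: (pre c' s cs E); [right|left].
  (* Equal slopes would contradict transversality. *)
  - move: tr; rewrite subr_eq0 => /eqP[].
    by move/eqP: m; rewrite eqr_div// => /eqP <-; exact: mulrC.
move=> cu dv Eu Ev ne m pre; have a0 := nv _ _ cu Eu; have b0 := nv _ _ dv Ev.
have [|L1 [R1]] := strands_at cu _ a0; first by rewrite Eu.
have [|L2 [R2]] := strands_at dv _ b0; first by rewrite Ev.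
rewrite Eu Ev; set m2 := _ / _ in m *; set m1 := _ / dx (c, u) in m *.
move=> [sL2 sR2 ne2 b2] [sL1 sR1 ne1 b1].
have dis A : A = L1 \/ A = R1 -> A = L2 \/ A = R2 -> False.
  by move=> /b1 H1 /b2 H2; apply: (branch_disjoint _ ne H1 H2); rewrite Eu.
have inc A : (pieces G A /\ closure A p) <-> [\/ A = L2, A = L1, A = R1 | A = R2].
  split=> [[pA cA]|].
    have [c' [s [cs Es]]] := incident_branch finite_sing sp pA cA.
    case: (pre c' s cs Es) => -[-> ss] /(branch_same ss) bA.
      by move/b1: bA => [] ->; [apply: Or42|apply: Or43].
    by move/b2: bA => [] ->; [apply: Or41|apply: Or44].
  have K1 : A = L1 \/ A = R1 -> pieces G A /\ closure A p.
    move=> /b1 bA; split; first exact: branch_piece bA.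
    by rewrite -Eu; apply: branch_closure => //; rewrite Eu.
  have K2 : A = L2 \/ A = R2 -> pieces G A /\ closure A p.
    move=> /b2 bA; split; first exact: branch_piece bA.
    by rewrite -Ev; apply: branch_closure => //; rewrite Ev.
  by case=> E; [apply: K2; left|apply: K1; left|apply: K1; right|apply: K2; right].
have [pL2 _] : pieces G L2 /\ closure L2 p by apply/inc; apply: Or41.
have [pL1 _] : pieces G L1 /\ closure L1 p by apply/inc; apply: Or42.
have [pR1 _] : pieces G R1 /\ closure R1 p by apply/inc; apply: Or43.
have [pR2 _] : pieces G R2 /\ closure R2 p by apply/inc; apply: Or44.
have hbE D A : half_branch G D p A -> [\/ A = L2, A = L1, A = R1 | A = R2].
  move=> [pA cA]; apply/inc; split=> //.
  by move: cA; apply: closure_subset => x [].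
have left_side q : left_of p q <-> 0 < -1 * (q.1 - p.1).
  by rewrite /left_of /= mulN1r oppr_gt0 subr_lt0.
have right_side q : right_of p q <-> 0 < 1 * (q.1 - p.1).
  by rewrite /right_of /= mul1r subr_gt0.
have s1 : (1 : R) = 1 \/ (1 : R) = -1 by left.
have s2 : (-1 : R) = 1 \/ (-1 : R) = -1 by right.
have sR1' : strand p m1 (- -1) R1 by rewrite opprK.
have sR2' : strand p m2 (- -1) R2 by rewrite opprK.
have hbl C : half_branch G (left_of p) p C -> C = L2 \/ C = L1.
  move=> hC; case: (hbE _ _ hC) => E; [by left|by right| |].
    by rewrite E in hC; have [] := opposite_half_branch s2 left_side sR1' hC.
  by rewrite E in hC; have [] := opposite_half_branch s2 left_side sR2' hC.
have hbr C : half_branch G (right_of p) p C -> C = R1 \/ C = R2.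
  move=> hC; case: (hbE _ _ hC) => E; [| |by left|by right].
    by rewrite E in hC; have [] := opposite_half_branch s1 right_side sL2 hC.
  by rewrite E in hC; have [] := opposite_half_branch s1 right_side sL1 hC.
have ml : 0 < -1 * (m2 - m1) by lra.
have mr : 0 < 1 * (m1 - m2) by lra.
(* The branch of larger slope [m1] is the lower one on the left and the upper one on the right. *)
exists L2, L1, R1, R2; split=> //.
- split; last by move=> E; apply: (dis R1); right.
  split=> // E.
  + by apply: (dis L1); left.
  + by apply: (dis L2); [right|left].
  + by apply: (dis L1); [left|right].
- move=> A; split.
    exact: (upperP s2 sL2 sL1 ml left_side pL2 pL1 hbl).
  exact: (lowerP s2 sL2 sL1 ml left_side pL2 pL1 hbl).
move=> A; split.
  exact: (upperP s1 sR1 sR2 mr right_side pR1 pR2 hbr).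
exact: (lowerP s1 sR1 sR2 mr right_side pR1 pR2 hbr).
Qed.

Lemma vertical_pieces p : vertical_points J p -> exists B C,
  B <> C /\ forall A, (pieces G A /\ closure A p) <-> A = B \/ A = C.
Proof.
move=> vp; have sp : sing p by right.
have [c [u [cu Eu d0]]] := verticalP vp.
have su : sing (curve c u) by rewrite Eu.
have [r ar] := arc_from finite_sing cu su; have [l al] := arc_to finite_sing cu su.
exists (arc_piece c u r), (arc_piece c l u); split.
  exact: (branch_distinct ar al erefl).
have bA A : A = arc_piece c u r \/ A = arc_piece c l u -> branch c u A.
  by case=> ->; [left; exists r|right; exists l].
move=> A; split=> [[pA cA]|/bA bA']; last first.
  by split; [exact: branch_piece bA'|rewrite -Eu; exact: branch_closure].
have [c' [s [cs Es]]] := incident_branch finite_sing sp pA cA.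
have [||cc su'] := regular_unique cs cu; first by rewrite Es Eu.
  by rewrite Es; exact: vertical_not_double.
subst c' => /(branch_same su')[[r' ar' ->]|[l' al' ->]].
  by left; rewrite (arc_from_uniq ar ar').
by right; rewrite (arc_to_uniq al al').
Qed.

End Strands.

(** * The diagram of a divide *)

Lemma uniq4 (T : eqType) (a b c d : T) : a <> b -> a <> c -> a <> d -> b <> c -> b <> d ->
  c <> d -> uniq [:: a; b; c; d].
Proof.
move=> /eqP ab /eqP ac /eqP ad /eqP bc /eqP bd /eqP cd.
by rewrite /= !inE !negb_or ab ac ad bc bd cd.
Qed.

Section DiagramOf.
Variables (R : realType) (G : oms_divide R).
Notation D := (diagram_of G).

Section Finite.
Hypotheses (finite_sing : finite_set (singular_points G)) (finite_pieces : finite_set (pieces G)).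

Lemma sing_singular (p : sing D) : singular_points G (fsval p).
Proof. by have := fsvalP p; rewrite in_fset_set// inE. Qed.

Lemma singular_sing q : singular_points G q -> exists p : sing D, fsval p = q.
Proof.
move=> sq; have qs : q \in fset_set (singular_points G) by rewrite in_fset_set// inE.
by exists [` qs]%fset.
Qed.

Lemma piece_pieces (A : piece D) : pieces G (fsval A).
Proof. by have := fsvalP A; rewrite in_fset_set// inE. Qed.

Lemma pieces_piece B : pieces G B -> exists A : piece D, fsval A = B.
Proof.
move=> pB; have Bp : B \in fset_set (pieces G) by rewrite in_fset_set// inE.
by exists [` Bp]%fset.
Qed.

Lemma card_sing_at (q : R * R) :
  #|[set p : sing D | fsval p == q]%SET| = `[< singular_points G q >].
Proof.
have [sq|nq] := asboolP (singular_points G q).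
  have [p pq] := singular_sing sq; rewrite -[RHS](cards1 p); apply: eq_card => p'.
  by rewrite !inE -pq (inj_eq val_inj).
apply: eq_card0 => p; rewrite inE; apply/negP => /eqP pq; apply: nq.
by rewrite -pq; exact: sing_singular.
Qed.

(** The two ends of an arc are distinct points, so nothing is counted twice. *)
Lemma degree_at_arc (A : piece D) (c : Defs.comp (oimm G)) l r : gamma_arc c l r ->
  fsval A = arc_piece c l r ->
  degree_at A = (`[< singular_points G (curve c l) >] + `[< singular_points G (curve c r) >])%N.
Proof.
move=> a AE; rewrite /degree_at -!card_sing_at.
rewrite -cardsUI [X in (_ + X)%N](_ : _ = 0%N) ?addn0.
  apply: eq_card => p; rewrite !inE /=; apply/asboolP/orP; rewrite AE.
    by case/(arc_closure a (sing_singular p)) => ->; [left|right].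
  by move=> H; apply/(arc_closure a (sing_singular p)); case: H => /eqP->; [left|right].
apply: eq_card0 => p; rewrite !inE; apply/negP => /andP[/eqP-> ].
exact/negP/(arc_ends_neq a).
Qed.

Lemma ended_degree (A : piece D) : (degree_at A <= 2)%N /\ ended A = (degree_at A < 2)%N.
Proof.
have [c [l [r [a AE]]]] := piece_arc finite_sing (piece_pieces A).
rewrite (degree_at_arc a AE); split; first by do 2!case: asbool.
have -> : ended A = ~~ `[< singular_points G (curve c l) >] || ~~ `[< singular_points G (curve c r) >].
  by rewrite /= /ended_of AE (asbool_equiv_eq (arc_end_point a)) asbool_or !asbool_neg.
by do 2!case: asbool.
Qed.

(** The conditions of [well_formed] at a single point, from which [choice] builds the global
    numbering. *)
Definition numbering (p : sing D) (n : nat -> piece D) : Prop :=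
  let s := [seq n i | i <- iota 0 (nnodes (is_vert (kind p)))] in
  [/\ uniq s, forall A, incident p A = (A \in s) &
    forall b A B, A != B -> joined b p A B =
      linked [seq (n e.1, n e.2) | e <- joins (is_vert (kind p)) (b (+) is_neg (kind p))] A B].

Lemma vertical_numbering (p : sing D) : vertical_points (oimm G) (fsval p) -> exists n, numbering p n.
Proof.
move=> vp; have [B [C [BC H]]] := vertical_pieces finite_sing vp.
have [pB _] : pieces G B /\ closure B (fsval p) by apply/H; left.
have [pC _] : pieces G C /\ closure C (fsval p) by apply/H; right.
have [b bB] := pieces_piece pB; have [c cC] := pieces_piece pC.
have bc : b != c by apply/eqP => bc; apply: BC; rewrite -bB -cC bc.
have kV : @kind D p = Vert.
  by rewrite /= /kind_of asboolF//; exact: vertical_not_double.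
have inc (A : piece D) : @incident D p A = (A \in [:: b; c]).
  rewrite !inE -!(inj_eq val_inj) /= bB cC; apply/asboolP/orP => [cA|].
    have /H : pieces G (fsval A) /\ closure (fsval A) (fsval p).
      by split=> //; exact: piece_pieces.
    by case=> ->; [left|right].
  by move=> E; have [] : pieces G (fsval A) /\ closure (fsval A) (fsval p);
    [apply/H; case: E => /eqP; [left|right]|].
exists (nth b [:: b; c]); rewrite /numbering kV /=; split=> //.
- by rewrite inE bc.
- move=> th A A' AA; rewrite /joined /= /joined_of -[kind_of p]/(@kind D p) kV /=.
  have -> : incident_of p A = (A \in [:: b; c]) by exact: inc.
  have -> : incident_of p A' = (A' \in [:: b; c]) by exact: inc.
  rewrite addbF /linked; case: th => //=; rewrite !inE !xpair_eqE.
  apply/andP/orP => [[/orP[] /eqP EA /orP[] /eqP EA']|].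
  + by rewrite EA EA' eqxx in AA.
  + by left; rewrite EA EA' !eqxx.
  + by right; rewrite EA EA' !eqxx.
  + by rewrite EA EA' eqxx in AA.
  by case=> /andP[/eqP-> /eqP->]; rewrite !eqxx ?orbT.
Qed.

Lemma double_numbering (p : sing D) : double_points (oimm G) (fsval p) -> exists n, numbering p n.
Proof.
move=> dp; have [UL [LL [UR [LR [[[n1 n2 n3 n4 n5] n6] H Hl Hr]]]]] := double_pieces finite_sing dp.
have [pUL _] : pieces G UL /\ closure UL (fsval p) by apply/H; apply: Or41.
have [pLL _] : pieces G LL /\ closure LL (fsval p) by apply/H; apply: Or42.
have [pUR _] : pieces G UR /\ closure UR (fsval p) by apply/H; apply: Or43.
have [pLR _] : pieces G LR /\ closure LR (fsval p) by apply/H; apply: Or44.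
have [ul ulE] := pieces_piece pUL; have [ll llE] := pieces_piece pLL.
have [ur urE] := pieces_piece pUR; have [lr lrE] := pieces_piece pLR.
have vE (A B : piece D) : (A == B) = (fsval A == fsval B) by rewrite (inj_eq val_inj).
have inc (A : piece D) : @incident D p A = (A \in [:: ul; ll; ur; lr]).
  rewrite !inE !vE ulE llE urE lrE; apply/asboolP/or4P => [cA|].
    have /H : pieces G (fsval A) /\ closure (fsval A) (fsval p).
      by split=> //; exact: piece_pieces.
    by case=> ->; [apply: Or41|apply: Or42|apply: Or43|apply: Or44].
  move=> E; have [] : pieces G (fsval A) /\ closure (fsval A) (fsval p) => //.
  by apply/H; case: E => /eqP; [apply: Or41|apply: Or42|apply: Or43|apply: Or44].
have un : uniq [:: ul; ll; ur; lr].
  have neq (a b : piece D) A B : fsval a = A -> fsval b = B -> A <> B -> a <> b.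
    by move=> <- <- AB E; apply: AB; rewrite E.
  apply: uniq4; [exact: (neq _ _ _ _ ulE llE)|exact: (neq _ _ _ _ ulE urE)|
    exact: (neq _ _ _ _ ulE lrE)|exact: (neq _ _ _ _ llE urE)|exact: (neq _ _ _ _ llE lrE)|
    exact: (neq _ _ _ _ urE lrE)].
have upl A : upper G (left_of (fsval p)) (fsval p) (fsval A) <-> A = ul.
  by rewrite (Hl _).1 -ulE; split=> [/val_inj|->].
have lol A : lower G (left_of (fsval p)) (fsval p) (fsval A) <-> A = ll.
  by rewrite (Hl _).2 -llE; split=> [/val_inj|->].
have upr A : upper G (right_of (fsval p)) (fsval p) (fsval A) <-> A = ur.
  by rewrite (Hr _).1 -urE; split=> [/val_inj|->].
have lor A : lower G (right_of (fsval p)) (fsval p) (fsval A) <-> A = lr.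
  by rewrite (Hr _).2 -lrE; split=> [/val_inj|->].
have linkE (P Q P' Q' : set (R * R) -> Prop) (x y x' y' : piece D) A B :
    (forall A, P (fsval A) <-> A = x) -> (forall A, Q (fsval A) <-> A = y) ->
    (forall A, P' (fsval A) <-> A = x') -> (forall A, Q' (fsval A) <-> A = y') ->
    `[< link P Q (fsval A) (fsval B) \/ link P' Q' (fsval A) (fsval B) >] =
    linked [:: (x, y); (x', y')] A B.
  move=> HP HQ HP' HQ'; rewrite /linked !inE !xpair_eqE /link.
  apply/asboolP/idP; rewrite !HP !HQ !HP' !HQ'.
    by case=> -[] [-> ->]; rewrite !eqxx ?orbT.
  by case/orP => /orP[] /andP[/eqP-> /eqP->]; [left; left|right; left|left; right|right; right].
have t0 A B : `[< theta0_double G (fsval p) (fsval A) (fsval B) >] =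
    linked [:: (ul, ur); (ll, lr)] A B by exact: linkE.
have t1 A B : `[< theta1_double G (fsval p) (fsval A) (fsval B) >] =
    linked [:: (ul, ll); (ur, lr)] A B by exact: linkE.
have kE : @kind D p = if osign G (fsval p) then Pos else Neg by rewrite /= /kind_of asboolT.
case: (osign G (fsval p)) kE => kE.
  exists (nth ul [:: ul; ll; ur; lr]); rewrite /numbering kE; split=> // b A B AB.
  by rewrite /joined /= /joined_of -[kind_of p]/(@kind D p) kE /= t0 t1; case: b.
(* Negative case: with [ll] and [ur] exchanged, the edges of Theta_0 become those of
   [joins false true]. *)
exists (nth ul [:: ul; ur; ll; lr]); rewrite /numbering kE; split.
- rewrite -(perm_uniq (s1 := [:: ul; ll; ur; lr]))//.
  by apply/permP => a; congr (_ + _)%N; exact: addnCA.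
- by move=> A; rewrite inc !inE; do 4!case: (_ == _).
- move=> b A B AB.
  by rewrite /joined /= /joined_of -[kind_of p]/(@kind D p) kE /= t0 t1; case: b.
Qed.

Lemma diagram_well_formed : exists nd, well_formed (D := D) nd.
Proof.
have [p|nd ndP] := @choice _ _ numbering.
  by case: (sing_singular p); [exact: double_numbering|exact: vertical_numbering].
exists nd; split.
- by move=> p; have [] := ndP p.
- by move=> p; have [] := ndP p.
- by move=> p b A B AB; have [_ _ ->] := ndP p.
- by move=> A; have [] := ended_degree A.
- by move=> A; have [] := ended_degree A.
Qed.

End Finite.

Lemma fset_set_infinite (T : choiceType) (A : set T) : ~ finite_set A -> fset_set A = fset0.
Proof. by move=> nA; rewrite /fset_set; case: pselect. Qed.

(* [fset_set] sends an infinite set to the empty one, and then the differential is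
   zero: the finiteness of these sets is not needed. *)
Lemma no_contribution : ~ (finite_set (singular_points G) /\ finite_set (pieces G)) ->
  forall (r : sing D) x y, ~~ contribution r x y.
Proof.
move=> nf r x y; have [fs|/fset_set_infinite E] := pselect (finite_set (singular_points G)).
  have [fp|/fset_set_infinite E] := pselect (finite_set (pieces G)); first by case: nf.
  have no (A : piece D) : False.
    by have := fsvalP A; move: (fsval A) => B; rewrite E inE.
  (* Without pieces there are no components, so every profile is zero, and no rule starts from the
     zero profile. *)
  have prof0 : profile r x = (0, 0, 0, 0)%N.
    have pos C : (C \in positive x) = false.
      by apply/negP => /(fintype.subsetP (valP x))/imsetP[A]; case: (no A).
    have neg C : (C \in negative x) = false.
      by apply/negP; rewrite inE => /andP[_ /imsetP[A]]; case: (no A).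
    by congr (_, _, _, _); apply: eq_card0 => C; rewrite inE ?pos ?neg.
  apply/negP => /and4P[_ _ _]; rewrite prof0.
  have : all (fun e => e.1 != (0, 0, 0, 0)%N)
    (if is_vert (kind r) then vertical_rules else double_rules) by case: is_vert.
  by move=> /allP H /H; rewrite eqxx.
by have := fsvalP r; move: (fsval r) => q; rewrite E inE.
Qed.

End DiagramOf.

(* [W s] is the polynomial with [sqrt t] replaced by [s], so that the left-hand
   side is W(t^2). *)
Theorem proposition3p16 (R : realType) (Gamma : oms_divide R) :
  W (diagram_of Gamma) tvar =
  tvar / (1 + tvar ^+ 2) * chi_gr (diagram_of Gamma) tvar.
Proof.
have [[fs fp]|nf] :=
  pselect (finite_set (singular_points Gamma) /\ finite_set (pieces Gamma)).
  have [nd wf] := diagram_well_formed fs fp.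
  apply: W_chi_gr tvar_neq0 tvar_sqr_neq0.
  - exact: (contribution_degree wf).
  - exact: differentialE.
  - exact: (differentialK wf).
(* In the degenerate case the differential is zero, so it squares to zero, and the condition on
   degrees is vacuous. *)
have no := no_contribution nf.
apply: W_chi_gr tvar_neq0 tvar_sqr_neq0.
- by move=> r x y; rewrite (negPf (no r x y)).
- exact: differentialE.
move=> f; apply/ffunP => y; rewrite differentialE ffunE.
by rewrite big1// => r _; rewrite big1// => x; rewrite (negPf (no r x y)).
Qed.
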